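(* The following identities hold: $$\mathscr A_{1,0}=\frac{\pi}{3\sqrt3},\qquad \mathscr A_{1,1}=-\frac{2\operatorname{Im}\mu_2}{\sqrt3},\qquad \mathscr A_{1,2}=\frac{2^2\pi^3}{3^3\sqrt3},\qquad \mathscr A_{1,3}=-\frac{2\operatorname{Im}(2\cdot3^2\mu_4-\pi^2\mu_2)}{\sqrt3},$$ $$\mathscr A_{1,4}=-\frac{2^5\cdot3\operatorname{Im}(\mu_{4,1}+\zeta_3\mu_2)}{\sqrt3}+\frac{2\cdot67\pi^5}{3^5\sqrt3},$$ $$\mathscr A_{1,5}=-\frac{2\cdot3\operatorname{Im}(2^3\cdot3^2\cdot5\mu_6-2^2\cdot5\pi^2\mu_4-\pi^4\mu_2)}{\sqrt3},$$ $$\mathscr A_{1,6}=-\frac{2^6\cdot3^3\cdot5\operatorname{Im}(\mu_{6,1}+\zeta_3\mu_4+\zeta_5\mu_2)}{\sqrt3}+\frac{2^5\cdot3\cdot5\pi^2\operatorname{Im}(\mu_{4,1}+\zeta_3\mu_2)}{\sqrt3}+\frac{2^2\cdot5\cdot13^2\pi^7}{3^6\sqrt3},$$ $$\begin{aligned}\mathscr A_{1,7}={}&-\frac{2\operatorname{Im}\left[2^4\cdot3^4\cdot5\cdot7\mu_8-2^3\cdot3\cdot5\cdot7\cdot23\pi^2\mu_6-2\cdot3^4\cdot7\pi^4\mu_4+(2^5\cdot3^3\cdot5\cdot7\zeta_3^2-79\pi^6)\mu_2\right]}{3\sqrt3}\\&-\frac{2^7\cdot3^2\cdot5\cdot7\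operatorname{Im}(\mu_{6,1,1}+\zeta_3\mu_{4,1})}{\sqrt3}-\frac{2^2\cdot5\cdot7\pi\left(3\cdot5\cdot659\zeta_7+2^3\cdot3^3\cdot7\pi^2\zeta_5+2^2\cdot17\pi^4\zeta_3\right)}{3^4\sqrt3}.\end{aligned}$$
   Context: For real $x>0$ put $\binom{2x}{x}:=\frac{\Gamma(2x+1)}{[\Gamma(x+1)]^2}$, and for integers $s\ge1$, $n\ge0$ define $$\mathscr A_{s,n}:=\sum_{k=1}^\infty\left.\frac{\partial^n}{\partial x^n}\frac{1}{x^s\binom{2x}{x}}\right|_{x=k}.$$ Here $\zeta_a=\sum_{k\ge1}k^{-a}$. For positive integers $a_1,\dots,a_n$, the multiple Clausen value (MCV) is $$\mu_{a_1,\dots,a_n}:=\sum_{\ell_1>\dots>\ell_n>0}\frac{e^{\ell_1\pi i/3}}{\ell_1^{a_1}}\prod_{j=2}^n\frac1{\ell_j^{a_j}}$$ (limit as $L\to\infty$ of partial sums over $\ell_1\le L$). *)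

(* Defs.v *)
From HB Require Import structures.
From mathcomp Require Import all_boot all_order all_algebra.
From mathcomp Require Import all_classical all_reals all_analysis.
From mathcomp Require Import complex.
Import Order.TTheory GRing.Theory Num.Theory.
Import numFieldNormedType.Exports.

Set Implicit Arguments.
Unset Strict Implicit.
Unset Printing Implicit Defensive.

Local Open Scope ring_scope.
Local Open Scope classical_set_scope.

(* Euler's integral; it is only meant (and only finite) for 0 < x. *)
Definition Gamma {R : realType} (x : R) : R :=
  \int[lebesgue_measure]_(t in `]0, +oo[) (t `^ (x - 1) * expR (- t)).

Definition central_binom {R : realType} (x : R) : R :=
  Gamma (2 * x + 1) / Gamma (x + 1) ^+ 2.

Definition inv_binom {R : realType} (s : nat) (x : R) : R :=
  1 / (x ^+ s * central_binom x).

Definition A_partial {R : realType} (s n : nat) (N : nat) : R :=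
  \sum_(1 <= k < N.+1) derive1n n (inv_binom s) k%:R.

Definition A {R : realType} (s n : nat) : R := limn (A_partial s n).

(* derive1n and limn are total functions: this says that the derivatives and
   the limit used in A exist. *)
Definition A_exists (R : realType) (s n : nat) : Prop :=
  (forall (m : nat) (x : R), (m < n)%N -> 0 < x ->
     derivable (derive1n m (inv_binom s)) x 1) /\
  cvgn (@A_partial R s n).

Definition zeta {R : realType} (a : nat) : R :=
  limn (fun N => \sum_(1 <= k < N.+1) 1 / k%:R ^+ a : R).

(* e^(i theta) *)
Definition cis {R : realType} (theta : R) : R[i] :=
  Complex (cos theta) (sin theta).

(* nested_sum [:: a_2; ...; a_n] l is the sum over l > l_2 > ... > l_n > 0 of
   the product of the 1 / l_j ^ a_j; it is 1 on the empty sequence. *)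
Fixpoint nested_sum {R : realType} (a : seq nat) (l : nat) : R :=
  if a is b :: a' then
    \sum_(1 <= j < l) (1 / j%:R ^+ b) * nested_sum a' j
  else 1.

(* The regular algebra R[i]^o carries the norm topology of the complex
   numbers. *)
Definition mu_partial {R : realType} (a1 : nat) (a : seq nat) (L : nat) :
    R[i]^o :=
  \sum_(1 <= l < L.+1)
    cis (l%:R * pi / 3) / l%:R ^+ a1 * real_complex R (nested_sum a l).

(* mu a_1 [:: a_2; ...; a_n] is the multiple Clausen value. *)
Definition mu {R : realType} (a1 : nat) (a : seq nat) : R[i] :=
  limn (mu_partial a1 a).

(* Main.v *)
(** Let f(x) = 1 / (x binom(2x, x)) and y = (2 sin (t/2))^2. Because of the recursion
    (4x + 2) f(x + 1) = x f(x), the sum over k of the n-th Taylor coefficients of f at k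
    telescopes against the functions 2 sin t y^(k-1) (ln y)^i / i!: up to the factor
    n! / sqrt 3, the value A_{1,n} is the integral over ]0, pi/3[ of the sum of
    c_{n-i} (ln y)^i / i!, where the c_m are the Taylor coefficients of 1 / binom(2x, x)
    at 0. Those are polynomials in zeta values, by the product formula for Gamma.
    On the arc w = 1 - e^(-it), which joins 0 to omega = e^(i pi/3), one has
    log w = ln (2 sin (t/2)) + i (pi - t)/2 and log (1 - w) = -it. Hence Nielsen's
    polylogarithms at omega, which are the multiple Clausen values, are linear
    combinations of the moments of ln (2 sin (t/2)) and t over the arc. Deforming the
    path w -> 1 - w from the ray [0, omega] gives linear relations between these moments
    and the values of the polylogarithms at 1. Together with the distribution relation
    for the real part of Li_k(omega) and Euler's evaluation of zeta(5, 1), they imply the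
    identities by linear algebra over the rational numbers. *)

Require Import Defs.
From HB Require Import structures.
From mathcomp Require Import all_boot all_order all_algebra.
From mathcomp Require Import all_classical all_reals all_analysis.
From mathcomp Require Import measurable_realfun.
From mathcomp Require Import complex.
From mathcomp Require Import ring lra.
Import Order.TTheory GRing.Theory Num.Theory.
Import numFieldNormedType.Exports.

Set Implicit Arguments.
Unset Strict Implicit.
Unset Printing Implicit Defensive.

Local Open Scope ring_scope.
Local Open Scope classical_set_scope.

(** Two obstacles shape the proof. First, [Gamma] is differentiated under the integral sign only at
    arguments above 1, so the Taylor coefficients of 1 / binom(2x, x) at 0 are read off the
    recursion from those of f at 1. Their zeta values come from a one-sided expansion with error
    O(x^8), which determines the coefficients up to x^7, as n <= 7 requires. Second, the integrands
    are logarithmically singular at 0 and the polylogarithms are evaluated on the unit circle. Hence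
    integrals over the arc are limits of primitives ([Jint]), limits on the circle rest on a
    dominating series of terms l^(-3/2), and path deformation becomes the statement that a function
    with zero derivative has equal limits at both ends. A_{1,n} involves only pure moments of ln (2
    sin (t/2)), whereas an MCV also brings in mixed moments with powers of t, which are not known
    individually. The relations eliminate them: each identity is certified by explicit multipliers
    and holds for arbitrary numbers in place of the unknown moments. The same relations yield
    zeta(2), zeta(4) and zeta(6). *)

Section RealDerivatives.
Context {R : realType}.
Implicit Types (f g : R -> R) (x c : R).

(** * Derivatives and limits of real functions *)

Lemma derivD f g x (df dg : R) : is_derive x 1 f df -> is_derive x 1 g dg ->
  is_derive x 1 (fun y => f y + g y) (df + dg).
Proof. by move=> hf hg; exact: is_deriveD. Qed.

Lemma derivB f g x (df dg : R) : is_derive x 1 f df -> is_derive x 1 g dg ->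
  is_derive x 1 (fun y => f y - g y) (df - dg).
Proof. by move=> hf hg; exact: is_deriveB. Qed.

Lemma derivN f x (df : R) : is_derive x 1 f df ->
  is_derive x 1 (fun y => - f y) (- df).
Proof. by move=> hf; exact: is_deriveN. Qed.

Lemma derivM f g x (df dg : R) : is_derive x 1 f df -> is_derive x 1 g dg ->
  is_derive x 1 (fun y => f y * g y) (df * g x + f x * dg).
Proof.
move=> hf hg; apply: (is_derive_eq (is_deriveM hf hg)).
by rewrite addrC /GRing.scale/= (mulrC df).
Qed.

Lemma derivC c x : is_derive x 1 (fun=> c) 0.
Proof. exact: is_derive_cst. Qed.

Lemma deriv_id x : is_derive x 1 (fun y : R => y) 1.
Proof. exact: is_derive_id. Qed.

Lemma derivZ f x c (df : R) : is_derive x 1 f df ->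
  is_derive x 1 (fun y => c * f y) (c * df).
Proof. by move=> hf; apply: (is_derive_eq (derivM (derivC c x) hf)); rewrite mul0r add0r. Qed.

Lemma deriv_comp f g x (df dg : R) : is_derive (g x) 1 f df -> is_derive x 1 g dg ->
  is_derive x 1 (fun y => f (g y)) (df * dg).
Proof. by move=> hf hg; exact: is_derive1_comp. Qed.

Lemma derivX f x (df : R) n : is_derive x 1 f df ->
  is_derive x 1 (fun y => f y ^+ n) (n%:R * f x ^+ n.-1 * df).
Proof.
move=> hf; elim: n => [|n ih].
  rewrite (_ : (fun _ => _) = fun=> 1); last by apply/funext => y; rewrite expr0.
  by apply: (is_derive_eq (derivC _ _)); rewrite !mul0r.
rewrite (_ : (fun _ => _) = (fun y => f y * f y ^+ n)); last first.
  by apply/funext => y; rewrite exprS.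
apply: (is_derive_eq (derivM hf ih)) => /=.
case: n {ih} => [|n]/=; first by rewrite !expr0; ring.
by rewrite -[in RHS]natr1 exprS; ring.
Qed.

Lemma derivV f x (df : R) : f x != 0 -> is_derive x 1 f df ->
  is_derive x 1 (fun y => (f y)^-1) (- df / f x ^+ 2).
Proof.
move=> fx0 hf; apply: (is_derive_eq (is_deriveV fx0 hf)).
by rewrite /GRing.scale/= !mulNr mulrC.
Qed.

Lemma deriv_sum n (h : nat -> R -> R) x (dh : nat -> R) :
  (forall i, (i < n)%N -> is_derive x 1 (h i) (dh i)) ->
  is_derive x 1 (fun y => \sum_(i < n) h i y) (\sum_(i < n) dh i).
Proof.
elim: n => [|n ih] H.
  rewrite big_ord0 (_ : (fun _ => _) = fun=> 0); first exact: derivC.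
  by apply/funext => y; rewrite big_ord0.
rewrite big_ord_recr/= (_ : (fun _ => _) = (fun y => \sum_(i < n) h i y + h n y)).
  by apply: derivD; [apply: ih => i ilt; apply: H; exact: ltnW|exact: H].
by apply/funext => y; rewrite big_ord_recr.
Qed.

Lemma derivable_cvg f x (df : R) : is_derive x 1 f df -> f y @[y --> x] --> f x.
Proof.
move=> [d _]; have := @derivable1_diffP _ _ f x => -[/(_ d) df' _].
exact: differentiable_continuous.
Qed.

Lemma cvg_sum_ord {T : Type} (F : set_system T) {FF : Filter F} n (f : nat -> T -> R) (a : nat -> R) :
  (forall i, (i < n)%N -> f i x @[x --> F] --> a i) ->
  \sum_(i < n) f i x @[x --> F] --> \sum_(i < n) a i.
Proof.
elim: n => [|n ih] H.
  by under eq_fun do rewrite big_ord0; rewrite big_ord0; exact: cvg_cst.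
under eq_fun do rewrite big_ord_recr; rewrite big_ord_recr.
by apply: cvgD; [apply: ih => i ilt; apply: H; exact: ltnW|exact: H].
Qed.

Lemma cvg_to_le {T : Type} (F : set_system T) {FF : ProperFilter F} (f : T -> R) (a M : R) :
  f x @[x --> F] --> a -> (\forall x \near F, `|f x| <= M) -> `|a| <= M.
Proof.
move=> fa fM; have h : `|f x| @[x --> F] --> `|a| by exact: cvg_norm.
by rewrite -(cvg_lim (@Rhausdorff R) h); apply: limr_le => //; exact: cvgP h.
Qed.

Lemma cvg_eq {T : Type} (F : set_system T) (f : T -> R) (a b : R) :
  a = b -> f x @[x --> F] --> a -> f x @[x --> F] --> b.
Proof. by move=> ->. Qed.

Lemma cvg_harmonic_bound (u : nat -> R) (K : R) :
  (forall n, `|u n.+1| <= K / n.+1%:R) -> u n @[n --> \oo] --> (0 : R).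
Proof.
move=> H; rewrite -cvg_shiftS; apply: norm_cvg0.
have h : K / n.+1%:R @[n --> \oo] --> (0 : R).
  rewrite -(mulr0 K); apply: cvgM; [exact: cvg_cst|exact: cvg_harmonic].
apply: (squeeze_cvgr _ (cvg_cst 0) h); apply: nearW => n.
by rewrite normr_ge0 /=; exact: H.
Qed.

Lemma exprn_le_expR (m : nat) x : 0 <= x -> x ^+ m <= m`!%:R * expR x.
Proof.
move=> x0; case: m => [|m].
  by rewrite expr0 fact0 mul1r -[leLHS]expR0 ler_expR.
rewrite mulrC -ler_pdivrMr ?ltr0n ?fact_gt0//.
by apply: le_trans (expR_ge1Dxn m x0); rewrite lerDr.
Qed.

Lemma mvt_le f (df : R -> R) (K a b : R) : a <= b ->
  (forall x, a <= x <= b -> is_derive x 1 f (df x)) ->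
  (forall x, a <= x <= b -> `|df x| <= K) -> `|f b - f a| <= K * (b - a).
Proof.
move=> ab hd hK.
have [||c cab ->] := @MVT_segment R f df a b ab.
- by move=> x; rewrite in_itv/= => /andP[ax xb]; apply: hd; rewrite !ltW.
- apply: derivable_within_continuous => x; rewrite in_itv/= => xab.
  by have [] := hd x xab.
rewrite normrM (ger0_norm (_ : 0 <= b - a)) ?subr_ge0//.
by rewrite ler_wpM2r ?subr_ge0// hK// -in_itv.
Qed.

Lemma cvg_mulc {T : Type} (F : set_system T) {FF : Filter F} (f : T -> R) (c a : R) :
  f x @[x --> F] --> a -> c * f x @[x --> F] --> c * a.
Proof. by move=> h; apply: cvgM => //; exact: cvg_cst. Qed.

End RealDerivatives.

(** * Euler's integrand: domination and differentiation in the parameter *)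

Section GammaIntegrand.
Context {R : realType}.
Implicit Types (a b p x t : R) (m : nat).
Notation mu := (@lebesgue_measure R).

(** Above t = 1 a fixed power t^(N+m) is absorbed by half of the exponential. Below 1 the m factors
    |ln t| are absorbed by t^a, since (a |ln t|)^m <= m! t^(-a). This requires a > 0 as soon as a
    logarithm is present, and it leaves K independent of p. *)
Lemma powR_ln_le_expR a b m : 0 <= a -> (m == 0)%N || (0 < a) ->
  exists2 K : R, 0 <= K & forall p t, a <= p <= b -> 0 < t ->
    `|t `^ p * ln t ^+ m| <= K * expR (t / 2).
Proof.
move=> a0 ma.
set N := (Num.truncn `|b|).+1.
have bN : b <= N%:R by rewrite (le_trans (ler_norm _))// ltW// Num.Theory.truncnS_gt.
set K1 : R := (N + m)`!%:R * 2 ^+ (N + m).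
set K2 : R := m`!%:R / a ^+ m.
have K10 : 0 <= K1 by rewrite mulr_ge0 ?exprn_ge0.
have K20 : 0 <= K2 by rewrite divr_ge0 ?exprn_ge0.
exists (K1 + K2); first by rewrite addr_ge0.
move=> p t /andP[ap pb] t0.
have e1 : 1 <= expR (t / 2) by rewrite -[leLHS]expR0 ler_expR divr_ge0// ltW.
have [t1|t1] := leP 1 t.
  have lt0 : 0 <= ln t by rewrite ln_ge0.
  rewrite ger0_norm ?mulr_ge0 ?powR_ge0 ?exprn_ge0//.
  apply: (@le_trans _ _ (t ^+ (N + m))).
    rewrite exprD ler_pM ?powR_ge0 ?exprn_ge0//.
      by rewrite -powR_mulrn ?(ltW t0)// ler_powR// (le_trans pb).
    by rewrite lerXn2r ?nnegrE ?(ltW t0)// ltW// ln_sublinear.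
  have := @exprn_le_expR R (N + m) (t / 2) (divr_ge0 (ltW t0) (ler0n _ _)).
  rewrite expr_div_n ler_pdivrMr ?exprn_gt0// => h.
  apply: (le_trans h); rewrite mulrDl mulrAC -/K1 lerDl.
  by rewrite mulr_ge0 ?expR_ge0.
apply: (@le_trans _ _ K2); last first.
  rewrite (@le_trans _ _ (K1 + K2))// ?lerDr//.
  by rewrite ler_peMr// addr_ge0.
rewrite /K2; case: m ma {K1 K2 K10 K20} => [_|m /= a0'].
  rewrite !expr0 mulr1 fact0 divr1 ger0_norm ?powR_ge0//.
  rewrite -(powRr0 t) ger_powR ?t0 ?(ltW t1)//.
  exact: le_trans ap.
rewrite normrM normrX ger0_norm ?powR_ge0//.
rewrite ler_pdivlMr ?exprn_gt0// -mulrA -exprMn.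
have u0 : 0 <= `|ln t| * a by rewrite mulr_ge0.
apply: (@le_trans _ _ (t `^ a * ((m.+1)`!%:R * expR (`|ln t| * a)))).
  apply: ler_pM; rewrite ?powR_ge0 ?exprn_ge0//.
    by rewrite ger_powR ?t0 ?(ltW t1).
  exact: exprn_le_expR.
rewrite mulrCA /powR gt_eqF// -expRD ler_piMr// expR_le1.
by rewrite ltr0_norm ?ln_lt0 ?t0//; lra.
Qed.

Definition gamma_integrand m (x t : R) := t `^ (x - 1) * ln t ^+ m * expR (- t).

Lemma measurable_gamma_integrand m x (D : set R) :
  measurable_fun D (gamma_integrand m x).
Proof.
apply: measurable_funTS; apply: measurable_funM.
  apply: measurable_funM; first exact: measurable_powR.
  by apply: measurable_funX; exact: measurable_ln.
by apply: measurableT_comp => //; exact: measurable_expR.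
Qed.

Lemma integrable_expRN_half K :
  mu.-integrable `]0, +oo[ (EFin \o (fun t : R => K * expR (- t / 2))).
Proof.
have h : mu.-integrable `]0, +oo[ (EFin \o exponential_pdf (2^-1 : R)).
  apply: (integrableS _ _ _ (integrable_exponential_pdf _)) => //.
have /(integrableZl _ (K * 2)) h2 := h.
apply: eq_integrable (h2 _) => //.
move=> t; rewrite inE/= in_itv/= andbT => t0.
have e s : K * 2 * (2^-1 * expR (- 2^-1 * s)) = K * expR (- s / 2).
  by rewrite (_ : - s / 2 = - 2^-1 * s); [field|field].
rewrite /comp exponential_pdfE ?(ltW t0)//; exact: (congr1 EFin (e t)).
Qed.

Lemma gamma_integrand_le a b m : 1 <= a -> (m == 0)%N || (1 < a) ->
  exists2 K : R, 0 <= K & forall x t, a <= x <= b -> 0 < t ->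
    `|gamma_integrand m x t| <= K * expR (- t / 2).
Proof.
move=> a1 ma.
have [||K K0 HK] := @powR_ln_le_expR (a - 1) (b - 1) m; first by rewrite subr_ge0.
  by rewrite subr_gt0.
exists K => // x t /andP[ax xb] t0.
rewrite /gamma_integrand normrM (ger0_norm (expR_ge0 _)).
rewrite (_ : - t / 2 = t / 2 + - t); last by field.
rewrite expRD mulrA ler_wpM2r ?expR_ge0// HK//.
by rewrite !lerD2r ax.
Qed.

Lemma integrable_gamma_integrand m x : 1 <= x -> (m == 0)%N || (1 < x) ->
  mu.-integrable `]0, +oo[ (EFin \o gamma_integrand m x).
Proof.
move=> x1 mx; have [K K0 HK] := @gamma_integrand_le x x m x1 mx.
apply: le_integrable (integrable_expRN_half K) => //.
  by apply/measurable_EFinP; exact: measurable_gamma_integrand.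
move=> t/=; rewrite in_itv/= andbT => t0.
rewrite lee_fin (ger0_norm (mulr_ge0 K0 (expR_ge0 _))).
by apply: HK => //; rewrite lexx.
Qed.

Definition Gamma_n m x := \int[mu]_(t in `]0, +oo[) gamma_integrand m x t.

Lemma Gamma_n0 x : Gamma_n 0 x = Gamma x.
Proof.
by apply: eq_Rintegral => t _; rewrite /gamma_integrand expr0 mulr1.
Qed.

Lemma is_derive_gamma_integrand m x t : 0 < t ->
  is_derive x 1 ((gamma_integrand m)^~ t) (gamma_integrand m.+1 x t).
Proof.
move=> t0.
have -> : (gamma_integrand m)^~ t =
    (fun x => expR ((x - 1) * ln t) * (ln t ^+ m * expR (- t))).
  by apply/funext => y; rewrite /gamma_integrand /powR gt_eqF// mulrA.
apply: is_derive_eq.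
by rewrite /GRing.scale/= /gamma_integrand /powR gt_eqF// exprS; ring.
Qed.

Lemma is_derive_Gamma_n m x : 1 < x -> is_derive x 1 (Gamma_n m) (Gamma_n m.+1 x).
Proof.
move=> x1.
(* Keeping u above 1 leaves a positive power of t against the logarithms, uniformly on an interval
   around x. *)
set u := (1 + x) / 2; set v := x + 1.
have u1 : 1 < u by rewrite /u; lra.
have ux : u < x by rewrite /u; lra.
have [K K0 HK] := @gamma_integrand_le u v m.+1 (ltW u1) u1.
pose I : set R := `]u, v[.
have Ix : I x by rewrite /I/= in_itv/= ux/= /v; lra.
have mI : measurable (`]0%R, +oo[%classic : set (measurableTypeR R)) by exact: measurable_itv.
have int x' : I x' -> mu.-integrable `]0, +oo[ (EFin \o gamma_integrand m x').
  rewrite /I/= in_itv/= => /andP[ux' _]; apply: integrable_gamma_integrand.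
    by rewrite ltW// (lt_trans u1).
  by rewrite (lt_trans u1)// orbT.
have der x' t : I x' -> (`]0, +oo[%classic : set R) t ->
    derivable ((gamma_integrand m)^~ t) x' 1.
  move=> _; rewrite /= in_itv/= andbT => t0.
  by have [] := @is_derive_gamma_integrand m x' t t0.
have pd x' t : 0 < t -> partial1of2 (gamma_integrand m) x' t = gamma_integrand m.+1 x' t.
  move=> t0; rewrite partial1of2E.
  by have := @is_derive_gamma_integrand m x' t t0 => ?; rewrite derive_val.
have G0 t : 0 <= K * expR (- t / 2) by rewrite mulr_ge0// expR_ge0.
have GB x' t : I x' -> (`]0, +oo[%classic : set R) t ->
    `|partial1of2 (gamma_integrand m) x' t| <= K * expR (- t / 2).
  rewrite /I/= !in_itv/= andbT => /andP[ux' xv'] t0; rewrite pd// HK//.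
  by rewrite (ltW ux') (ltW xv').
have d := derivable_under_integral mI Ix int der G0 (integrable_expRN_half K) GB.
have e := differentiation_under_integral mI Ix int der G0 (integrable_expRN_half K) GB.
split; first exact: d.
rewrite -derive1E e; apply: eq_Rintegral => t; rewrite inE/= in_itv/= andbT.
exact: pd.
Qed.

End GammaIntegrand.

(** * The Gamma function on [1, +oo[: functional equation, shift bounds, positivity *)

Section GammaFunction.
Context {R : realType}.
Implicit Types (p q x y t : R).
Notation mu := (@lebesgue_measure R).

Lemma integrable_addM (D : set (measurableTypeR R)) (f g : R -> R) (c : R) : measurable D ->
  mu.-integrable D (EFin \o f) -> mu.-integrable D (EFin \o g) ->
  mu.-integrable D (EFin \o (fun t => f t + c * g t)).
Proof.
move=> mD hf hg; have h := integrableD mD hf (integrableZl mD c hg).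
by apply: eq_integrable h => // t _; rewrite /= EFinD EFinM.
Qed.

Lemma powR_add t p q : 0 < t -> t `^ p * t `^ q = t `^ (p + q).
Proof. by move=> t0; rewrite powRD//; apply/implyP => _; rewrite gt_eqF. Qed.

Lemma powR_cvg_right0 p : 0 <= p -> t `^ p @[t --> (0 : R)^'+] --> 0 `^ p.
Proof.
rewrite le_eqVlt => /predU1P[<-|p0].
  by under eq_fun do rewrite powRr0; rewrite powRr0; exact: cvg_cst.
by rewrite powR0 ?gt_eqF//; exact: powR_cvg0.
Qed.

Lemma is_derive_powR_expRN p t : 0 < t ->
  is_derive t 1 (fun t => t `^ p * expR (- t))
    (p * t `^ (p - 1) * expR (- t) - t `^ p * expR (- t)).
Proof.
move=> t0; apply: is_derive_eq.
  exact: derivM (is_derive1_powR p t0) (deriv_comp (is_derive_expR _) (derivN (deriv_id _))).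
by rewrite /=; ring.
Qed.

Lemma expRN_half_cvgy (K : R) : K * expR (- t / 2) @[t --> +oo] --> (0 : R).
Proof.
rewrite -(mulr0 K); apply: cvg_mulc; under eq_fun do rewrite mulNr.
apply: (cvg_comp (fun t : R => t / 2) (fun u => expR (- u)) _ (@cvgr_expR R)).
by apply: gt0_cvgMly; [rewrite invr_gt0|exact: cvg_id].
Qed.

Lemma powR_expRN_cvgy p : 0 <= p -> t `^ p * expR (- t) @[t --> +oo] --> (0 : R).
Proof.
move=> p0; have [||K K0 HK] := @gamma_integrand_le R (p + 1) (p + 1) 0.
- by rewrite lerDr.
- by [].
apply: (squeeze_cvgr _ (cvg_cst 0) (expRN_half_cvgy K)); near=> t.
have t0 : 0 < t by [].
rewrite mulr_ge0 ?powR_ge0 ?expR_ge0//=.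
have := HK (p + 1) t; rewrite lexx => /(_ isT t0).
rewrite /gamma_integrand expr0 mulr1 addrK mulNr; apply: le_trans.
exact: ler_norm.
Unshelve. all: by end_near. Qed.

(** The integrand is minus the derivative of t^x e^(-t), which vanishes at both ends. It changes
    sign at t = x, while the fundamental theorem on a half-line is applied here to nonnegative
    integrands. So a multiple of e^(-t/2) is added, and its integral is subtracted at the end. *)
Lemma integral_gamma_by_parts x : 1 <= x ->
  \int[mu]_(t in `]0, +oo[) (gamma_integrand 0 (x + 1) t + (- x) * gamma_integrand 0 x t) = 0.
Proof.
move=> x1; have x0 : 0 < x by exact: lt_le_trans x1.
have [//|K K0 HK] := @gamma_integrand_le R x x 0 x1.
(* The constant K serves t > 0; the extra 1 covers t = 0, where 0^(x-1) equals 1 if x = 1. *)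
pose M := x * (K + 1).
have M0 : 0 <= M := mulr_ge0 (ltW x0) (addr_ge0 K0 ler01).
pose h t : R := t `^ x * expR (- t) - x * (t `^ (x - 1) * expR (- t)).
have hE t : gamma_integrand 0 (x + 1) t + (- x) * gamma_integrand 0 x t = h t.
  by rewrite /gamma_integrand !expr0 !mulr1 addrK mulNr.
have e2 t : 0 < t -> is_derive t 1 (fun t : R => expR (- t / 2)) (- 2^-1 * expR (- t / 2)).
  by move=> t0; apply: is_derive_eq; rewrite /GRing.scale/=; field.
have cexp t : expR (- s) @[s --> t] --> expR (- t).
  by apply: continuous_comp; [exact: cvgN|exact: continuous_expR].
have cexp2 t : expR (- s / 2) @[s --> t] --> expR (- t / 2).
  apply: (continuous_comp (f := fun s : R => - s / 2)); last exact: continuous_expR.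
  by apply: cvgM; [exact: cvgN|exact: cvg_cst].
have cM (c : R) : continuous (fun s : R => c * expR (- s / 2)).
  by move=> t; apply: cvg_mulc; exact: cexp2.
have I1 : \int[mu]_(t in `[0, +oo[) (M * expR (- t / 2)) = 2 * M.
  rewrite (@Rintegral_ge0_continuous_FTC2y _ _ (fun t => - (2 * M) * expR (- t / 2)) 0 0).
  - by rewrite oppr0 mul0r expR0; ring.
  - by move=> t _; rewrite mulr_ge0 ?expR_ge0.
  - exact: (continuous_subspaceT (cM M)).
  - exact: expRN_half_cvgy.
  - by move=> t t0; have [] := derivZ (- (2 * M)) (e2 _ t0).
  - by apply: cvg_mulc; apply: cvg_at_right_filter; exact: cexp2.
  - move=> t; rewrite in_itv/= andbT => t0.
    have d := derivZ (- (2 * M)) (e2 _ t0).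
    by rewrite derive1E derive_val; field.
have cpow p : 0 <= p -> {within `[0, +oo[, continuous (fun t : R => t `^ p * expR (- t))}.
  move=> p0; apply/continuous_within_itvcyP; split.
    move=> t; rewrite in_itv/= andbT => t0.
    exact: (derivable_cvg (is_derive_powR_expRN p t0)).
  apply: cvgM; first exact: powR_cvg_right0.
  by apply: cvg_at_right_filter; exact: cexp.
have I2 : \int[mu]_(t in `[0, +oo[) (h t + M * expR (- t / 2)) = 2 * M.
  rewrite (@Rintegral_ge0_continuous_FTC2y _ _
    (fun t => - (t `^ x * expR (- t)) - 2 * M * expR (- t / 2)) 0 0).
  - by rewrite (powR0 (lt0r_neq0 x0)) !oppr0 !mul0r expR0; ring.
  - move=> t; rewrite le_eqVlt => /predU1P[<-|t0].
      rewrite /h (powR0 (lt0r_neq0 x0)) !oppr0 !mul0r expR0 !mulr1 add0r addrC subr_ge0 /M.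
      apply: ler_wpM2l; first exact: ltW.
      apply: (@le_trans _ _ 1); last by rewrite lerDr.
      have h01 : (0 : R) `^ (x - 1) <= 1 `^ (x - 1) by apply: ge0_ler_powR; rewrite ?nnegrE ?subr_ge0.
      by move: h01; rewrite powR1.
    rewrite /h -addrA addr_ge0 ?mulr_ge0 ?powR_ge0 ?expR_ge0//.
    rewrite addrC subr_ge0 /M -mulrA; apply: ler_wpM2l; first exact: ltW.
    have := HK x t; rewrite lexx => /(_ isT t0).
    rewrite /gamma_integrand expr0 mulr1 => h1; apply: le_trans (ler_norm _) _.
    by apply: (le_trans h1); rewrite ler_wpM2r ?expR_ge0// lerDl.
  - move=> t; apply: cvgD; first apply: cvgB.
    + by apply: cpow; exact: ltW.
    + by apply: cvg_mulc; apply: cpow; rewrite subr_ge0.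
    + exact: (continuous_subspaceT (cM M)).
  - rewrite -[X in _ --> X](_ : - 0 - 2 * M * 0 = 0); last by ring.
    apply: cvgB; first by apply: cvgN; apply: powR_expRN_cvgy; exact: ltW.
    by rewrite mulr0; exact: expRN_half_cvgy.
  - move=> t t0.
    by have [] := derivB (derivN (is_derive_powR_expRN x t0)) (derivZ (2 * M) (e2 _ t0)).
  - apply: cvgB; last by apply: cvg_mulc; apply: cvg_at_right_filter; exact: cexp2.
    apply: cvgN; apply: cvgM; first by apply: powR_cvg_right0; exact: ltW.
    by apply: cvg_at_right_filter; exact: cexp.
  - move=> t; rewrite in_itv/= andbT => t0.
    have d := derivB (derivN (is_derive_powR_expRN x t0)) (derivZ (2 * M) (e2 _ t0)).
    by rewrite derive1E derive_val /h; field.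
have ih : mu.-integrable `]0, +oo[ (EFin \o (fun t => gamma_integrand 0 (x + 1) t + (- x) * gamma_integrand 0 x t)).
  apply: integrable_addM => //; apply: integrable_gamma_integrand => //.
  by rewrite (le_trans x1)// lerDl.
have ie := integrable_expRN_half M.
have e1 : \int[mu]_(t in `]0, +oo[) (M * expR (- t / 2)) = 2 * M.
  by rewrite -I1 Rintegral_itv_obnd_cbnd//; have /integrableP[/measurable_EFinP] := ie.
have e3 : \int[mu]_(t in `]0, +oo[) ((gamma_integrand 0 (x + 1) t + (- x) * gamma_integrand 0 x t) + M * expR (- t / 2)) = 2 * M.
  rewrite -I2 -Rintegral_itv_obnd_cbnd; last first.
    apply: eq_integrable (integrable_addM 1 _ ih ie) => // t _.
    by rewrite /= mul1r hE.
  by apply: eq_Rintegral => t _; rewrite hE.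
by move: e3; rewrite RintegralD// e1 => /eqP; rewrite -subr_eq0 addrK => /eqP.
Qed.

Lemma Gamma_comb (x y a b : R) : 1 <= x -> 1 <= y ->
  \int[mu]_(t in `]0, +oo[) (a * gamma_integrand 0 x t + b * gamma_integrand 0 y t) =
  a * Gamma x + b * Gamma y.
Proof.
move=> x1 y1; have mI : measurable (`]0%R, +oo[%classic : set (measurableTypeR R)).
  exact: measurable_itv.
have ix := integrable_gamma_integrand x1 (isT : (0 == 0)%N || _).
have iy := integrable_gamma_integrand y1 (isT : (0 == 0)%N || _).
have iZ z c : mu.-integrable `]0, +oo[ (EFin \o gamma_integrand 0 z) ->
    mu.-integrable `]0, +oo[ (EFin \o (fun t => c * gamma_integrand 0 z t)).
  by move=> /(integrableZl mI c) h; apply: eq_integrable h => // t _; rewrite /= EFinM.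
rewrite RintegralD//; [|exact: iZ|exact: iZ].
by rewrite !RintegralZl// -!Gamma_n0.
Qed.

Lemma GammaD1 x : 1 <= x -> Gamma (x + 1) = x * Gamma x.
Proof.
move=> x1; have x2 : 1 <= x + 1 by lra.
have := Gamma_comb 1 (- x) x2 x1; rewrite mul1r mulNr.
under eq_Rintegral do rewrite mul1r.
by rewrite integral_gamma_by_parts// => /esym/eqP; rewrite subr_eq0 => /eqP.
Qed.

Lemma le_Gamma_comb x y z a b c : 1 <= x -> 1 <= y -> 1 <= z ->
  (forall t, 0 < t -> a * t `^ (x - 1) + b * t `^ (y - 1) <= c * t `^ (z - 1)) ->
  a * Gamma x + b * Gamma y <= c * Gamma z.
Proof.
move=> x1 y1 z1 H.
have mI : measurable (`]0%R, +oo[%classic : set (measurableTypeR R)).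
  exact: measurable_itv.
have ix := integrable_gamma_integrand x1 (isT : (0 == 0)%N || _).
have iy := integrable_gamma_integrand y1 (isT : (0 == 0)%N || _).
have iz := integrable_gamma_integrand z1 (isT : (0 == 0)%N || _).
have iZ w d : mu.-integrable `]0, +oo[ (EFin \o gamma_integrand 0 w) ->
    mu.-integrable `]0, +oo[ (EFin \o (fun t => d * gamma_integrand 0 w t)).
  by move=> /(integrableZl mI d) h; apply: eq_integrable h => // t _; rewrite /= EFinM.
have e := Gamma_comb c 0 z1 z1; rewrite (mul0r (Gamma z)) (addr0 (c * Gamma z)) in e.
rewrite -e -(Gamma_comb a b x1 y1).
apply: (le_Rintegral mI); [exact: integrable_addM (iZ _ _ _) _|exact: integrable_addM (iZ _ _ _) _|].
move=> t; rewrite /= in_itv/= andbT => t0; rewrite mul0r addr0.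
rewrite /gamma_integrand !expr0 !mulr1 !mulrA -mulrDl.
by rewrite ler_wpM2r ?expR_ge0// H.
Qed.

Lemma powRN_ge (u x : R) : 0 < u -> 0 <= x -> 1 - x * (u - 1) <= u `^ (- x).
Proof.
move=> u0 x0; rewrite /powR gt_eqF//.
apply: le_trans (expR_ge1Dx _); rewrite lerD2l mulNr lerN2 ler_wpM2l//.
by have := @le_ln1Dx R (u - 1); rewrite (addrC 1) subrK; apply; lra.
Qed.

(* Both shift bounds integrate the tangent inequality [powRN_ge], with [u = t / c]
   here and [u = c / t] in [Gamma_shift_ge]. *)
Lemma Gamma_shift_le y x : 1 <= y -> 0 <= x -> Gamma (y + x) <= (y + x) `^ x * Gamma y.
Proof.
move=> y1 x0; set c := y + x; have c0 : 0 < c by rewrite /c; lra.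
have c1 : 1 <= c by rewrite /c; lra.
have c2 : 1 <= c + 1 by lra.
rewrite [leLHS](_ : _ = (1 + x) * Gamma c + (- x / c) * Gamma (c + 1)); last first.
  by rewrite GammaD1//; field; rewrite gt_eqF.
apply: le_Gamma_comb => // t t0; rewrite addrK.
have -> : t `^ c = t * t `^ (c - 1).
  by rewrite -{2}(powRr1 (ltW t0)) powR_add// addrC subrK.
have -> : t `^ (y - 1) = t `^ (- x) * t `^ (c - 1).
  by rewrite powR_add// /c; congr (powR _ _); ring.
rewrite mulrA -mulrDl mulrA; apply: ler_wpM2r; first exact: powR_ge0.
have -> : c `^ x * t `^ (- x) = (t / c) `^ (- x).
  rewrite powRM ?ltW ?invr_gt0// mulrC; congr (_ * _).
  by rewrite -powR_inv1 ?ltW// -powRrM; congr (powR _ _); ring.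
apply: le_trans (powRN_ge _ x0); last by rewrite divr_gt0.
by rewrite [leLHS](_ : _ = 1 - x * (t / c - 1))//; ring.
Qed.

Lemma Gamma_shift_ge y x : 2 <= y -> 0 <= x -> (y - 1) `^ x * Gamma y <= Gamma (y + x).
Proof.
move=> y2 x0; set c := y - 1; have c1 : 1 <= c by rewrite /c; lra.
have c0 : 0 < c by lra.
have y1 : 1 <= y by lra.
have yx1 : 1 <= y + x by lra.
rewrite [leLHS](_ : _ = c `^ x * (1 + x) * Gamma y + (- c `^ x * x * c) * Gamma c); last first.
  by rewrite {1 2}(_ : y = c + 1) ?GammaD1//; [ring|rewrite /c; ring].
rewrite -[leRHS]mul1r.
apply: le_Gamma_comb => // t t0; rewrite mul1r.
have e1 : t `^ (y - 1) = t * t `^ (c - 1).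
  by rewrite -{2}(powRr1 (ltW t0)) powR_add//; congr (powR _ _); rewrite /c; ring.
have -> : t `^ (y + x - 1) = t `^ x * t `^ (y - 1).
  by rewrite powR_add//; congr (powR _ _); ring.
have -> : t `^ (c - 1) = t^-1 * t `^ (y - 1) by rewrite e1 mulKf// gt_eqF.
rewrite mulrA -mulrDl; apply: ler_wpM2r; first exact: powR_ge0.
have -> : t `^ x = c `^ x * (c / t) `^ (- x).
  rewrite powRM ?ltW ?invr_gt0// mulrA powRN mulfV ?gt_eqF ?powR_gt0// mul1r.
  by rewrite -powR_inv1 ?ltW// -powRrM; congr (powR _ _); ring.
rewrite [leLHS](_ : _ = c `^ x * (1 - x * (c / t - 1))); last by ring.
by apply: ler_wpM2l; [exact: powR_ge0|apply: powRN_ge => //; rewrite divr_gt0].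
Qed.

Lemma Gamma1 : Gamma 1 = 1 :> R.
Proof.
rewrite -Gamma_n0 /Gamma_n.
have cexp t : expR (- s) @[s --> t] --> expR (- t).
  by apply: continuous_comp; [exact: cvgN|exact: continuous_expR].
have de t : is_derive t 1 (fun t : R => - expR (- t)) (expR (- t)).
  by apply: is_derive_eq; rewrite /GRing.scale/=; ring.
rewrite (_ : \int[mu]_(t in _) _ = \int[mu]_(t in `]0, +oo[) expR (- t)); last first.
  by apply: eq_Rintegral => t _; rewrite /gamma_integrand subrr powRr0 expr0 !mul1r.
rewrite Rintegral_itv_obnd_cbnd; last first.
  have h := integrable_gamma_integrand (lexx (1 : R)) (isT : (0 == 0)%N || _).
  apply: eq_integrable h => // t _.
  by rewrite /= /gamma_integrand subrr powRr0 expr0 !mul1r.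
rewrite (@Rintegral_ge0_continuous_FTC2y _ _ (fun t => - expR (- t)) 0 0).
- by rewrite oppr0 expR0; ring.
- by move=> t _; exact: expR_ge0.
- exact: continuous_subspaceT.
- by rewrite -oppr0; apply: cvgN; exact: cvgr_expR.
- by move=> t _; have [] := de t.
- by apply: cvgN; apply: cvg_at_right_filter; exact: cexp.
- by move=> t _; have d := de t; rewrite derive1E derive_val.
Qed.

(** [Gamma_shift_ge] at y = 2, where every power of y - 1 is 1, gives Gamma (x + 1) >= Gamma 2 = 1;
    the functional equation brings this down to x. *)
Lemma Gamma_gt0 x : 1 <= x -> 0 < Gamma x.
Proof.
move=> x1; have G2 : Gamma 2 = 1 :> R.
  by rewrite (_ : 2 = 1 + 1) ?GammaD1 ?Gamma1 ?mulr1//; ring.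
have h := @Gamma_shift_ge 2 (x - 1) (lexx _) (_ : 0 <= x - 1).
have {h} : 1 <= x * Gamma x.
  rewrite -GammaD1//; have := h; rewrite subr_ge0 => /(_ x1).
  rewrite G2 mulr1 (_ : 2 - 1 = 1); last by ring.
  by rewrite powR1 (_ : 2 + (x - 1) = x + 1)//; ring.
move=> h; rewrite -(pmulr_rgt0 _ (_ : 0 < x)); first exact: lt_le_trans h.
exact: lt_le_trans x1.
Qed.

End GammaFunction.

(** * Partial sums of zeta values *)

Section ZetaPartialSums.
Context {R : realType}.

Definition zsum (a N : nat) : R := \sum_(1 <= k < N.+1) 1 / k%:R ^+ a.

Lemma zsumS a N : zsum a N.+1 = zsum a N + 1 / N.+1%:R ^+ a.
Proof. by rewrite /zsum big_nat_recr. Qed.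

Lemma zsum0 a : zsum a 0 = 0.
Proof. by rewrite /zsum big_geq. Qed.

(** Telescoping against 1/n - 1/(n + 1). The bound is the same for all a and enters the constants of
    several error terms below. *)
Lemma zsum_le2 a N : (2 <= a)%N -> zsum a N <= 2.
Proof.
move=> a2; case: N => [|N]; first by rewrite zsum0; lra.
suff : zsum a N.+1 <= 2 - 1 / N.+1%:R.
  by move=> h; apply: (le_trans h); rewrite gerBl divr_ge0.
elim: N => [|N ih].
  by rewrite zsumS zsum0 expr1n; lra.
rewrite zsumS.
have n1 : 0 < N.+1%:R :> R by rewrite ltr0n.
have e : N.+2%:R = N.+1%:R + 1 :> R by rewrite -natr1.
move: n1 ih; set n : R := N.+1%:R; rewrite e -/n => n1 ih.
have h : 1 / (n + 1) ^+ a <= 1 / (n + 1) ^+ 2.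
  rewrite !div1r lef_pV2 ?posrE ?exprn_gt0//; [|lra|lra].
  by apply: ler_weXn2l => //; lra.
have h2 : 1 / (n + 1) ^+ 2 <= 1 / n - 1 / (n + 1).
  rewrite -subr_ge0 (_ : _ - _ = 1 / (n * (n + 1) ^+ 2)); last by field; lra.
  by apply: divr_ge0 => //; apply: mulr_ge0; [lra|apply: exprn_ge0; lra].
apply: (le_trans (lerD ih (le_trans h h2))).
by rewrite addrA subrK.
Qed.

Lemma zsum_ndecr a : {homo zsum a : m n / (m <= n)%N >-> m <= n}.
Proof.
move=> m n /subnK <-; elim: (n - m)%N => [|k ih] //.
by rewrite addSn zsumS (le_trans ih)// lerDl divr_ge0 ?exprn_ge0.
Qed.

Lemma zsum_cvg a : (2 <= a)%N -> zsum a n @[n --> \oo] --> (zeta a : R).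
Proof.
move=> a2; have h : cvgn (zsum a).
  apply: nondecreasing_is_cvgn; first exact: zsum_ndecr.
  by exists 2 => _ [n _ <-]; exact: zsum_le2.
exact: h.
Qed.

End ZetaPartialSums.

(** * Taylor bounds for the logarithm and the exponential *)

Section LogExpansions.
Context {R : realType}.
Implicit Types (x u : R).

Definition lnT n u : R := \sum_(i < n) (-1) ^+ i * u ^+ i.+1 / i.+1%:R.

(** The derivative of the error is (-v)^n / (1 + v), the tail of a geometric sum, hence at most u^n
    in absolute value on [0, u]. *)
Lemma ln1D_expand n u : 0 <= u -> `|ln (1 + u) - lnT n u| <= u ^+ n.+1.
Proof.
move=> u0.
have d (v : R) : 0 <= v <= u -> is_derive v 1 (fun v => ln (1 + v) - lnT n v) ((- v) ^+ n / (1 + v)).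
  move=> /andP[v0 vu]; have v1 : 0 < 1 + v by lra.
  have d1 : is_derive v 1 (fun v => ln (1 + v)) ((1 + v)^-1 * (0 + 1)).
    apply: (deriv_comp (is_derive1_ln v1)); exact: derivD (derivC _ _) (deriv_id _).
  have d2 : is_derive v 1 (lnT n) (\sum_(i < n) (- v) ^+ i).
    have h : is_derive v 1 (fun v => \sum_(i < n) (-1) ^+ i * v ^+ i.+1 / i.+1%:R)
      (\sum_(i < n) (-1) ^+ i * (i.+1%:R * v ^+ i * 1) / i.+1%:R).
      apply: (deriv_sum (h := fun i v => (-1) ^+ i * v ^+ i.+1 / i.+1%:R)
        (dh := fun i => (-1) ^+ i * (i.+1%:R * v ^+ i * 1) / i.+1%:R)) => i _.
      apply: is_derive_eq; first exact: derivM (derivZ _ (derivX _ (deriv_id _))) (derivC _ _).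
      by rewrite mulr0 addr0.
    apply: (is_derive_eq h); apply: eq_bigr => i _.
    by rewrite [RHS]exprNn mulr1 -mulrA; congr (_ * _); rewrite mulrAC mulfV ?pnatr_eq0// mul1r.
  apply: (is_derive_eq (derivB d1 d2)).
  have := subrX1 (- v) n; rewrite (_ : - v - 1 = - (1 + v)); last by ring.
  move=> h; apply: (@mulIf _ (1 + v)); first by rewrite gt_eqF.
  rewrite mulrBl divfK ?gt_eqF// add0r mulr1 mulVf ?gt_eqF//.
  by rewrite [X in 1 - X]mulrC; move: h; rewrite mulNr => h; rewrite -h; ring.
have K (v : R) : 0 <= v <= u -> `|(- v) ^+ n / (1 + v)| <= u ^+ n.
  move=> /andP[v0 vu]; rewrite normrM normrX normrN (ger0_norm v0).
  rewrite ger0_norm ?invr_ge0; last lra.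
  rewrite ler_pdivrMr; last lra.
  apply: (@le_trans _ _ (u ^+ n)); first by apply: lerXn2r; rewrite ?nnegrE.
  by rewrite ler_peMr ?exprn_ge0//; lra.
have := mvt_le u0 d K; rewrite subr0 -exprSr addr0 ln1 /lnT.
rewrite [X in _ - (0 - X)]big1; first by rewrite subr0 subr0.
by move=> i _; rewrite expr0n/= mulr0 mul0r.
Qed.

(** The error of order n + 1 has the error of order n as its derivative, so the mean value
    inequality raises the exponent while K = e stays fixed. *)
Lemma expR_expand n : exists2 K : R, 0 <= K &
  forall u, `|u| <= 1 -> `|expR u - \sum_(i < n) u ^+ i / i`!%:R| <= K * `|u| ^+ n.
Proof.
exists (expR 1); first exact: expR_ge0.
elim: n => [|n ih] u u1.
  rewrite big_ord0 subr0 expr0 mulr1 ger0_norm ?expR_ge0// ler_expR.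
  exact: le_trans (ler_norm _) u1.
pose g m v : R := expR v - \sum_(i < m) v ^+ i / i`!%:R.
have d (v : R) : is_derive v 1 (g n.+1) (g n v).
  have h : is_derive v 1 (fun v => \sum_(i < n) v ^+ i.+1 / (i.+1)`!%:R) (\sum_(i < n) v ^+ i / i`!%:R).
    apply: (deriv_sum (h := fun i v => v ^+ i.+1 / (i.+1)`!%:R)
        (dh := fun i => v ^+ i / i`!%:R)) => i _.
    apply: is_derive_eq; first exact: derivM (derivX _ (deriv_id _)) (derivC _ _).
    rewrite mulr0 addr0 mulr1 factS natrM invfM /=.
    by rewrite -mulrA mulrCA; congr (_ * _); rewrite mulrA mulfV ?pnatr_eq0// mul1r.
  rewrite (_ : g n.+1 = fun v => expR v - (1 + \sum_(i < n) v ^+ i.+1 / (i.+1)`!%:R)).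
    apply: (is_derive_eq (derivB (is_derive_expR _) (derivD (derivC 1 _) h))).
    by rewrite add0r.
  by apply/funext => w; rewrite /g big_ord_recl expr0 fact0 divr1.
have g0 : g n.+1 0 = 0.
  by rewrite /g expR0 big_ord_recl expr0 fact0 divr1 big1 ?addr0 ?subrr// => i _; rewrite /= expr0n mul0r.
have K (v : R) : `|v| <= `|u| -> `|g n v| <= expR 1 * `|u| ^+ n.
  move=> vu; apply: (le_trans (ih v (le_trans vu u1))).
  by rewrite ler_wpM2l ?expR_ge0//; apply: lerXn2r; rewrite ?nnegrE.
have [u0|u0] := leP 0 u.
  have H : `|g n.+1 u - g n.+1 0| <= expR 1 * `|u| ^+ n * (u - 0).
    apply: (mvt_le u0 (fun v _ => d v)) => v /andP[v0 vu].
    by apply: K; rewrite !ger0_norm.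
  by move: H; rewrite g0 !subr0 -mulrA exprSr {3}(ger0_norm u0).
have u0' := ltW u0.
have H : `|g n.+1 0 - g n.+1 u| <= expR 1 * `|u| ^+ n * (0 - u).
  apply: (mvt_le u0' (fun v _ => d v)) => v /andP[uv v0].
  by apply: K; rewrite !ler0_norm// lerN2.
by move: H; rewrite g0 !sub0r normrN -mulrA exprSr {3}(ler0_norm u0').
Qed.

End LogExpansions.

(** * Product formula and expansion for the inverse central binomial at 0 *)

Section CentralBinomial.
Context {R : realType}.
Implicit Types (x y u n : R).
#[local] Opaque Gamma ln powR.

(* The inverse of binom(2x, x), which is also defined for [-1/2 < x <= 0]. *)
Definition Cinv x : R := Gamma (x + 1) ^+ 2 / Gamma (2 * x + 1).

(** After N uses of the functional equation, ln (Cinv x) is [lq N x] plus the sum of [tC k x] over k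
    <= N. The [tC] are logarithms of the factors in the product formula, and [lq] is the remainder
    that has to vanish in the limit. *)
Let lq N x : R := 2 * ln (Gamma (N.+1%:R + x)) - ln (Gamma (N.+1%:R + 2 * x)) - ln (Gamma N.+1%:R).

Let tC k x : R := ln (1 + 2 * x / k%:R) - 2 * ln (1 + x / k%:R).

Lemma Cinv_gt0 x : 0 <= x -> 0 < Cinv x.
Proof.
move=> x0; apply: divr_gt0; [apply: exprn_gt0|]; apply: Gamma_gt0; lra.
Qed.

Lemma ln_GammaD1 (y : R) : 1 <= y -> ln (Gamma (y + 1)) = ln y + ln (Gamma y).
Proof.
move=> y1; rewrite GammaD1// lnM// posrE ?Gamma_gt0//.
exact: lt_le_trans y1.
Qed.

Let telescope (L : R -> R) (HL : forall y, 1 <= y -> L (y + 1) = ln y + L y) (N : nat) x : 0 <= x ->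
  2 * L (1 + x) - L (1 + 2 * x) - L 1 =
  2 * L (N.+1%:R + x) - L (N.+1%:R + 2 * x) - L N.+1%:R + \sum_(1 <= k < N.+1) tC k x.
Proof.
move=> x0; elim: N => [|N ih]; first by rewrite big_geq; [rewrite addr0|].
rewrite big_nat_recr; last by [].
rewrite /= addrCA addrC ih; congr (_ + _).
have n1 : 1 <= N.+1%:R :> R by rewrite ler1n.
have e : N.+2%:R = N.+1%:R + 1 :> R by rewrite -natr1.
rewrite /tC e; move: (N.+1%:R) n1 => n n1.
have -> : L (n + 1 + x) = ln (n + x) + L (n + x) by rewrite addrAC HL; lra.
have -> : L (n + 1 + 2 * x) = ln (n + 2 * x) + L (n + 2 * x) by rewrite addrAC HL; lra.
have -> : L (n + 1) = ln n + L n by rewrite HL; lra.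
have -> : 1 + 2 * x / n = (n + 2 * x) / n by field; lra.
have -> : 1 + x / n = (n + x) / n by field; lra.
have -> : ln ((n + 2 * x) / n) = ln (n + 2 * x) - ln n by rewrite ln_div ?posrE; lra.
have -> : ln ((n + x) / n) = ln (n + x) - ln n by rewrite ln_div ?posrE; lra.
ring.
Qed.

Let ln_Cinv_sum N x : 0 <= x ->
  ln (Cinv x) = lq N x + \sum_(1 <= k < N.+1) tC k x.
Proof.
move=> x0; have g1 : 0 < Gamma (x + 1) by apply: Gamma_gt0; lra.
have g2 : 0 < Gamma (2 * x + 1) by apply: Gamma_gt0; lra.
rewrite -(telescope (L := fun y => ln (Gamma y)) ln_GammaD1 N x0).
rewrite /Cinv ln_div; [|by rewrite posrE exprn_gt0|by rewrite posrE].
rewrite (lnXn _ g1) Gamma1 ln1 subr0 (addrC x) (addrC (2 * x)).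
by congr (_ - _); rewrite mulr_natl.
Qed.

Lemma ln_Gamma_shift_le y x : 1 <= y -> 0 <= x ->
  ln (Gamma (y + x)) <= x * ln (y + x) + ln (Gamma y).
Proof.
move=> y1 x0; have yx : 0 < y + x by lra.
have g1 := Gamma_gt0 y1; have g2 : 0 < Gamma (y + x) by apply: Gamma_gt0; lra.
move: (Gamma_shift_le y1 x0) g1 g2; move: (Gamma y) (Gamma (y + x)) => A B H A0 B0.
by rewrite -ln_powR -lnM ?posrE ?powR_gt0// ler_ln ?posrE ?mulr_gt0 ?powR_gt0.
Qed.

Lemma ln_Gamma_shift_ge y x : 2 <= y -> 0 <= x ->
  x * ln (y - 1) + ln (Gamma y) <= ln (Gamma (y + x)).
Proof.
move=> y2 x0; have y1 : 0 < y - 1 by lra.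
have g1 : 0 < Gamma y by apply: Gamma_gt0; lra.
have g2 : 0 < Gamma (y + x) by apply: Gamma_gt0; lra.
move: (Gamma_shift_ge y2 x0) g1 g2; move: (Gamma y) (Gamma (y + x)) => A B H A0 B0.
by rewrite -ln_powR -lnM ?posrE ?powR_gt0// ler_ln ?posrE ?mulr_gt0 ?powR_gt0.
Qed.

(** The left side compares the increments of L over two consecutive steps of length x from n + 1 on.
    The shift bounds place both increments between x times logarithms of arguments in
    [n, n + 1 + 2x], and these logarithms differ by O(1/n). *)
Let lq_bound_abs (L : R -> R) n x : 1 <= n -> 0 <= x ->
  (forall y x, 1 <= y -> 0 <= x -> L (y + x) <= x * ln (y + x) + L y) ->
  (forall y x, 2 <= y -> 0 <= x -> x * ln (y - 1) + L y <= L (y + x)) ->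
  `|2 * L (n + 1 + x) - L (n + 1 + 2 * x) - L (n + 1)| <= x * (1 + 2 * x) / n.
Proof.
move=> n1 x0 Hle Hge.
have h1 : x * ln n + L (n + 1) <= L (n + 1 + x).
  by have := Hge (n + 1) x; rewrite addrK; apply; lra.
have h2 : L (n + 1 + x + x) <= x * ln (n + 1 + x + x) + L (n + 1 + x) by apply: Hle; lra.
have h3 : L (n + 1 + x) <= x * ln (n + 1 + x) + L (n + 1) by apply: Hle; lra.
have h4 : x * ln (n + x) + L (n + 1 + x) <= L (n + 1 + x + x).
  by have := Hge (n + 1 + x) x; rewrite (addrAC n 1 x) addrK; apply; lra.
have -> : n + 1 + 2 * x = n + 1 + x + x by ring.
have D (a b : R) : 0 < a -> 0 <= b -> ln (a + b) - ln a <= b / a.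
  move=> a0 b0; rewrite -ln_div ?posrE//; last lra.
  have -> : (a + b) / a = 1 + b / a by field; lra.
  by apply: le_ln1Dx; rewrite (lt_le_trans (ltrN10 R))// divr_ge0// ltW.
have k1 : ln (n + 1 + x + x) - ln n <= (1 + 2 * x) / n.
  by rewrite (_ : n + 1 + x + x = n + (1 + 2 * x)); [apply: D; lra|ring].
have k2 : ln (n + 1 + x) - ln (n + x) <= (1 + 2 * x) / n.
  rewrite (_ : n + 1 + x = n + x + 1); last by ring.
  apply: (le_trans (D _ _ _ _)); [lra|lra|].
  apply: (@le_trans _ _ (1 / n)); last by rewrite ler_wpM2r ?invr_ge0; lra.
  by rewrite !div1r lef_pV2 ?posrE; lra.
have m1 := ler_wpM2l x0 k1; have m2 := ler_wpM2l x0 k2.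
rewrite ler_norml -mulrA; move: m1 m2; rewrite !mulrBr.
set A := x * ((1 + 2 * x) / n); move=> m1 m2.
apply/andP; split; lra.
Qed.

Let lq_bound N x : 0 <= x -> `|lq N.+1 x| <= x * (1 + 2 * x) / N.+1%:R.
Proof.
move=> x0; have n1 : 1 <= N.+1%:R :> R by rewrite ler1n.
have e : N.+2%:R = N.+1%:R + 1 :> R by rewrite -natr1.
rewrite /lq e.
exact: (lq_bound_abs (L := fun y => ln (Gamma y)) n1 x0 ln_Gamma_shift_le ln_Gamma_shift_ge).
Qed.

(** The coefficient of v^(i+1) in ln (1 + 2v) - 2 ln (1 + v). It vanishes at i = 0, which removes
    the divergent harmonic sum from the expansion. *)
Definition lamC i : R := (-1) ^+ i * (2 ^+ i.+1 - 2) / i.+1%:R.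

Lemma ln_Cinv_expand x : 0 <= x ->
  `|ln (Cinv x) - \sum_(i < 6) lamC i.+1 * zeta i.+2 * x ^+ i.+2| <= 516 * x ^+ 8.
Proof.
move=> x0.
(* 258 = 2^8 + 2 collects the errors of order 8 of ln (1 + 2v) and 2 ln (1 + v). Summing over k with
   [zsum_le2] doubles it to 516. *)
have T k : `|tC k.+1 x - \sum_(i < 7) lamC i * (x / k.+1%:R) ^+ i.+1| <= 258 * (x / k.+1%:R) ^+ 8.
  rewrite /tC -mulrA; have v0 : 0 <= x / k.+1%:R by rewrite divr_ge0.
  move: (x / _) v0 => v v0.
  have := ln1D_expand 7 v0.
  have := ln1D_expand 7 (mulr_ge0 (ler0n _ 2) v0).
  have -> : \sum_(i < 7) lamC i * v ^+ i.+1 = lnT 7 (2 * v) - 2 * lnT 7 v.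
    rewrite /lnT mulr_sumr -sumrB; apply: eq_bigr => i _; rewrite /lamC (exprMn i.+1 2 v).
    ring.
  rewrite exprMn; move: (lnT 7 (2 * v)) (lnT 7 v) (ln (1 + 2 * v)) (ln (1 + v)) => a b c d.
  rewrite !ler_norml; move: (v ^+ 8) => w /andP[? ?] /andP[? ?].
  by apply/andP; split; lra.
have S N : `|ln (Cinv x) - lq N x - \sum_(i < 6) lamC i.+1 * zsum i.+2 N * x ^+ i.+2| <= 516 * x ^+ 8.
  have -> : ln (Cinv x) - lq N x - \sum_(i < 6) lamC i.+1 * zsum i.+2 N * x ^+ i.+2 =
      \sum_(1 <= k < N.+1) (tC k x - \sum_(i < 7) lamC i * (x / k%:R) ^+ i.+1).
    rewrite (ln_Cinv_sum N x0) [lq N x + _]addrC addrK.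
    rewrite [RHS]sumrB; congr (_ - _).
    rewrite [RHS]exchange_big [RHS]big_ord_recl [X in _ = X + _]big1 ?add0r; last first.
      by move=> k _; rewrite /lamC expr0 expr1 subrr mulr0 !mul0r.
    apply: eq_bigr => i _; rewrite -mulr_sumr -mulrA; congr (_ * _).
    rewrite /zsum mulr_suml; apply: eq_bigr => k _.
    by rewrite lift0 expr_div_n mulrC mul1r.
  apply: (le_trans (ler_norm_sum _ _ _)).
  apply: (@le_trans _ _ (\sum_(1 <= k < N.+1) 258 * (x / k%:R) ^+ 8)).
    by rewrite !big_add1/=; apply: ler_sum => k _; exact: T.
  rewrite -mulr_sumr (_ : 516 = 258 * 2); last by ring.
  rewrite -[leRHS]mulrA; apply: ler_wpM2l => //.
  have -> : \sum_(1 <= k < N.+1) (x / k%:R) ^+ 8 = zsum 8 N * x ^+ 8.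
    rewrite /zsum mulr_suml; apply: eq_bigr => k _.
    by rewrite expr_div_n mulrC mul1r.
  by apply: ler_wpM2r; [exact: exprn_ge0|exact: zsum_le2].
have lq0 : lq N x @[N --> \oo] --> (0 : R).
  apply: (@cvg_harmonic_bound _ (lq^~ x) (x * (1 + 2 * x))) => n.
  exact: lq_bound.
have C : (ln (Cinv x) - lq N x - \sum_(i < 6) lamC i.+1 * zsum i.+2 N * x ^+ i.+2) @[N --> \oo] -->
   ln (Cinv x) - 0 - \sum_(i < 6) lamC i.+1 * zeta i.+2 * x ^+ i.+2.
  apply: cvgB; first by apply: cvgB => //; exact: cvg_cst.
  apply: (cvg_sum_ord (f := fun i N => lamC i.+1 * zsum i.+2 N * x ^+ i.+2)
    (a := fun i => lamC i.+1 * zeta i.+2 * x ^+ i.+2)) => i _.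
  apply: cvgM; last exact: cvg_cst.
  by apply: cvg_mulc; exact: zsum_cvg.
by rewrite subr0 in C; apply: (cvg_to_le C); exact: nearW.
Qed.

End CentralBinomial.

(** * One-sided expansions at 0 with error O(x^8) *)

Section Asymptotics.
Context {R : realType}.
Implicit Types (f g : R -> R) (p q : {poly R}) (x K d : R).

(* [f x = p.[x] + O (x ^+ 8)] when [x] tends to [0] from the right. *)
Definition asy f p := exists K d, [/\ 0 <= K, 0 < d, d <= 1 &
  forall x, 0 < x -> x < d -> `|f x - p.[x]| <= K * x ^+ 8].

Lemma poly_bounded p : exists2 B, 0 <= B & forall x, 0 <= x -> x <= 1 -> `|p.[x]| <= B.
Proof.
elim/poly_ind: p => [|p c [B B0 HB]].
  by exists 0 => // x _ _; rewrite horner0 normr0.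
exists (B + `|c|); first exact: addr_ge0.
move=> x x0 x1; rewrite hornerMXaddC; apply: (le_trans (ler_normD _ _)).
by rewrite lerD2r normrM (ger0_norm x0) (le_trans _ (HB x x0 x1))// ler_piMr.
Qed.

Lemma asy_ext f g p : (forall x, 0 < x -> f x = g x) -> asy f p -> asy g p.
Proof.
move=> fg [K [d [K0 d0 d1 H]]]; exists K, d; split=> // x x0 xd.
by rewrite -fg// H.
Qed.

Lemma asy_cst c : asy (fun=> c) c%:P.
Proof.
exists 0, 1; split => // x x0 _.
by rewrite hornerC subrr normr0 mul0r.
Qed.

Lemma asyD f g p q : asy f p -> asy g q -> asy (fun x => f x + g x) (p + q).
Proof.
move=> [K [d [K0 d0 d1 H]]] [K' [d' [K0' d0' d1' H']]].
exists (K + K'), (Num.min d d'); split.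
- exact: addr_ge0.
- by rewrite lt_min d0.
- by rewrite ge_min d1.
- move=> x x0; rewrite lt_min => /andP[xd xd'].
  rewrite hornerD mulrDl (_ : _ - _ = (f x - p.[x]) + (g x - q.[x])); last by ring.
  by apply: (le_trans (ler_normD _ _)); apply: lerD; [exact: H|exact: H'].
Qed.

Lemma asyM f g p q : asy f p -> asy g q -> asy (fun x => f x * g x) (p * q).
Proof.
move=> [K [d [K0 d0 d1 H]]] [K' [d' [K0' d0' d1' H']]].
have [B B0 HB] := poly_bounded p; have [B' B0' HB'] := poly_bounded q.
exists ((B + K) * K' + B' * K), (Num.min d d'); split.
- by rewrite addr_ge0 ?mulr_ge0 ?addr_ge0.
- by rewrite lt_min d0.
- by rewrite ge_min d1.
- move=> x x0; rewrite lt_min => /andP[xd xd'].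
  have x1 : x <= 1 by rewrite (le_trans (ltW xd)).
  have x8 : 0 <= x ^+ 8 by rewrite exprn_ge0// ltW.
  have fb : `|f x| <= B + K.
    rewrite -(subrK p.[x] (f x)) addrC; apply: (le_trans (ler_normD _ _)).
    apply: lerD; first exact: HB (ltW x0) x1.
    apply: (le_trans (H x x0 xd)); rewrite ler_piMr//.
    by rewrite exprn_ile1// ltW.
  rewrite hornerM (_ : _ - _ = f x * (g x - q.[x]) + q.[x] * (f x - p.[x])); last by ring.
  apply: (le_trans (ler_normD _ _)); rewrite mulrDl !normrM -!mulrA.
  by apply: lerD; apply: ler_pM => //; [exact: H'|exact: HB' (ltW x0) x1|exact: H].
Qed.

(** Since f is O(x^2), its fourth power is absorbed by the error, so the exponential series stops at
    the cube. The radius r below forces |f x| <= 1, as [expR_expand] demands. *)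
Lemma asy_expR f q : asy f ('X^2 * q) ->
  asy (fun x => expR (f x))
    (1 + 'X^2 * q + 2^-1 *: ('X^2 * q) ^+ 2 + 6^-1 *: ('X^2 * q) ^+ 3).
Proof.
move=> af; have [K [d [K0 d0 d1 H]]] := af.
have [B B0 HB] := poly_bounded q.
have [E E0 HE] := @expR_expand R 4.
have [K1 [e [K10 e0 e1 H1]]] : asy (fun x => \sum_(i < 4) f x ^+ i / i`!%:R)
    (1 + 'X^2 * q + 2^-1 *: ('X^2 * q) ^+ 2 + 6^-1 *: ('X^2 * q) ^+ 3).
  apply: (asy_ext (f := fun x => 1 + f x + 2^-1 * (f x * f x) + 6^-1 * (f x * (f x * f x)))).
    by move=> x _; rewrite !big_ord_recl big_ord0 /= !expr0 !expr1 /bump /= !factS fact0; field.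
  rewrite -!mul_polyC; apply: asyD; first apply: asyD; first apply: asyD => //.
  - exact: asy_cst.
  - by apply: asyM; [exact: asy_cst|rewrite expr2; exact: asyM].
  - by apply: asyM; [exact: asy_cst|rewrite exprS expr2; do 2! apply: asyM => //].
set L := B + K; have L0 : 0 <= L by exact: addr_ge0.
pose r := Num.min (Num.min d e) (L + 1)^-1.
exists (E * L ^+ 4 + K1), r; split.
- by rewrite addr_ge0 ?mulr_ge0 ?exprn_ge0.
- by rewrite !lt_min d0 e0 invr_gt0; lra.
- by rewrite !ge_min d1.
move=> x x0; rewrite !lt_min => /andP[/andP[xd xe] xL].
have x1 : x <= 1 by rewrite (le_trans (ltW xd)).
have fL : `|f x| <= L * x ^+ 2.
  rewrite -(subrK ('X^2 * q).[x] (f x)) addrC; apply: (le_trans (ler_normD _ _)).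
  rewrite /L mulrDl; apply: lerD.
    rewrite hornerM hornerXn normrM normrX (ger0_norm (ltW x0)) mulrC.
    by rewrite ler_wpM2r ?exprn_ge0 ?(ltW x0)//; exact: HB (ltW x0) x1.
  apply: (le_trans (H x x0 xd)); apply: ler_wpM2l => //.
  by apply: ler_wiXn2l => //; exact: ltW.
have f1 : `|f x| <= 1.
  apply: (le_trans fL); apply: (@le_trans _ _ (L * x)).
    by apply: ler_wpM2l => //; rewrite expr2 ler_piMl// ltW.
  have : L * x <= L / (L + 1) by rewrite ler_wpM2l// ltW.
  by move/le_trans; apply; rewrite ler_pdivrMr; lra.
rewrite (_ : _ - _ = (expR (f x) - \sum_(i < 4) f x ^+ i / i`!%:R) +
  (\sum_(i < 4) f x ^+ i / i`!%:R - (1 + 'X^2 * q + 2^-1 *: ('X^2 * q) ^+ 2 + 6^-1 *: ('X^2 * q) ^+ 3).[x])); last by ring.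
apply: (le_trans (ler_normD _ _)); rewrite mulrDl; apply: lerD; last exact: H1.
apply: (le_trans (HE _ f1)); rewrite -mulrA; apply: ler_wpM2l => //.
rewrite (_ : x ^+ 8 = (x ^+ 2) ^+ 4); last by rewrite -exprM.
by rewrite -exprMn; apply: lerXn2r => //; rewrite nnegrE ?normr_ge0// mulr_ge0 ?exprn_ge0// ltW.
Qed.

(** Letting x tend to 0 kills the constant coefficient; then divide by X and repeat. *)
Lemma asy_zero n p K d : 0 < d -> 0 <= K ->
  (forall x, 0 < x -> x < d -> `|p.[x]| <= K * x ^+ n) ->
  forall i, (i < n)%N -> p`_i = 0.
Proof.
move=> d0 K0; elim: n p => [|n ih] p H i //.
have p0 : p.[0] = 0.
  have c1 : p.[x] @[x --> (0 : R)^'+] --> p.[0].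
    by apply: cvg_at_right_filter; exact: continuous_horner.
  have c2 : K * x ^+ n.+1 @[x --> (0 : R)^'+] --> K * 0 ^+ n.+1.
    by apply: cvg_at_right_filter; apply: cvg_mulc; exact: exprn_continuous.
  have c3 : p.[x] @[x --> (0 : R)^'+] --> (0 : R).
    apply: norm_cvg0; apply: (squeeze_cvgr _ (cvg_cst 0) _).
    2: by move: c2; rewrite expr0n mulr0; exact.
    near=> x; rewrite normr_ge0/=; apply: H; first by near: x; exact: nbhs_right_gt.
    by near: x; exact: nbhs_right_lt.
  exact: (cvg_unique _ c1 c3).
have [q pq] : exists q, p = q * 'X.
  by exists (p %/ 'X); have /factor_theorem[q ->] : root p 0 by [apply/eqP]; rewrite subr0 mulpK ?polyX_eq0.
rewrite pq coefMX; case: i => [|i] //= iltn.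
apply: ih => // x x0 xd.
rewrite -(ler_pM2r x0) -mulrA -exprSr -{2}(ger0_norm (ltW x0)) -normrM.
by rewrite -hornerMX -pq; exact: H.
Unshelve. all: by end_near. Qed.

Lemma asy_uniq f p q : asy f p -> asy f q -> forall i, (i < 8)%N -> p`_i = q`_i.
Proof.
move=> [K [d [K0 d0 d1 H]]] [K' [d' [K0' d0' d1' H']]] i i8.
apply/eqP; rewrite -subr_eq0 -coefB; apply/eqP.
apply: (@asy_zero 8 (p - q) (K + K') (Num.min d d')) => //.
- by rewrite lt_min d0.
- exact: addr_ge0.
move=> x x0; rewrite lt_min => /andP[xd xd'].
rewrite hornerD hornerN (_ : _ - _ = (f x - q.[x]) - (f x - p.[x])); last by ring.
apply: (le_trans (ler_normB _ _)); rewrite [leRHS]mulrDl [leRHS]addrC.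
by apply: lerD; [exact: H'|exact: H].
Qed.

Lemma is_derive_sum_fact (a : nat -> R) n x :
  is_derive x 1 (fun z => \sum_(i < n.+1) a i * (z ^+ i / i`!%:R))
    (\sum_(i < n) a i.+1 * (x ^+ i / i`!%:R)).
Proof.
have h : is_derive x 1 (fun z => \sum_(i < n) a i.+1 * (z ^+ i.+1 / (i.+1)`!%:R))
    (\sum_(i < n) a i.+1 * (x ^+ i / i`!%:R)).
  apply: (deriv_sum (h := fun i z => a i.+1 * (z ^+ i.+1 / (i.+1)`!%:R))
      (dh := fun i => a i.+1 * (x ^+ i / i`!%:R))) => i _.
  apply: derivZ; apply: is_derive_eq; first exact: derivM (derivX _ (deriv_id _)) (derivC _ _).
  rewrite mulr0 addr0 mulr1 factS natrM invfM /=.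
  by rewrite -mulrA mulrCA; congr (_ * _); rewrite mulrA mulfV ?pnatr_eq0// mul1r.
rewrite (_ : (fun _ => _) = fun z => a 0 * (1 / 1) + \sum_(i < n) a i.+1 * (z ^+ i.+1 / (i.+1)`!%:R)).
  by apply: (is_derive_eq (derivD (derivC _ _) h)); rewrite add0r.
by apply/funext => z; rewrite big_ord_recl expr0 fact0.
Qed.

(** Stated for a whole chain of successive derivatives, so that the induction can shift the chain:
    the error for G 0 has the error for G 1 as its derivative. *)
Lemma taylor_bound (G : nat -> R -> R) n K d : 0 <= K ->
  (forall m x, 0 <= x <= d -> is_derive x 1 (G m) (G m.+1 x)) ->
  (forall x, 0 <= x <= d -> `|G n x| <= K) ->
  forall x, 0 <= x <= d -> `|G 0 x - \sum_(i < n) G i 0 * (x ^+ i / i`!%:R)| <= K * x ^+ n.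
Proof.
move=> K0; elim: n G => [|n ih] G HG HK x xd.
  by rewrite big_ord0 subr0 expr0 mulr1; exact: HK.
have /andP[x0 xd'] := xd.
pose T z := G 0 z - \sum_(i < n.+1) G i 0 * (z ^+ i / i`!%:R).
have T0 : T 0 = 0.
  by rewrite /T big_ord_recl expr0 fact0 divr1 mulr1 big1 ?addr0 ?subrr// => i _; rewrite /= expr0n mul0r mulr0.
have dT (z : R) : 0 <= z <= x -> is_derive z 1 T (G 1 z - \sum_(i < n) G i.+1 0 * (z ^+ i / i`!%:R)).
  move=> /andP[z0 zx]; apply: derivB; last exact: (is_derive_sum_fact (fun i => G i 0) n z).
  by apply: HG; rewrite z0 (le_trans zx).
have := mvt_le x0 dT (K := K * x ^+ n); rewrite T0 !subr0 -mulrA -exprSr; apply.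
move=> z /andP[z0 zx].
have := ih (fun m => G m.+1) (fun m => HG m.+1) HK z.
rewrite z0 (le_trans zx xd') => /(_ isT) h; apply: (le_trans h).
by apply: ler_wpM2l => //; apply: lerXn2r; rewrite ?nnegrE.
Qed.

Lemma asy_taylor (G : nat -> R -> R) :
  (forall m x, 0 <= x -> is_derive x 1 (G m) (G m.+1 x)) ->
  asy (G 0) (\poly_(i < 8) (G i 0 / i`!%:R)).
Proof.
move=> HG.
have c : G 8 x @[x --> (0 : R)] --> G 8 0 by exact: derivable_cvg (HG 8 0 (lexx _)).
have /cvgrPdist_le/(_ 1 ltr01)[/= d /= d0 Hd] := c.
set r := Num.min (d / 2) 1; have r0 : 0 < r by rewrite lt_min divr_gt0 /=.
have rd : r < d.
  by rewrite gt_min; apply/orP; left; lra.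
have K0 : 0 <= `|G 8 0| + 1 by rewrite addr_ge0.
exists (`|G 8 0| + 1), r; split=> //; first by rewrite ge_min lexx orbT.
move=> x x0 xr; rewrite horner_poly.
under eq_bigr do rewrite -mulrA [_^-1 * _]mulrC.
apply: (@taylor_bound G 8 _ r) => //.
- by move=> m z /andP[z0 _]; exact: HG.
- move=> z /andP[z0 zr]; rewrite -(subrK (G 8 0) (G 8 z)) addrC.
  apply: (le_trans (ler_normD _ _)); rewrite lerD2l distrC; apply: Hd.
  by rewrite /= sub0r normrN ger0_norm// (le_lt_trans zr).
- by rewrite !ltW.
Qed.

End Asymptotics.

(** * Derivatives of all orders of [inv_binom] *)

Section Smoothness.
Context {R : realType}.
Implicit Types (f g : R -> R) (a x : R) (n m : nat).

(** Peeling off the first derivative lets closure under products and inverses follow by induction on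
    n from the first-order rules, without a formula for higher derivatives. *)
Fixpoint smooth_upto n a f : Prop :=
  if n is m.+1 then (forall x, a < x -> derivable f x 1) /\ smooth_upto m a (derive1 f)
  else True.

Lemma derivable_derive1 f x : derivable f x 1 -> is_derive x 1 f (derive1 f x).
Proof. by move=> d; split=> //; rewrite derive1E. Qed.

Lemma is_derive_ext_right a f g x (df : R) : a < x -> (forall x, a < x -> f x = g x) ->
  is_derive x 1 f df -> is_derive x 1 g df.
Proof.
move=> ax fg; apply: near_eq_is_derive.
by near=> y; apply: fg; near: y; exact: lt_nbhsr.
Unshelve. all: by end_near. Qed.

Lemma smooth_upto_ext n a f g : (forall x, a < x -> f x = g x) ->
  smooth_upto n a f -> smooth_upto n a g.
Proof.
elim: n f g => [|n ih] f g fg //= [df sf].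
have d x : a < x -> is_derive x 1 g (derive1 f x).
  by move=> ax; apply: (is_derive_ext_right ax fg); apply: derivable_derive1; exact: df.
split; first by move=> x ax; have [] := d x ax.
by apply: ih sf => x ax; have dx := d x ax; rewrite [RHS]derive1E derive_val.
Qed.

Lemma smooth_upto_derive n a f f' : (forall x, a < x -> is_derive x 1 f (f' x)) ->
  smooth_upto n a f' -> smooth_upto n.+1 a f.
Proof.
move=> df sf; split; first by move=> x ax; have [] := df x ax.
by apply: smooth_upto_ext sf => x ax; have dx := df x ax; rewrite derive1E derive_val.
Qed.

Lemma smooth_upto_pred n a f : smooth_upto n.+1 a f -> smooth_upto n a f.
Proof. by elim: n f => [|n ih] f // [df sf]; split=> //; exact: ih. Qed.

Lemma smooth_uptoD n a f g : smooth_upto n a f -> smooth_upto n a g ->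
  smooth_upto n a (fun x => f x + g x).
Proof.
elim: n f g => [|n ih] f g // [df sf] [dg sg].
apply: (@smooth_upto_derive _ _ _ (fun x => derive1 f x + derive1 g x)); last exact: ih.
by move=> x ax; apply: derivD; apply: derivable_derive1; [exact: df|exact: dg].
Qed.

Lemma smooth_uptoM n a f g : smooth_upto n a f -> smooth_upto n a g ->
  smooth_upto n a (fun x => f x * g x).
Proof.
elim: n f g => [|n ih] f g // sf sg; have [df sf'] := sf; have [dg sg'] := sg.
have H x : a < x -> is_derive x 1 (fun x => f x * g x) (derive1 f x * g x + f x * derive1 g x).
  by move=> ax; apply: derivM; apply: derivable_derive1; [exact: df|exact: dg].
apply: (smooth_upto_derive H).
by apply: smooth_uptoD; apply: ih => //; exact: smooth_upto_pred.
Qed.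

Lemma smooth_upto_cst n a (c : R) : smooth_upto n a (fun=> c).
Proof.
elim: n c => [|n ih] c //.
by apply: (@smooth_upto_derive _ _ _ (fun=> 0)) => // x _; exact: derivC.
Qed.

Lemma smooth_upto_id n a : smooth_upto n a (fun x => x).
Proof.
case: n => [|n] //; apply: (@smooth_upto_derive n a _ (fun=> 1)).
exact: smooth_upto_cst.
Qed.

Lemma smooth_uptoV n a f : (forall x, a < x -> f x != 0) -> smooth_upto n a f ->
  smooth_upto n a (fun x => (f x)^-1).
Proof.
move=> f0; elim: n => [|n ih] // sf; have [df sf'] := sf.
have H x : a < x -> is_derive x 1 (fun x => (f x)^-1) (-1 * (derive1 f x * ((f x)^-1 * (f x)^-1))).
  move=> ax; apply: (is_derive_eq (derivV (f0 x ax) (derivable_derive1 (df x ax)))).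
  by rewrite -invfM -expr2 mulN1r mulNr.
apply: (smooth_upto_derive H); apply: smooth_uptoM; first exact: smooth_upto_cst.
apply: smooth_uptoM => //.
by apply: smooth_uptoM; apply: ih; exact: smooth_upto_pred.
Qed.

Lemma smooth_upto_derivable n m a f x : smooth_upto n a f -> (m < n)%N -> a < x ->
  derivable (derive1n m f) x 1.
Proof.
elim: n m f => [|n ih] [|m] f // [df sf] mn ax; first exact: df.
by rewrite derive1Sn; exact: ih.
Qed.

Lemma smooth_upto_Gamma_n n m (c : R) : 0 < c -> smooth_upto n 0 (fun x => Gamma_n m (c * x + 1)).
Proof.
move=> c0; elim: n m => [|n ih] m //.
apply: (@smooth_upto_derive _ _ _ (fun x => Gamma_n m.+1 (c * x + 1) * c)); last first.
  by apply: smooth_uptoM => //; exact: smooth_upto_cst.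
move=> x x0; apply: deriv_comp; first by apply: is_derive_Gamma_n; rewrite ltrDr mulr_gt0.
apply: (is_derive_eq (derivD (derivZ c (deriv_id _)) (derivC _ _))).
by rewrite addr0 mulr1.
Qed.

Lemma smooth_inv_binom s n : smooth_upto n (0 : R) (inv_binom s).
Proof.
have G1 x : 0 < x -> 0 < Gamma_n 0 (1 * x + 1).
  by move=> x0; rewrite Gamma_n0; apply: Gamma_gt0; lra.
have G2 x : 0 < x -> 0 < Gamma_n 0 (2 * x + 1).
  by move=> x0; rewrite Gamma_n0; apply: Gamma_gt0; lra.
have sX : smooth_upto n 0 (fun x : R => x ^+ s).
  elim: s => [|s ih].
    by apply: (@smooth_upto_ext _ _ (fun=> 1)) (smooth_upto_cst _ _ _) => x _; rewrite expr0.
  apply: (@smooth_upto_ext _ _ (fun x => x * x ^+ s)); first by move=> x _; rewrite exprS.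
  by apply: smooth_uptoM => //; exact: smooth_upto_id.
apply: (@smooth_upto_ext _ _ (fun x => (x ^+ s)^-1 * (Gamma_n 0 (1 * x + 1) * Gamma_n 0 (1 * x + 1) * (Gamma_n 0 (2 * x + 1))^-1))).
  move=> x x0; rewrite /inv_binom /central_binom !Gamma_n0 mul1r.
  by rewrite invfM invf_div mul1r expr2.
apply: smooth_uptoM.
  by apply: smooth_uptoV => // x x0; rewrite expf_neq0// gt_eqF.
apply: smooth_uptoM; last first.
  by apply: smooth_uptoV (smooth_upto_Gamma_n _ _ _) => // x x0; rewrite gt_eqF ?G2.
by apply: smooth_uptoM; exact: smooth_upto_Gamma_n.
Qed.

Lemma derivable_inv_binom s m (x : R) : 0 < x -> derivable (derive1n m (inv_binom s)) x 1.
Proof. exact: smooth_upto_derivable (smooth_inv_binom s m.+1) (leqnn _). Qed.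

Lemma is_derive_inv_binom s m (x : R) : 0 < x ->
  is_derive x 1 (derive1n m (inv_binom s)) (derive1n m.+1 (inv_binom s) x).
Proof. by move=> x0; rewrite derive1nS; exact/derivable_derive1/derivable_inv_binom. Qed.

End Smoothness.

(** * Improper integrals over ]0, pi/3[ *)

Section PrimitivesOnArc.
Context {R : realType}.
Implicit Types (g h F : R -> R) (v w t K : R).

(* The improper integral of [g] over ]0, pi/3[ is [v], expressed by a primitive. *)
Definition Jint g v := exists F,
  [/\ forall t, 0 < t < pi / 3 -> is_derive t 1 F (g t),
      F t @[t --> (0 : R)^'+] --> (0 : R) & F t @[t --> (pi / 3 : R)^'-] --> v].

Lemma pi3_gt0 : 0 < pi / 3 :> R.
Proof. by rewrite divr_gt0// pi_gt0. Qed.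

Lemma Jint_ext g h v : (forall t, 0 < t < pi / 3 -> g t = h t) -> Jint g v -> Jint h v.
Proof.
move=> gh [F [dF F0 F1]]; exists F; split=> // t t01.
by rewrite -gh//; exact: dF.
Qed.

Lemma JintD g h v w : Jint g v -> Jint h w -> Jint (fun t => g t + h t) (v + w).
Proof.
move=> [F [dF F0 F1]] [G [dG G0 G1]]; exists (fun t => F t + G t); split.
- by move=> t t01; apply: derivD; [exact: dF|exact: dG].
- exact: (cvg_eq (addr0 0) (cvgD F0 G0)).
- exact: cvgD.
Qed.

Lemma JintZ c g v : Jint g v -> Jint (fun t => c * g t) (c * v).
Proof.
move=> [F [dF F0 F1]]; exists (fun t => c * F t); split.
- by move=> t t01; apply: derivZ; exact: dF.
- exact: (cvg_eq (mulr0 c) (cvg_mulc F0)).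
- exact: cvg_mulc.
Qed.

Lemma JintB g h v w : Jint g v -> Jint h w -> Jint (fun t => g t - h t) (v - w).
Proof.
move=> Jg Jh; rewrite -(mulN1r w).
apply: Jint_ext (JintD Jg (JintZ (-1) Jh)) => t _.
by rewrite mulN1r.
Qed.

Lemma Jint_cst c : Jint (fun=> c) (c * (pi / 3)).
Proof.
exists (fun t => c * t); split.
- by move=> t _; apply: (is_derive_eq (derivZ c (deriv_id t))); rewrite mulr1.
- have h : (t : R) @[t --> (0 : R)^'+] --> (0 : R) by apply: cvg_at_right_filter; exact: cvg_id.
  exact: (cvg_eq (mulr0 c) (cvg_mulc h)).
- by apply: cvg_mulc; apply: cvg_at_left_filter; exact: cvg_id.
Qed.

(** The mean value inequality on [a, b], then a tends to 0 and b to pi/3. The case K = 0 makes the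
    value independent of the primitive. *)
Lemma Jint_bound g v K : (forall t, 0 < t < pi / 3 -> `|g t| <= K) -> Jint g v ->
  `|v| <= K * (pi / 3).
Proof.
move=> gK [F [dF F0 F1]].
have p0 := pi3_gt0.
have K0 : 0 <= K.
  have h : 0 < (pi / 3 / 2 : R) < pi / 3 by lra.
  exact: le_trans (normr_ge0 _) (gK _ h).
have L (a b : R) : 0 < a -> a <= b -> b < pi / 3 -> `|F b - F a| <= K * (pi / 3).
  move=> a0 ab bp.
  have h : `|F b - F a| <= K * (b - a).
    apply: (mvt_le (df := g)) => //.
      by move=> x /andP[ax xb]; apply: dF; rewrite (lt_le_trans a0)//= (le_lt_trans xb).
    by move=> x /andP[ax xb]; apply: gK; rewrite (lt_le_trans a0)//= (le_lt_trans xb).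
  by apply: (le_trans h); rewrite ler_wpM2l//; lra.
have M (b : R) : 0 < b -> b < pi / 3 -> `|F b| <= K * (pi / 3).
  move=> b0 bp; have c : (F b - F a) @[a --> (0 : R)^'+] --> F b - 0.
    by apply: cvgB => //; exact: cvg_cst.
  rewrite subr0 in c; apply: (cvg_to_le c); near=> a.
  have a0 : 0 < a by near: a; exact: nbhs_right_gt.
  have ab : a <= b by near: a; exact: nbhs_right_le.
  exact: L.
apply: (cvg_to_le F1); near=> b.
have b0 : 0 < b by near: b; apply: nbhs_left_gt.
have bp : b < pi / 3 by near: b; exact: nbhs_left_lt.
exact: M.
Unshelve. all: by end_near. Qed.

Lemma Jint_uniq g v w : Jint g v -> Jint g w -> v = w.
Proof.
move=> Jv Jw; apply/eqP; rewrite -subr_eq0 -normr_le0 -(mul0r (pi / 3)).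
apply: (@Jint_bound (fun=> 0)); first by move=> t _; rewrite normr0.
by apply: Jint_ext (JintB Jv Jw) => t _; rewrite subrr.
Qed.

Lemma Jint_sum n (f : nat -> R -> R) (a : nat -> R) :
  (forall i, (i < n)%N -> Jint (f i) (a i)) ->
  Jint (fun t => \sum_(i < n) f i t) (\sum_(i < n) a i).
Proof.
elim: n => [|n ih] H.
  have := Jint_cst 0; rewrite mul0r big_ord0; apply: Jint_ext => t _.
  by rewrite big_ord0.
rewrite big_ord_recr/=.
apply: (@Jint_ext (fun t => \sum_(i < n) f i t + f n t)).
  by move=> t _; rewrite big_ord_recr.
by apply: JintD; [apply: ih => i ilt; apply: H; exact: ltnW|exact: H].
Qed.

End PrimitivesOnArc.

(** * From the recursion in k to an integral over the arc *)

Section CentralBinomialTelescope.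
Context {R : realType}.
Implicit Types (t : R) (i j k m n : nat).

(* [ysin t] is the square of 2 sin (t / 2). *)
Definition ysin t : R := 2 - 2 * cos t.

Definition lnpow i t : R := ln (ysin t) ^+ i / i`!%:R.

Lemma cos_pi3 : cos (pi / 3) = 1 / 2 :> R.
Proof.
have p0 := @pi_gt0 R.
have c0 : 0 < cos (pi / 3) :> R by apply: cos_gt0_pihalf; lra.
have e : cos (pi / 3 + (pi / 3 + pi / 3)) = -1 :> R.
  by rewrite -cospi; congr cos; field.
move: e; rewrite !cosD sinD.
have := cos2Dsin2 (pi / 3 : R); move: (cos (pi / 3)) (sin (pi / 3)) c0 => c s c0 h1 h2.
(* This is cos (3x) + 1 = 4 c^3 - 3 c + 1 at x = pi/3, factored. *)
have : (c + 1) * (2 * c - 1) ^+ 2 = 0.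
  transitivity (c * (c * c - s * s) - s * (s * c + c * s) + 1 - 3 * c * (1 - (c ^+ 2 + s ^+ 2))).
    ring.
  by rewrite h1 h2; ring.
move/eqP; rewrite mulf_eq0 => /orP[/eqP|]; first by lra.
by rewrite expf_eq0 /= => /eqP; lra.
Qed.

Lemma sin_pi3 : sin (pi / 3) = Num.sqrt 3 / 2 :> R.
Proof.
have p0 := @pi_gt0 R.
have s0 : 0 < sin (pi / 3) :> R by apply: sin_gt0_pi; lra.
have h := cos2Dsin2 (pi / 3 : R).
have q0 : 0 < Num.sqrt 3 :> R by rewrite sqrtr_gt0.
have q2 : Num.sqrt 3 ^+ 2 = 3 :> R by rewrite sqr_sqrtr.
move: h s0; rewrite cos_pi3; move: (sin (pi / 3)) (Num.sqrt 3) q0 q2 => s q q0 q2 h s0.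
have e : (s - q / 2) * (s + q / 2) = 0.
  transitivity ((1 / 2) ^+ 2 + s ^+ 2 - 1 - (q ^+ 2 - 3) / 4); first by field.
  by rewrite h q2; ring.
by move/eqP: e; rewrite mulf_eq0 => /orP[/eqP|/eqP]; lra.
Qed.

Lemma sin_arc_gt0 t : 0 < t < pi / 3 -> 0 < sin t.
Proof.
move=> /andP[t0 t1]; apply: sin_gt0_pi; rewrite t0 (lt_le_trans t1)//.
have := @pi_gt0 R; lra.
Qed.

Lemma cos_arc t : 0 < t < pi / 3 -> 1 / 2 < cos t < 1.
Proof.
move=> /andP[t0 t1]; have p0 := @pi_gt0 R.
rewrite -cos_pi3 -{2}cos0 !ltr_cos ?t0 ?t1// in_itv/=; lra.
Qed.

Lemma ysin_arc t : 0 < t < pi / 3 -> 0 < ysin t < 1.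
Proof. by move=> /cos_arc; rewrite /ysin; lra. Qed.

Lemma is_derive_ysin t : is_derive t 1 ysin (2 * sin t).
Proof.
apply: (is_derive_eq (derivB (derivC 2 t) (derivZ 2 (is_derive_cos t)))).
by rewrite sub0r mulrN opprK.
Qed.

Lemma is_derive_lnpow i t : 0 < ysin t ->
  is_derive t 1 (lnpow i) ((if i is i'.+1 then lnpow i' t else 0) * (2 * sin t / ysin t)).
Proof.
move=> y0; have d := deriv_comp (is_derive1_ln y0) (is_derive_ysin t).
apply: (is_derive_eq (derivM (derivX i d) (derivC _ _))).
rewrite mulr0 addr0; case: i => [|i]; first by rewrite !mul0r.
rewrite /lnpow factS natrM /=.
have i0 : i.+1%:R != 0 :> R by rewrite pnatr_eq0.
have f0 : i`!%:R != 0 :> R by rewrite pnatr_eq0 -lt0n fact_gt0.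
move: (i.+1%:R) (i`!%:R) (ysin t) (ln (ysin t) ^+ i) i0 f0 y0 => A B y L A0 B0 y0.
by field; rewrite A0 B0 gt_eqF.
Qed.

(** For 0 < y < 1 one has |ln y|^i <= i! e^|ln y| = i! / y. *)
Lemma lnpow_bound i t : 0 < t < pi / 3 -> `|ysin t * lnpow i t| <= 1.
Proof.
move=> t01; have /andP[y0 y1] := ysin_arc t01; rewrite /lnpow.
have f0 : 0 < i`!%:R :> R by rewrite ltr0n fact_gt0.
rewrite mulrA normrM normfV [X in _ / X]gtr0_norm// ler_pdivrMr// mul1r.
rewrite normrM normrX (gtr0_norm y0).
have l0 : ln (ysin t) <= 0 by rewrite ln_le0// ltW.
have := exprn_le_expR i (normr_ge0 (ln (ysin t))).
rewrite {2}(ler0_norm l0) expRN lnK ?posrE// => h.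
apply: (@le_trans _ _ (ysin t * (i`!%:R / ysin t))); first by rewrite ler_wpM2l// ltW.
by rewrite mulrCA mulfV ?gt_eqF// mulr1.
Qed.

Definition Wfun j t : R := 2 * sin t * ysin t ^+ j.

Lemma sin_ysin t : 4 * sin t ^+ 2 = ysin t * (4 - ysin t).
Proof. by rewrite sin2cos2 /ysin; ring. Qed.

(** By 4 sin^2 t = y (4 - y) and 2 cos t = 2 - y the derivative is a function of y alone. Its
    factors 4j + 2 and j + 1 are those of [a_rec], which is what makes the sum over j telescope. *)
Lemma is_derive_Wfun_lnpow i j t : 0 < ysin t ->
  is_derive t 1 (fun t => Wfun j t * lnpow i t)
    (ysin t ^+ j * (((4 * j + 2)%:R - j.+1%:R * ysin t) * lnpow i t +
       (4 - ysin t) * (if i is i'.+1 then lnpow i' t else 0))).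
Proof.
move=> y0; have dW := derivM (derivZ 2 (is_derive_sin t)) (derivX j (is_derive_ysin t)).
apply: (is_derive_eq (derivM dW (is_derive_lnpow i y0))).
have sy := sin_ysin t; have cy : cos t = (2 - ysin t) / 2 by rewrite /ysin; field.
have J1 k : k.+1%:R = k%:R + 1 :> R by rewrite natr1.
rewrite natrD natrM (J1 j) cy /Wfun.
move: (sin t) (ysin t) y0 sy (lnpow i t) (if i is _.+1 then _ else _) => s y y0 sy e e'.
apply/eqP; rewrite -subr_eq0; apply/eqP.
case: j {dW} => [|j].
  rewrite /= !expr0; transitivity ((4 * s ^+ 2 - y * (4 - y)) * (e' / y)).
    by field; rewrite gt_eqF.
  by rewrite sy subrr mul0r.
rewrite /= (J1 j); move: (j%:R) => J; rewrite exprS; move: (y ^+ j) => Y.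
transitivity ((4 * s ^+ 2 - y * (4 - y)) * ((J + 1) * Y * e + Y * e')).
  by field; rewrite gt_eqF.
by rewrite sy subrr mul0r.
Qed.

(** With q the fourth root of y, the sine is at most q^2, while the powers of ln y = 4 ln q cost
    only a factor 1/q. A factor q remains. *)
Lemma Wfun_lnpow_cvg0 i j : Wfun j t * lnpow i t @[t --> (0 : R)^'+] --> (0 : R).
Proof.
pose q t : R := Num.sqrt (Num.sqrt (ysin t)).
have qc : q t @[t --> (0 : R)^'+] --> (0 : R).
  have y0 : ysin 0 = 0 by rewrite /ysin cos0; ring.
  have c : ysin t @[t --> (0 : R)] --> ysin 0 by exact: derivable_cvg (is_derive_ysin 0).
  have c1 : Num.sqrt (ysin t) @[t --> (0 : R)] --> Num.sqrt (ysin 0).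
    by apply: continuous_comp => //; exact: sqrt_continuous.
  have c2 : q t @[t --> (0 : R)] --> q 0.
    by apply: (continuous_comp (f := fun t => Num.sqrt (ysin t))) => //; exact: sqrt_continuous.
  by apply: cvg_at_right_filter; move: c2; rewrite {2}/q y0 !sqrtr0.
have h : 2 * 4 ^+ i * q t @[t --> (0 : R)^'+] --> (0 : R).
  exact: (cvg_eq (mulr0 _) (cvg_mulc qc)).
apply: norm_cvg0; apply: (squeeze_cvgr _ (cvg_cst 0) h); near=> t.
rewrite normr_ge0 /=.
have t0 : 0 < t by near: t; exact: nbhs_right_gt.
have tp : t < pi / 3 by near: t; apply: nbhs_right_lt; exact: pi3_gt0.
have t01 : 0 < t < pi / 3 by rewrite t0.
have /andP[y0 y1] := ysin_arc t01.
have s0 := sin_arc_gt0 t01.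
have q0 : 0 < q t by rewrite !sqrtr_gt0.
have q2 : q t ^+ 2 = Num.sqrt (ysin t) by rewrite sqr_sqrtr// sqrtr_ge0.
have q4 : q t ^+ 4 = ysin t by rewrite (exprM _ 2 2) q2 sqr_sqrtr// ltW.
have sq : sin t <= q t ^+ 2.
  have h2 : sin t ^+ 2 <= ysin t.
    have e1 := sin_ysin t; have e2 : 0 <= ysin t ^+ 2 by exact: sqr_ge0.
    by move: (ysin t) (sin t ^+ 2) e1 e2 => y S e1 e2; lra.
  have qq : 0 <= q t ^+ 2 by rewrite exprn_ge0// ltW.
  by rewrite -(ler_pXn2r (n := 2))// ?nnegrE// ?(ltW s0)// -exprM q4.
have q1 : q t <= 1.
  rewrite -(@expr_le1 _ 4) ?q4 ?ltW//.
have lq : ln (q t) <= 0 by rewrite ln_le0.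
have f0 : 0 < i`!%:R :> R by rewrite ltr0n fact_gt0.
have Lb : `|lnpow i t| <= 4 ^+ i / q t.
  rewrite /lnpow -q4 lnXn// normrM normfV (gtr0_norm f0) ler_pdivrMr//.
  have -> : ln (q t) *+ 4 = 4 * ln (q t) by rewrite mulr_natl.
  rewrite normrX normrM (ger0_norm (ler0n _ 4)) exprMn -mulrA; apply: ler_wpM2l; first exact: exprn_ge0.
  apply: (le_trans (exprn_le_expR i (normr_ge0 _))).
  by rewrite (ler0_norm lq) expRN lnK ?posrE// mulrC.
have yj : ysin t ^+ j <= 1 by rewrite exprn_ile1// ltW.
have s2 : 0 <= 2 * sin t by rewrite mulr_ge0// ltW.
have yj0 : 0 <= ysin t ^+ j by rewrite exprn_ge0// ltW.
rewrite /Wfun normrM (ger0_norm (mulr_ge0 s2 yj0)).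
apply: (@le_trans _ _ (2 * q t ^+ 2 * 1 * (4 ^+ i / q t))).
  apply: ler_pM => //; first exact: mulr_ge0.
  by apply: ler_pM => //; rewrite ler_wpM2l.
rewrite [leLHS](_ : _ = 2 * 4 ^+ i * q t)//; field; exact: lt0r_neq0.
Unshelve. all: by end_near. Qed.

Section Sequences.
Variables (a : nat -> nat -> R) (c : nat -> R).
(** With [a k m] the m-th Taylor coefficient of f at k, [sigma j m] is that of x f(x) at j, and
    [a_rec] compares coefficients in (4x + 2) f(x + 1) = x f(x). At j = 0, where f has a pole, x
    f(x) stands for 1 / binom(2x, x), whose coefficients are [c]. *)
Let b k m := if m is m'.+1 then a k m' else 0.
Let sigma j m := if j is 0 then c m else j%:R * a j m + b j m.
Hypothesis a_rec : forall j m, (4 * j + 2)%:R * a j.+1 m + 4 * b j.+1 m = sigma j m.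

(** The recursion divides by about 4 at each step in k, so a decay of order 1/k^2 propagates easily
    and suffices for [sigma_cvg0]. The factor 10 gives 5 B <= D / 2, after which the step reduces to
    (n + 1)^2 <= 4 n^2. *)
Let a_decay m : exists2 B, 0 <= B & forall k, `|a k.+1 m| <= B / k.+1%:R ^+ 2.
Proof.
suff H m' B : 0 <= B -> (forall k, `|b k.+1 m'| <= B / k.+1%:R ^+ 2) ->
    forall k, `|a k.+1 m'| <= (`|c m'| + 10 * B) / k.+1%:R ^+ 2.
  elim: m => [|m [B B0 HB]].
    exists (`|c 0| + 10 * 0); first by rewrite mulr0 addr0.
    by apply: H => // k; rewrite /= normr0 mul0r.
  by exists (`|c m.+1| + 10 * B); [rewrite addr_ge0 ?mulr_ge0|exact: H].
move=> B0 HB; have c0 := normr_ge0 (c m').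
elim=> [|k ih].
  have := a_rec 0 m'; rewrite /sigma muln0 add0n => h.
  have := HB 0; rewrite expr1n !divr1; move: h c0.
  move: (a 1 m') (b 1 m') (c m') => x y z h; rewrite (_ : x = (z - 4 * y) / 2); last by rewrite -h; field.
  by move=> z0 yB; rewrite normrM normfV (ger0_norm (ler0n _ 2)) ler_pdivrMr//;
     apply: (le_trans (ler_normB _ _)); rewrite normrM (ger0_norm (ler0n _ 4)); lra.
have := a_rec k.+1 m'; rewrite /sigma.
have k1 : 1 <= k.+1%:R :> R by rewrite ler1n.
have e : k.+2%:R = k.+1%:R + 1 :> R by rewrite natr1.
have := HB k.+1; have := HB k; rewrite e natrD natrM.
move: ih k1; move: (a k.+2 m') (a k.+1 m') (b k.+2 m') (b k.+1 m') (k.+1%:R) => x y u v n.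
set D := `|c m'| + 10 * B => hy n1 hv hu h.
have n0 : 0 < n by lra.
have D1 : 10 * B <= D by rewrite /D lerDr.
have D0 : 0 <= D by apply: le_trans D1; rewrite mulr_ge0.
have -> : x = (n * y + v - 4 * u) / (4 * n + 2) by rewrite -h; field; lra.
rewrite normrM normfV (gtr0_norm (_ : 0 < 4 * n + 2)); last lra.
rewrite ler_pdivrMr; last lra.
have u1 : `|u| <= B / n ^+ 2.
  apply: (le_trans hu); apply: ler_wpM2l => //; rewrite lef_pV2 ?posrE ?exprn_gt0//; last lra.
  by apply: lerXn2r; rewrite ?nnegrE; lra.
have step : `|n * y + v - 4 * u| <= (n * D + 5 * B) / n ^+ 2.
  apply: (le_trans (ler_normB _ _)); apply: (le_trans (lerD (ler_normD _ _) (lexx _))).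
  rewrite !normrM (gtr0_norm n0) (ger0_norm (ler0n _ 4)).
  have hy' := ler_wpM2l (ltW n0) hy.
  have -> : (n * D + 5 * B) / n ^+ 2 = n * (D / n ^+ 2) + B / n ^+ 2 + 4 * (B / n ^+ 2) by field; lra.
  by move: hy' hv u1; move: (n * (D / _)) (B / _) => p q; lra.
apply: (le_trans step); rewrite ler_pdivrMr ?exprn_gt0//.
have -> : D / (n + 1) ^+ 2 * (4 * n + 2) * n ^+ 2 = (D * (4 * n + 2) * n ^+ 2) / (n + 1) ^+ 2 by field; lra.
rewrite ler_pdivlMr; last by rewrite exprn_gt0//; lra.
have h1 : (n * D + 5 * B) * (n + 1) ^+ 2 <= (n * D + D / 2) * (n + 1) ^+ 2.
  by apply: ler_wpM2r; [apply: exprn_ge0|]; lra.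
apply: (le_trans h1); rewrite -subr_ge0.
have -> : D * (4 * n + 2) * n ^+ 2 - (n * D + D / 2) * (n + 1) ^+ 2 =
   D * ((n + 1 / 2) * ((3 * n + 1) * (n - 1) )) by field.
by apply: mulr_ge0 => //; apply: mulr_ge0; [lra|apply: mulr_ge0; lra].
Qed.

Let sigma_cvg0 m : sigma N m @[N --> \oo] --> (0 : R).
Proof.
have [A A0 HA] := a_decay m.
have [B B0 HB] : exists2 B, 0 <= B & forall k, `|b k.+1 m| <= B / k.+1%:R ^+ 2.
  case: m {HA} => [|m]; last exact: a_decay.
  by exists 0 => // k; rewrite /= normr0 mul0r.
apply: (@cvg_harmonic_bound _ (sigma^~ m) (A + B)) => n.
rewrite /sigma; apply: (le_trans (ler_normD _ _)).
have k1 : 1 <= n.+1%:R :> R by rewrite ler1n.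
rewrite normrM; move: (HA n) (HB n) k1; move: (a _ _) (b _ _) (n.+1%:R) => x y k hx hy k1.
rewrite (ger0_norm (_ : 0 <= k)); last lra.
have k0 : 0 <= k by lra.
have h := ler_wpM2l k0 hx.
rewrite mulrDl; apply: lerD.
  by apply: (le_trans h); rewrite [leLHS](_ : _ = A / k)//; field; lra.
apply: (le_trans hy); apply: ler_wpM2l => //; rewrite lef_pV2 ?posrE ?exprn_gt0//; try lra.
by rewrite expr2 ler_peMr.
Qed.

Let s N n t := \sum_(i < n.+1) sigma N (n - i)%N * (ysin t ^+ N * lnpow i t).

Let u N n t := \sum_(k < N) \sum_(i < n.+1) a k.+1 (n - i)%N * (Wfun k t * lnpow i t).

Let sum_shift k n (e : nat -> R) :
  \sum_(i < n.+1) a k (n - i)%N * (if val i is i'.+1 then e i' else 0) =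
  \sum_(i < n.+1) b k (n - i)%N * e i.
Proof.
rewrite big_ord_recl mulr0 add0r big_ord_recr /= subnn mul0r addr0.
by apply: eq_bigr => i _; rewrite /bump /= add1n add0n -(subnSK (ltn_ord i)).
Qed.

Let is_derive_u N n t : 0 < ysin t -> is_derive t 1 (u N n) (s 0 n t - s N n t).
Proof.
move=> y0; elim: N => [|N ih].
  rewrite subrr (_ : u 0 n = fun=> 0); first exact: derivC.
  by apply/funext => z; rewrite /u big_ord0.
rewrite (_ : u N.+1 n = fun z => u N n z + \sum_(i < n.+1) a N.+1 (n - i)%N * (Wfun N z * lnpow i z)); last first.
  by apply/funext => z; rewrite /u big_ord_recr.
have d := deriv_sum (n := n.+1) (h := fun i z => a N.+1 (n - i)%N * (Wfun N z * lnpow i z))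
   (fun i _ => derivZ (a N.+1 (n - i)%N) (is_derive_Wfun_lnpow i N y0)).
apply: (is_derive_eq (derivD ih d)).
have -> : \sum_(i < n.+1) a N.+1 (n - i)%N *
   (ysin t ^+ N * (((4 * N + 2)%:R - N.+1%:R * ysin t) * lnpow i t +
     (4 - ysin t) * (if val i is i'.+1 then lnpow i' t else 0))) = s N n t - s N.+1 n t.
  transitivity (ysin t ^+ N * ((4 * N + 2)%:R - N.+1%:R * ysin t) * (\sum_(i < n.+1) a N.+1 (n - i)%N * lnpow i t)
     + ysin t ^+ N * (4 - ysin t) * (\sum_(i < n.+1) b N.+1 (n - i)%N * lnpow i t)).
    rewrite -(sum_shift _ _ (fun i => lnpow i t)) !mulr_sumr -big_split; apply: eq_bigr => -[[|i] ilt] _ /=; ring.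
  rewrite /s !mulr_sumr -big_split -sumrB; apply: eq_bigr => i _ /=.
  by rewrite -a_rec exprS; ring.
ring.
Qed.

(** The primitive [u N] of [s 0 - s N] tends to 0 at 0. At pi/3 one has y = 1, so all positive
    powers of ln y drop out, and 2 sin t = sqrt 3: there [u N] is sqrt 3 times the N-th partial sum.
    The integral of [s N] tends to 0 with [sigma N]. *)
Lemma telescope_cvg n v :
  Jint (fun t => \sum_(i < n.+1) c (n - i)%N * lnpow i t) v ->
  \sum_(k < N) a k.+1 n @[N --> \oo] --> v / Num.sqrt 3.
Proof.
move=> [F [dF F0 F1]].
have q0 : Num.sqrt 3 != 0 :> R by rewrite sqrtr_eq0 -ltNge.
have y1 : ysin (pi / 3) = 1 by rewrite /ysin cos_pi3; field.
have uE N : u N n (pi / 3) = Num.sqrt 3 * \sum_(k < N) a k.+1 n.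
  rewrite /u mulr_sumr; apply: eq_bigr => k _.
  rewrite big_ord_recl big1 ?addr0; last first.
    by move=> i _; rewrite /lnpow y1 ln1 expr0n mul0r !mulr0.
  rewrite subn0 /Wfun /lnpow y1 expr1n expr0 fact0 divr1 sin_pi3.
  by field.
have JN N : Jint (s N n) (v - Num.sqrt 3 * \sum_(k < N) a k.+1 n).
  exists (fun t => F t - u N n t); split.
  - move=> t t01; have /andP[y0 _] := ysin_arc t01.
    apply: (is_derive_eq (derivB (dF t t01) (is_derive_u N n y0))).
    rewrite opprB addrCA (_ : \sum_(i < n.+1) _ = s 0 n t) ?subrr ?addr0//.
    by apply: eq_bigr => i _; rewrite expr0 mul1r.
  - apply: (cvg_eq (subrr 0)); apply: cvgB => //.
    apply: (cvg_eq (a := \sum_(k < N) 0)); first by rewrite big1.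
    apply: (cvg_sum_ord (f := fun k t => \sum_(i < n.+1) a k.+1 (n - i)%N * (Wfun k t * lnpow i t)) (a := fun=> 0)) => k _.
    apply: (cvg_eq (a := \sum_(i < n.+1) 0)); first by rewrite big1.
    apply: (cvg_sum_ord (f := fun i t => a k.+1 (n - i)%N * (Wfun k t * lnpow i t)) (a := fun=> 0)) => i _.
    exact: (cvg_eq (mulr0 _) (cvg_mulc (Wfun_lnpow_cvg0 i k))).
  - apply: cvgB => //; rewrite -uE; apply: cvg_at_left_filter.
    by apply: derivable_cvg (is_derive_u N n _); rewrite y1.
(* The index N.+1 leaves one factor y to tame the logarithms through [lnpow_bound]. *)
have bnd N : `|v - Num.sqrt 3 * \sum_(k < N.+1) a k.+1 n| <= (\sum_(i < n.+1) `|sigma N.+1 (n - i)%N|) * (pi / 3).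
  apply: Jint_bound (JN N.+1) => t t01; have /andP[y0 y1'] := ysin_arc t01.
  apply: (le_trans (ler_norm_sum _ _ _)); apply: ler_sum => i _.
  rewrite normrM ler_piMr// exprSr -mulrA normrM.
  apply: mulr_ile1 => //; last exact: lnpow_bound.
  by rewrite ger0_norm ?exprn_ge0 ?exprn_ile1 ?ltW.
have lim0 : (\sum_(i < n.+1) `|sigma N.+1 (n - i)%N|) * (pi / 3) @[N --> \oo] --> (0 : R).
  apply: (cvg_eq (mul0r (pi / 3))); apply: cvgM; last exact: cvg_cst.
  apply: (cvg_eq (a := \sum_(i < n.+1) 0)); first by rewrite big1.
  apply: (cvg_sum_ord (f := fun i N => `|sigma N.+1 (n - i)%N|) (a := fun=> 0)) => i _.
  apply: (cvg_eq (normr0 R)); apply: cvg_norm.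
  by rewrite (cvg_shiftS (sigma^~ (n - i)%N)); exact: sigma_cvg0.
have lim1 : v - Num.sqrt 3 * \sum_(k < N.+1) a k.+1 n @[N --> \oo] --> (0 : R).
  apply: norm_cvg0; apply: (squeeze_cvgr _ (cvg_cst 0) lim0).
  by apply: nearW => N; rewrite normr_ge0/= bnd.
rewrite -(cvg_shiftS (fun N => \sum_(k < N) a k.+1 n)).
have -> : [sequence \sum_(k < N.+1) a k.+1 n]_N =
    (fun N => (v - (v - Num.sqrt 3 * \sum_(k < N.+1) a k.+1 n)) / Num.sqrt 3).
  by apply/funext => N /=; field.
apply: cvgM; last exact: cvg_cst.
by apply: (cvg_eq (subr0 v)); apply: cvgB => //; exact: cvg_cst.
Qed.

End Sequences.

End CentralBinomialTelescope.

(** * Taylor coefficients of the inverse binomial as polynomials in zeta values *)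

Section InvBinomCoefficients.
Context {R : realType}.
Implicit Types (x z : R) (k m n : nat).
#[local] Opaque Gamma.

Let deriv_shift1 (f : R -> R) x (df : R) : is_derive (x + 1) 1 f df ->
  is_derive x 1 (fun x => f (x + 1)) df.
Proof.
move=> h; have d : is_derive x 1 (fun x : R => x + 1) 1.
  by apply: (is_derive_eq (derivD (deriv_id x) (derivC 1 x))); rewrite addr0.
by apply: (is_derive_eq (deriv_comp (g := fun x : R => x + 1) h d)); rewrite mulr1.
Qed.

Lemma inv_binom_rec x : 0 <= x -> (4 * x + 2) * inv_binom 1 (x + 1) = Cinv x.
Proof.
move=> x0; rewrite /inv_binom /central_binom /Cinv expr1.
have -> : 2 * (x + 1) + 1 = 2 * x + 1 + 1 + 1 by ring.
have g1 : 0 < Gamma (x + 1) by apply: Gamma_gt0; lra.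
have g2 : 0 < Gamma (2 * x + 1) by apply: Gamma_gt0; lra.
rewrite [Gamma (x + 1 + 1)]GammaD1; last lra.
rewrite [Gamma (2 * x + 1 + 1 + 1)]GammaD1; last lra.
rewrite [Gamma (2 * x + 1 + 1)]GammaD1; last lra.
move: (Gamma (x + 1)) (Gamma (2 * x + 1)) g1 g2 => A B A0 B0.
by field; rewrite !gt_eqF//=; lra.
Qed.

Lemma inv_binomE x : 0 < x -> x * inv_binom 1 x = Cinv x.
Proof.
move=> x0; rewrite /inv_binom /central_binom /Cinv expr1.
have g1 : 0 < Gamma (x + 1) by apply: Gamma_gt0; lra.
have g2 : 0 < Gamma (2 * x + 1) by apply: Gamma_gt0; lra.
move: (Gamma (x + 1)) (Gamma (2 * x + 1)) g1 g2 => A B A0 B0.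
by field; rewrite !gt_eqF.
Qed.

(** Leibniz's rule on both sides of the recursion: a linear factor contributes only one further
    term. At m = 0 the term with [m.-1] is killed by its factor m. *)
Let deriv_seq_rec (F : nat -> R -> R)
  (dF : forall m x, 0 < x -> is_derive x 1 (F m) (F m.+1 x))
  (F0 : forall x, 0 < x -> (4 * x + 2) * F 0 (x + 1) = x * F 0 x) m x : 0 < x ->
  (4 * x + 2) * F m (x + 1) + 4 * m%:R * F m.-1 (x + 1) = x * F m x + m%:R * F m.-1 x.
Proof.
elim: m x => [|m ih] x x0.
  by rewrite !mulr0 !mul0r !addr0 F0.
have x1 : 0 < x + 1 by lra.
have dshift j : is_derive x 1 (fun x => F j (x + 1)) (F j.+1 (x + 1)).
  by apply: deriv_shift1; exact: dF.
have dl : is_derive x 1 (fun x => (4 * x + 2) * F m (x + 1) + 4 * m%:R * F m.-1 (x + 1))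
    ((4 * x + 2) * F m.+1 (x + 1) + 4 * m.+1%:R * F m (x + 1)).
  apply: (is_derive_eq (derivD (derivM (derivD (derivZ 4 (deriv_id x)) (derivC 2 x)) (dshift m))
     (derivZ (4 * m%:R) (dshift m.-1)))).
  rewrite -natr1; case: m {ih} => [|m] /=; ring.
have dr : is_derive x 1 (fun x => x * F m x + m%:R * F m.-1 x)
    (x * F m.+1 x + m.+1%:R * F m x).
  have d1 : is_derive x 1 (fun x => x * F m x) (1 * F m x + x * F m.+1 x).
    exact: (derivM (deriv_id x) (dF m x x0)).
  have d2 : is_derive x 1 (fun x => m%:R * F m.-1 x) (m%:R * F m.-1.+1 x).
    exact: (derivZ _ (dF m.-1 x x0)).
  apply: (is_derive_eq (derivD d1 d2)).
  rewrite -natr1; case: m {ih dl d1 d2} => [|m] /=; ring.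
have dl' := is_derive_ext_right x0 (fun y y0 => ih y y0) dl.
by have [_ <-] := dl'; have [_ <-] := dr.
Qed.

Let F m x : R := derive1n m (inv_binom 1) x.

Let dF m x : 0 < x -> is_derive x 1 (F m) (F m.+1 x).
Proof. exact: is_derive_inv_binom. Qed.

Let F_rec m x : 0 < x ->
  (4 * x + 2) * F m (x + 1) + 4 * m%:R * F m.-1 (x + 1) = x * F m x + m%:R * F m.-1 x.
Proof.
apply: deriv_seq_rec; first exact: dF.
move=> {}x x0; exact: (etrans (inv_binom_rec (ltW x0)) (esym (inv_binomE x0))).
Qed.

Definition acoef k m : R := derive1n m (inv_binom 1) k%:R / m`!%:R.

(* By [inv_binom_rec], the Taylor coefficients of [Cinv] at [0] in terms of those of
   [inv_binom 1] at [1]. *)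
Definition ccoef m : R := 2 * acoef 1 m + 4 * (if m is m'.+1 then acoef 1 m' else 0).

Let coef_rec (H : nat -> R -> R)
  (Hrec : forall m x, 0 < x ->
     (4 * x + 2) * H m (x + 1) + 4 * m%:R * H m.-1 (x + 1) = x * H m x + m%:R * H m.-1 x)
  (h := fun k m => H m k%:R / m`!%:R) j m :
  (4 * j.+1 + 2)%:R * h j.+2 m + 4 * (if m is m'.+1 then h j.+2 m' else 0) =
  j.+1%:R * h j.+1 m + (if m is m'.+1 then h j.+1 m' else 0).
Proof.
have j0 : 0 < j.+1%:R :> R by rewrite ltr0n.
have := Hrec m _ j0.
have -> : j.+1%:R + 1 = j.+2%:R :> R by rewrite natr1.
rewrite natrD natrM /h.
have m0 : m`!%:R != 0 :> R by rewrite pnatr_eq0 -lt0n fact_gt0.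
case: m m0 => [|m] m0.
  by rewrite !mulr0 !mul0r !addr0 fact0 !divr1.
rewrite /= factS natrM in m0 *; move: m0; rewrite mulf_eq0 negb_or => /andP[m1 m0].
move: (H m.+1 j.+2%:R) (H m j.+2%:R) (H m.+1 j.+1%:R) (H m j.+1%:R) => x y z w.
move: (m.+1%:R) (m`!%:R) (j.+1%:R) m0 m1 => M f J f0 M0 e.
transitivity (((4 * J + 2) * x + 4 * M * y) / (M * f)); first by field; rewrite f0.
by rewrite e; field; rewrite f0.
Qed.

Lemma acoef_rec j m :
  (4 * j + 2)%:R * acoef j.+1 m + 4 * (if m is m'.+1 then acoef j.+1 m' else 0) =
  if j is 0 then ccoef m else j%:R * acoef j m + (if m is m'.+1 then acoef j m' else 0).
Proof. by case: j => [|j]; [|exact: (coef_rec F_rec)]. Qed.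

Let G m z : R := (4 * z + 2) * F m (z + 1) + 4 * m%:R * F m.-1 (z + 1).

Let taylor_coef (H : nat -> R -> R) (h := fun m => H m 1 / m`!%:R) m :
  2 * h m + 4 * (if m is m'.+1 then h m' else 0) =
  ((4 * 0 + 2) * H m (0 + 1) + 4 * m%:R * H m.-1 (0 + 1)) / m`!%:R.
Proof.
rewrite mulr0 !add0r /h.
have m0 : m`!%:R != 0 :> R by rewrite pnatr_eq0 -lt0n fact_gt0.
case: m m0 => [|m] m0; first by rewrite !mulr0 mul0r !addr0 fact0 !divr1.
rewrite /= factS natrM in m0 *; move: m0; rewrite mulf_eq0 negb_or => /andP[m1 m0].
move: (H m.+1 1) (H m 1) (m.+1%:R) (m`!%:R) m0 m1 => x y M f f0 M0.
by field; rewrite f0.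
Qed.

(** [Cinv] itself would call for derivatives of [Gamma] at 1, the end of the range where they are
    available. Instead it is replaced by (4z + 2) f(z + 1), which is smooth across z = 0 and agrees
    with [Cinv] for z > 0. *)
Lemma asy_Cinv_taylor : asy Cinv (\poly_(i < 8) ccoef i).
Proof.
have dG m z : 0 <= z -> is_derive z 1 (G m) (G m.+1 z).
  move=> z0; have z1 : 0 < z + 1 by lra.
  have dshift j : is_derive z 1 (fun x => F j (x + 1)) (F j.+1 (z + 1)).
    by apply: deriv_shift1; exact: dF.
  apply: (is_derive_eq (derivD (derivM (derivD (derivZ 4 (deriv_id z)) (derivC 2 z)) (dshift m))
     (derivZ (4 * m%:R) (dshift m.-1)))).
  rewrite /G -natr1; case: m => [|m] /=; ring.
apply: (@asy_ext _ (G 0)).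
  move=> x x0; have h := inv_binom_rec (ltW x0).
  by rewrite /G mulr0 mul0r addr0; exact: h.
have -> : \poly_(i < 8) ccoef i = \poly_(i < 8) (G i 0 / i`!%:R).
  apply/polyP => i; rewrite !coef_poly; case: ifP => // _.
  exact: (taylor_coef F).
exact: asy_taylor.
Qed.

Definition logC_poly : {poly R} := \poly_(i < 6) (lamC i.+1 * zeta i.+2).

Lemma asy_Cinv_zeta : asy Cinv (1 + 'X^2 * logC_poly + 2^-1 *: ('X^2 * logC_poly) ^+ 2
  + 6^-1 *: ('X^2 * logC_poly) ^+ 3).
Proof.
apply: (@asy_ext _ (fun x => expR (ln (Cinv x)))).
  by move=> x x0; rewrite lnK// posrE Cinv_gt0// ltW.
apply: asy_expR; exists 516, 1.
split; [exact: ler0n|exact: ltr01|exact: lexx|move=> x x0 _].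
rewrite hornerM hornerXn horner_poly mulr_sumr.
rewrite (_ : \sum_(i < 6) _ = \sum_(i < 6) lamC i.+1 * zeta i.+2 * x ^+ i.+2).
  by apply: ln_Cinv_expand; exact: ltW.
by apply: eq_bigr => i _; rewrite mulrCA -exprD.
Qed.

Lemma ccoefE m : (m < 8)%N -> ccoef m = (1 + 'X^2 * logC_poly + 2^-1 *: ('X^2 * logC_poly) ^+ 2
  + 6^-1 *: ('X^2 * logC_poly) ^+ 3)`_m.
Proof.
move=> m8; rewrite -(asy_uniq asy_Cinv_taylor asy_Cinv_zeta m8).
by rewrite coef_poly m8.
Qed.

(** The coefficients up to x^7 of the exponential of x^2 [logC_poly]. The zeta values are
    parameters, so that those at even arguments can later become powers of pi. *)
Definition cval (z2 z3 z4 z5 z6 z7 : R) m : R := nth 0 [:: 1; 0; - z2; 2 * z3;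
  - (7 / 2) * z4 + z2 ^+ 2 / 2; 6 * z5 - 2 * z2 * z3;
  - (31 / 3) * z6 + 7 / 2 * z2 * z4 + 2 * z3 ^+ 2 - z2 ^+ 3 / 6;
  18 * z7 - 6 * z2 * z5 - 7 * z3 * z4 + z2 ^+ 2 * z3] m.

Lemma ccoef_val m : (m < 8)%N ->
  ccoef m = cval (zeta 2) (zeta 3) (zeta 4) (zeta 5) (zeta 6) (zeta 7) m.
Proof.
move=> m8; rewrite ccoefE//.
have e2 : ('X^2 * logC_poly) ^+ 2 = 'X^4 * (logC_poly * logC_poly).
  by rewrite exprMn -exprM expr2.
have e3 : ('X^2 * logC_poly) ^+ 3 = 'X^6 * (logC_poly * (logC_poly * logC_poly)).
  by rewrite exprMn -exprM exprS expr2.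
rewrite e2 e3 !coefD !coefZ !coefXnM coef1.
have [q0 q1 q2] : [/\ logC_poly`_0 = - zeta 2, logC_poly`_1 = 2 * zeta 3 &
    logC_poly`_2 = - (7 / 2) * zeta 4].
  by rewrite !coef_poly /= /lamC; split; field.
have [q3 q4 q5] : [/\ logC_poly`_3 = 6 * zeta 5, logC_poly`_4 = - (31 / 3) * zeta 6 &
    logC_poly`_5 = 18 * zeta 7].
  by rewrite !coef_poly /= /lamC; split; field.
have c0 (p r : {poly R}) : (p * r)`_0 = p`_0 * r`_0.
  by rewrite coefM big_ord_recl big_ord0 /= addr0.
have c1 (p r : {poly R}) : (p * r)`_1 = p`_0 * r`_1 + p`_1 * r`_0.
  by rewrite coefM !big_ord_recl big_ord0 /= addr0.
have c2 (p r : {poly R}) : (p * r)`_2 = p`_0 * r`_2 + p`_1 * r`_1 + p`_2 * r`_0.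
  by rewrite coefM !big_ord_recl big_ord0 /= addr0 addrA.
have c3 (p r : {poly R}) : (p * r)`_3 = p`_0 * r`_3 + p`_1 * r`_2 + p`_2 * r`_1 + p`_3 * r`_0.
  by rewrite coefM !big_ord_recl big_ord0 /= addr0 !addrA.
case: m m8 => [|[|[|[|[|[|[|[|//]]]]]]]] _; rewrite /cval /= ?(c0, c1, c2, c3)
  ?(q0, q1, q2, q3, q4, q5); by field.
Qed.

Lemma A_partial_acoef n N : A_partial 1 n N = n`!%:R * \sum_(k < N) acoef k.+1 n.
Proof.
rewrite /A_partial big_add1 /= big_mkord mulr_sumr; apply: eq_bigr => k _.
by rewrite /acoef mulrCA mulfV ?mulr1// pnatr_eq0 -lt0n fact_gt0.
Qed.

Lemma A_of_Jint n v :
  Jint (fun t => \sum_(i < n.+1) ccoef (n - i)%N * lnpow i t) v ->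
  A_exists R 1 n /\ A 1 n = n`!%:R * v / Num.sqrt 3.
Proof.
move=> J; have h := telescope_cvg acoef_rec J.
have h2 : A_partial 1 n N @[N --> \oo] --> n`!%:R * v / Num.sqrt 3.
  rewrite -mulrA (_ : A_partial 1 n = fun N => n`!%:R * \sum_(k < N) acoef k.+1 n).
    exact: cvg_mulc.
  by apply/funext => N; exact: A_partial_acoef.
split; last exact: (cvg_lim (@Rhausdorff R) h2).
split; last exact: (cvgP _ h2).
by move=> m x _ x0; exact: derivable_inv_binom.
Qed.

End InvBinomCoefficients.

(** * Complex functions of a real variable, treated by components *)

Section ComplexPaths.
Context {R : realType}.
Implicit Types (F G : R -> R[i]) (z w : R[i]) (t : R).
Local Notation Re := (@complex.Re R).
Local Notation Im := (@complex.Im R).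

Definition is_cderive t F z :=
  is_derive t 1 (fun u => Re (F u)) (Re z) /\ is_derive t 1 (fun u => Im (F u)) (Im z).

Definition ccvg {T : Type} (E : set_system T) (f : T -> R[i]) z :=
  (Re (f x) @[x --> E] --> Re z) /\ (Im (f x) @[x --> E] --> Im z).

Lemma ReD z w : Re (z + w) = Re z + Re w. Proof. by case: z w => [a b] [c d]. Qed.
Lemma ImD z w : Im (z + w) = Im z + Im w. Proof. by case: z w => [a b] [c d]. Qed.
Lemma ReN z : Re (- z) = - Re z. Proof. by case: z. Qed.
Lemma ImN z : Im (- z) = - Im z. Proof. by case: z. Qed.
Lemma ReM z w : Re (z * w) = Re z * Re w - Im z * Im w.
Proof. by case: z w => [a b] [c d]. Qed.
Lemma ImM z w : Im (z * w) = Re z * Im w + Im z * Re w.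
Proof. by case: z w => [a b] [c d]. Qed.

Lemma complex_eqP z w : Re z = Re w -> Im z = Im w -> z = w.
Proof. by case: z w => [a b] [c d] /= -> ->. Qed.

Lemma cderiv_eq t F z w : z = w -> is_cderive t F z -> is_cderive t F w.
Proof. by move=> ->. Qed.

Lemma cderiv_cst t w : is_cderive t (fun=> w) 0.
Proof. by split; exact: derivC. Qed.

Lemma cderivD t F G z w : is_cderive t F z -> is_cderive t G w ->
  is_cderive t (fun u => F u + G u) (z + w).
Proof.
move=> [F1 F2] [G1 G2]; split.
  by rewrite ReD; under eq_fun do rewrite ReD; exact: derivD.
by rewrite ImD; under eq_fun do rewrite ImD; exact: derivD.
Qed.

Lemma cderivN t F z : is_cderive t F z -> is_cderive t (fun u => - F u) (- z).
Proof.
move=> [F1 F2]; split.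
  by rewrite ReN; under eq_fun do rewrite ReN; exact: derivN.
by rewrite ImN; under eq_fun do rewrite ImN; exact: derivN.
Qed.

Lemma cderivB t F G z w : is_cderive t F z -> is_cderive t G w ->
  is_cderive t (fun u => F u - G u) (z - w).
Proof. by move=> hF hG; apply: cderivD => //; exact: cderivN. Qed.

Lemma cderivM t F G z w : is_cderive t F z -> is_cderive t G w ->
  is_cderive t (fun u => F u * G u) (z * G t + F t * w).
Proof.
move=> [F1 F2] [G1 G2]; split.
  under eq_fun do rewrite ReM.
  apply: (is_derive_eq (derivB (derivM F1 G1) (derivM F2 G2))).
  by rewrite ReD !ReM; ring.
under eq_fun do rewrite ImM.
apply: (is_derive_eq (derivD (derivM F1 G2) (derivM F2 G1))).
by rewrite ImD !ImM; ring.
Qed.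

Lemma cderivZ t c F z : is_cderive t F z -> is_cderive t (fun u => c * F u) (c * z).
Proof.
by move=> h; apply: (cderiv_eq _ (cderivM (cderiv_cst t c) h)); rewrite mul0r add0r.
Qed.

Lemma cderivX t F z n : is_cderive t F z ->
  is_cderive t (fun u => F u ^+ n) (n%:R * F t ^+ n.-1 * z).
Proof.
move=> h; elim: n => [|n ih].
  by under eq_fun do rewrite expr0; apply: (cderiv_eq _ (cderiv_cst t 1)); rewrite !mul0r.
under eq_fun do rewrite exprS.
apply: (cderiv_eq _ (cderivM h ih)).
rewrite /= -[in RHS]natr1; case: n {ih} => [|n] /=; first by rewrite expr0; ring.
by rewrite exprS; ring.
Qed.

Lemma cderiv_cvg t F z : is_cderive t F z -> ccvg (nbhs t) F (F t).
Proof. by move=> [F1 F2]; split; [exact: derivable_cvg F1|exact: derivable_cvg F2]. Qed.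

Lemma cderiv0_cst F a b : a <= b -> (forall t, a <= t <= b -> is_cderive t F 0) -> F a = F b.
Proof.
move=> ab h; apply: complex_eqP; apply/eqP; rewrite eq_sym -subr_eq0 -normr_le0 -(mul0r (b - a)).
  apply: (mvt_le (f := fun u => Re (F u)) (df := fun=> 0)) => //.
    by move=> x xab; have [] := h x xab.
  by move=> x _; rewrite normr0.
apply: (mvt_le (f := fun u => Im (F u)) (df := fun=> 0)) => //.
  by move=> x xab; have [] := h x xab.
by move=> x _; rewrite normr0.
Qed.

Lemma ccvg_eq {T : Type} (E : set_system T) (f : T -> R[i]) z w :
  z = w -> ccvg E f z -> ccvg E f w.
Proof. by move=> ->. Qed.

Lemma ccvg_cst {T : Type} (E : set_system T) {FE : Filter E} z : ccvg E (fun=> z) z.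
Proof. by split; exact: cvg_cst. Qed.

Lemma ccvgD {T : Type} (E : set_system T) {FE : Filter E} (f g : T -> R[i]) z w :
  ccvg E f z -> ccvg E g w -> ccvg E (fun x => f x + g x) (z + w).
Proof.
move=> [f1 f2] [g1 g2]; split.
  by rewrite ReD; under eq_fun do rewrite ReD; exact: cvgD.
by rewrite ImD; under eq_fun do rewrite ImD; exact: cvgD.
Qed.

Lemma ccvgN {T : Type} (E : set_system T) {FE : Filter E} (f : T -> R[i]) z :
  ccvg E f z -> ccvg E (fun x => - f x) (- z).
Proof.
move=> [f1 f2]; split.
  by rewrite ReN; under eq_fun do rewrite ReN; exact: cvgN.
by rewrite ImN; under eq_fun do rewrite ImN; exact: cvgN.
Qed.

Lemma ccvgB {T : Type} (E : set_system T) {FE : Filter E} (f g : T -> R[i]) z w :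
  ccvg E f z -> ccvg E g w -> ccvg E (fun x => f x - g x) (z - w).
Proof. by move=> hf hg; apply: ccvgD => //; exact: ccvgN. Qed.

Lemma ccvgM {T : Type} (E : set_system T) {FE : Filter E} (f g : T -> R[i]) z w :
  ccvg E f z -> ccvg E g w -> ccvg E (fun x => f x * g x) (z * w).
Proof.
move=> [f1 f2] [g1 g2]; split.
  by rewrite ReM; under eq_fun do rewrite ReM; apply: cvgB; apply: cvgM.
by rewrite ImM; under eq_fun do rewrite ImM; apply: cvgD; apply: cvgM.
Qed.

Lemma ccvgX {T : Type} (E : set_system T) {FE : Filter E} (f : T -> R[i]) z n :
  ccvg E f z -> ccvg E (fun x => f x ^+ n) (z ^+ n).
Proof.
move=> h; elim: n => [|n ih].
  by rewrite expr0; under eq_fun do rewrite expr0; exact: ccvg_cst.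
by rewrite exprS; under eq_fun do rewrite exprS; exact: ccvgM.
Qed.

Lemma ccvg_near_eq {T : Type} (E : set_system T) {FE : Filter E} (f g : T -> R[i]) z :
  (\forall x \near E, f x = g x) -> ccvg E f z -> ccvg E g z.
Proof.
move=> fg [f1 f2]; split.
  by apply: cvg_trans f1; apply: near_eq_cvg; near=> x; congr Re; near: x.
by apply: cvg_trans f2; apply: near_eq_cvg; near=> x; congr Im; near: x.
Unshelve. all: by end_near. Qed.

Lemma ccvg_uniq {T : Type} (E : set_system T) {FE : ProperFilter E} (f : T -> R[i]) z w :
  ccvg E f z -> ccvg E f w -> z = w.
Proof.
move=> [f1 f2] [g1 g2]; apply: complex_eqP.
  by rewrite -(cvg_lim (@Rhausdorff R) f1) -(cvg_lim (@Rhausdorff R) g1).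
by rewrite -(cvg_lim (@Rhausdorff R) f2) -(cvg_lim (@Rhausdorff R) g2).
Qed.

(** The form in which paths are deformed later: the ends may be singular points of F, and only
    one-sided limits are taken there. *)
Lemma cderiv0_limits F a b z w : a < b -> (forall t, a < t < b -> is_cderive t F 0) ->
  ccvg (a^'+) F z -> ccvg (b^'-) F w -> z = w.
Proof.
move=> ab h Fz Fw; have m01 : a < (a + b) / 2 < b by lra.
have cst t : a < t < b -> F t = F ((a + b) / 2).
  move=> /andP[ta tb]; have [le|le] := leP t ((a + b) / 2).
    apply: (cderiv0_cst le) => u /andP[u1 u2]; apply: h.
    by rewrite (lt_le_trans ta)//= (le_lt_trans u2)//; lra.
  apply/esym; apply: (cderiv0_cst (ltW le)) => u /andP[u1 u2]; apply: h.
  by rewrite (le_lt_trans u2)// andbT; lra.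
have e1 : z = F ((a + b) / 2).
  apply: (ccvg_uniq Fz); apply: ccvg_near_eq (@ccvg_cst _ _ _ _).
  near=> t; apply/esym/cst; apply/andP; split; first by near: t; exact: nbhs_right_gt.
  by near: t; exact: nbhs_right_lt.
rewrite e1; apply/esym; apply: (ccvg_uniq Fw); apply: ccvg_near_eq (@ccvg_cst _ _ _ _).
near=> t; apply/esym/cst; apply/andP; split; last by near: t; exact: nbhs_left_lt.
by near: t; exact: nbhs_left_gt.
Unshelve. all: by end_near. Qed.

Definition cabs z : R := Num.sqrt (Re z ^+ 2 + Im z ^+ 2).

Lemma cabsE z : cabs z = Normc.normc z. Proof. by case: z. Qed.

Lemma cabsM z w : cabs (z * w) = cabs z * cabs w.
Proof. by rewrite !cabsE Normc.normcM. Qed.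

Lemma cabsN z : cabs (- z) = cabs z.
Proof. by rewrite !cabsE; exact: normcN. Qed.

Lemma cabs_ge0 z : 0 <= cabs z. Proof. exact: sqrtr_ge0. Qed.

Lemma cabs0 : cabs 0 = 0. Proof. by rewrite cabsE Normc.normc0. Qed.

Lemma cabs1 : cabs 1 = 1. Proof. by rewrite cabsE Normc.normc1. Qed.

Lemma cabs_eq0 z : cabs z = 0 -> z = 0.
Proof. by rewrite cabsE; exact: Normc.eq0_normc. Qed.

Lemma cabsX z n : cabs (z ^+ n) = cabs z ^+ n.
Proof. by elim: n => [|n ih]; rewrite ?expr0 ?cabs1// !exprS cabsM ih. Qed.

Lemma cabs_real (x : R) : cabs x%:C%C = `|x|.
Proof. by rewrite /cabs /= expr0n addr0 sqrtr_sqr. Qed.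

Lemma Re_le_cabs z : `|Re z| <= cabs z.
Proof. by rewrite -sqrtr_sqr ler_wsqrtr// lerDl sqr_ge0. Qed.

Lemma Im_le_cabs z : `|Im z| <= cabs z.
Proof. by rewrite -sqrtr_sqr ler_wsqrtr// lerDr sqr_ge0. Qed.

Lemma cabs_le z : cabs z <= `|Re z| + `|Im z|.
Proof.
rewrite -(ler_pXn2r (n := 2))// ?nnegrE ?addr_ge0 ?cabs_ge0//.
rewrite sqr_sqrtr ?addr_ge0 ?sqr_ge0// sqrrD !real_normK ?num_real//.
by rewrite lerD2r lerDl mulrn_wge0// mulr_ge0.
Qed.

Lemma ccvg0_squeeze {T : Type} (E : set_system T) {FE : Filter E} (f : T -> R[i]) (g : T -> R) :
  (\forall x \near E, cabs (f x) <= g x) -> g x @[x --> E] --> (0 : R) -> ccvg E f 0.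
Proof.
move=> fg g0; split; apply: norm_cvg0; apply: (squeeze_cvgr _ (cvg_cst 0) g0).
  near=> x; rewrite normr_ge0/=; apply: (le_trans (Re_le_cabs _)); near: x; exact: fg.
near=> x; rewrite normr_ge0/=; apply: (le_trans (Im_le_cabs _)); near: x; exact: fg.
Unshelve. all: by end_near. Qed.

Lemma cabs_cvg {T : Type} (E : set_system T) {FE : Filter E} (f : T -> R[i]) z :
  ccvg E f z -> cabs (f x) @[x --> E] --> cabs z.
Proof.
move=> [f1 f2].
have h : Re (f x) ^+ 2 + Im (f x) ^+ 2 @[x --> E] --> Re z ^+ 2 + Im z ^+ 2.
  by apply: cvgD; rewrite !expr2; apply: cvgM.
exact: (cvg_comp _ _ h (@sqrt_continuous R _)).
Qed.

End ComplexPaths.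

(** * Dominated series of real functions *)

Section DominatedSeries.
Context {R : realType}.
Implicit Types (u v M : nat -> R) (l n N : nat).

Lemma dominated_cvg u M : (forall l, `|u l| <= M l) -> cvgn (series M) -> cvgn (series u).
Proof.
move=> uM cM; apply: normed_cvg; apply: (series_le_cvg _ _ uM cM) => l.
  exact: normr_ge0.
exact: le_trans (uM l).
Qed.

Lemma series_tail u M N : (forall l, `|u l| <= M l) -> cvgn (series M) ->
  `|limn (series u) - series u N| <= limn (series M) - series M N.
Proof.
move=> uM cM; have cu := dominated_cvg uM cM.
have h1 : `|series u n - series u N| @[n --> \oo] --> `|limn (series u) - series u N|.
  by apply: cvg_norm; apply: cvgB => //; exact: cvg_cst.
have h2 : series M n - series M N @[n --> \oo] --> limn (series M) - series M N.
  by apply: cvgB => //; exact: cvg_cst.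
rewrite -(cvg_lim (@Rhausdorff R) h1) -(cvg_lim (@Rhausdorff R) h2).
apply: ler_lim; [exact: cvgP h1|exact: cvgP h2|].
near=> n; have Nn : (N <= n)%N by near: n; exact: nbhs_infty_ge.
rewrite !sub_series_geq//; apply: (le_trans (ler_norm_sum _ _ _)).
by apply: ler_sum => i _.
Unshelve. all: by end_near. Qed.

(** Tannery's theorem: both tails are at most the tail of M, and the remaining partial sum is
    finite. *)
Lemma tannery {T : Type} (E : set_system T) {FE : ProperFilter E} (f : nat -> T -> R) (g M : nat -> R) :
  (forall l, f l x @[x --> E] --> g l) ->
  (\forall x \near E, forall l, `|f l x| <= M l) -> cvgn (series M) ->
  limn (series (f^~ x)) @[x --> E] --> limn (series g).
Proof.
move=> fg fM cM.
have gM l : `|g l| <= M l.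
  by apply: (cvg_to_le (fg l)); near=> x; move: l; near: x.
apply/cvgrPdist_lt => e e0.
have e3 : 0 < e / 3 by lra.
have /cvgrPdist_lt/(_ _ e3) : series M n @[n --> \oo] --> limn (series M) by [].
move=> [N _ /(_ N (leqnn N)) /= hN].
have fgN : series (f^~ x) N @[x --> E] --> series g N.
  rewrite /series /= big_mkord; under eq_fun do rewrite big_mkord.
  by apply: cvg_sum_ord => i _.
move/cvgrPdist_lt/(_ _ e3) : fgN => fgN.
near=> x.
have h1 := series_tail N gM cM.
have h2 : `|limn (series (f^~ x)) - series (f^~ x) N| <= limn (series M) - series M N.
  by apply: series_tail => //; near: x.
have h3 : `|series g N - series (f^~ x) N| < e / 3 by near: x.
have h4 := ler_norm (limn (series M) - series M N).
move: h1 h2 h3 h4 hN; move: (limn _) (limn _) (limn _) (series _ _) (series _ _) (series _ _).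
move=> p q r a b c h1 h2 h3 h4 hN.
have -> : r - p = (r - c) + (c - a) - (p - a) by ring.
apply: (le_lt_trans (ler_normB _ _)); apply: (le_lt_trans (lerD (ler_normD _ _) (lexx _))).
by lra.
Unshelve. all: by end_near. Qed.

(** The mean value inequality bounds the difference quotients by the same M l as the derivatives, so
    [tannery] applies to them. *)
Lemma deriv_series (f df : nat -> R -> R) M (t r : R) : 0 < r ->
  (forall l (x : R), `|x - t| < r -> is_derive x 1 (f l) (df l x)) ->
  (forall l (x : R), `|x - t| < r -> `|df l x| <= M l) ->
  (forall x : R, `|x - t| < r -> cvgn (series (f^~ x))) -> cvgn (series M) ->
  is_derive t 1 (fun x => limn (series (f^~ x))) (limn (series (df^~ t))).
Proof.
move=> r0 dfl dfM cf cM.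
have tt : `|t - t| < r by rewrite subrr normr0.
suff H : h^-1 *: (limn (series (f^~ (h *: 1 + t))) - limn (series (f^~ t))) @[h --> 0^'] -->
    limn (series (df^~ t)).
  split; first exact: (cvgP _ H).
  exact: (cvg_lim (@Rhausdorff R) H).
have T : limn (series (fun l => h^-1 *: (f l (h *: 1 + t) - f l t))) @[h --> 0^'] -->
    limn (series (df^~ t)).
  apply: (tannery (f := fun l h => h^-1 *: (f l (h *: 1 + t) - f l t))) cM => [l|].
    have [dv e] := dfl l t tt; rewrite -e; exact: dv.
  near=> h => l; have h0 : h != 0 by near: h; exact: nbhs_dnbhs_neq.
  have hr : `|h| < r.
    near: h; apply: nbhs_dnbhs; apply/nbhs_ballP; exists r => // y /=.
    by rewrite /ball /= sub0r normrN.
  rewrite /GRing.scale /= mulr1 normrM normfV mulrC ler_pdivrMr ?normr_gt0//.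
  have hb x : `|x - t| <= `|h| -> `|x - t| < r by move=> /le_lt_trans; exact.
  have [hp|hn] := leP 0 h.
    have -> : `|h| = h + t - t by rewrite addrK ger0_norm.
    apply: (mvt_le (df := df l)); first lra.
      move=> x /andP[x1 x2]; apply: dfl; apply: hb; rewrite ger0_norm ?ger0_norm//; lra.
    by move=> x /andP[x1 x2]; apply: dfM; apply: hb; rewrite ger0_norm ?ger0_norm//; lra.
  have -> : `|h| = t - (h + t) by rewrite ltr0_norm//; ring.
  rewrite distrC; apply: (mvt_le (df := df l)); first lra.
    by move=> x /andP[x1 x2]; apply: dfl; apply: hb; rewrite ler0_norm ?ltr0_norm//; lra.
  by move=> x /andP[x1 x2]; apply: dfM; apply: hb; rewrite ler0_norm ?ltr0_norm//; lra.
apply: cvg_trans T; apply: near_eq_cvg; near=> h.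
have hr : `|h *: 1 + t - t| < r.
  rewrite addrK /GRing.scale /= mulr1.
  near: h; apply: nbhs_dnbhs; apply/nbhs_ballP; exists r => // y /=.
  by rewrite /ball /= sub0r normrN.
have c1 := cf _ hr; have c2 := cf _ tt.
rewrite -lim_seriesB//.
by rewrite -lim_seriesZ//; exact: is_cvg_seriesB.
Unshelve. all: by end_near. Qed.

Lemma series_shift_cvg u : cvgn (series u) -> cvgn (series (fun l => u l.+1)).
Proof.
move=> cu; have e : series (fun l => u l.+1) = fun N => series u N.+1 - u 0%N.
  apply/funext => N; rewrite !seriesEnat /= (big_nat_recl _ _ u)//.
  by rewrite addrAC subrr add0r.
rewrite e; apply: is_cvgB; last exact: is_cvg_cst.
by apply/(cvgP (limn (series u))); rewrite (cvg_shiftS (series u)).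
Qed.

End DominatedSeries.

(** * Series of complex numbers and termwise differentiation along a path *)

Section ComplexSeries.
Context {R : realType}.
Implicit Types (u v : nat -> R[i]) (M : nat -> R) (z w : R[i]) (l n p N : nat).
Local Notation Re := (@complex.Re R).
Local Notation Im := (@complex.Im R).

Definition csum u : R[i] :=
  Complex (limn (series (fun l => Re (u l)))) (limn (series (fun l => Im (u l)))).

Definition csummable u := cvgn (series (fun l => Re (u l))) /\ cvgn (series (fun l => Im (u l))).

Lemma cdominated u M : (forall l, cabs (u l) <= M l) -> cvgn (series M) -> csummable u.
Proof.
move=> uM cM; split; apply: dominated_cvg cM => l.
  exact: le_trans (Re_le_cabs _) (uM l).
exact: le_trans (Im_le_cabs _) (uM l).
Qed.

Let Re_partial_csum u N : Re (\sum_(l < N) u l) = series (fun l => Re (u l)) N.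
Proof.
rewrite seriesEnat /= big_mkord; elim: N => [|N ih]; first by rewrite !big_ord0.
by rewrite !big_ord_recr /= ReD ih.
Qed.

Let Im_partial_csum u N : Im (\sum_(l < N) u l) = series (fun l => Im (u l)) N.
Proof.
rewrite seriesEnat /= big_mkord; elim: N => [|N ih]; first by rewrite !big_ord0.
by rewrite !big_ord_recr /= ImD ih.
Qed.

Lemma csumP u z : ccvg \oo (fun N => \sum_(l < N) u l) z -> csum u = z.
Proof.
move=> [h1 h2]; apply: complex_eqP => /=; apply: (cvg_lim (@Rhausdorff R)).
  rewrite (_ : series _ = fun N => Re (\sum_(l < N) u l))//.
  by apply/funext => N; rewrite Re_partial_csum.
rewrite (_ : series _ = fun N => Im (\sum_(l < N) u l))//.
by apply/funext => N; rewrite Im_partial_csum.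
Qed.

Lemma csum_cvg u : csummable u -> ccvg \oo (fun N => \sum_(l < N) u l) (csum u).
Proof.
move=> [h1 h2]; split => /=.
  rewrite (_ : (fun N => _) = series (fun l => Re (u l)))//.
  by apply/funext => N; exact: Re_partial_csum.
rewrite (_ : (fun N => _) = series (fun l => Im (u l)))//.
by apply/funext => N; exact: Im_partial_csum.
Qed.

Lemma csumZ z u : csummable u -> csum (fun l => z * u l) = z * csum u.
Proof.
move=> /csum_cvg h; apply: csumP; under eq_fun do rewrite -mulr_sumr.
by apply: ccvgM => //; exact: ccvg_cst.
Qed.

Lemma csumB u v : csummable u -> csummable v ->
  csum (fun l => u l - v l) = csum u - csum v.
Proof.
move=> /csum_cvg h /csum_cvg h'; apply: csumP; under eq_fun do rewrite sumrB.
exact: ccvgB.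
Qed.

Lemma csum_shift u : csummable u -> csum u = u 0 + csum (fun l => u l.+1).
Proof.
move=> /csum_cvg [h1 h2]; suff -> : csum (fun l => u l.+1) = csum u - u 0 by ring.
apply: csumP.
have e N : \sum_(l < N) u l.+1 = \sum_(l < N.+1) u l - u 0.
  by rewrite big_ord_recl /= addrAC subrr add0r.
under eq_fun do rewrite e.
apply: ccvgB; last exact: ccvg_cst.
by split; [rewrite (cvg_shiftS (fun N => Re (\sum_(l < N) u l)))|
  rewrite (cvg_shiftS (fun N => Im (\sum_(l < N) u l)))].
Qed.

Lemma cabs_csum u M : (forall l, cabs (u l) <= M l) -> cvgn (series M) ->
  cabs (csum u) <= 2 * limn (series M).
Proof.
move=> uM cM; apply: (le_trans (cabs_le _)).
have s0 (f : nat -> R) : series f 0%N = 0 by rewrite seriesEnat /= big_geq.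
have h1 : `|Re (csum u)| <= limn (series M).
  have := @series_tail _ (fun l => Re (u l)) M 0 _ cM.
  rewrite !s0 !subr0; apply => l.
  exact: le_trans (Re_le_cabs _) (uM l).
have h2 : `|Im (csum u)| <= limn (series M).
  have := @series_tail _ (fun l => Im (u l)) M 0 _ cM.
  rewrite !s0 !subr0; apply => l.
  exact: le_trans (Im_le_cabs _) (uM l).
by move: h1 h2; lra.
Qed.

Lemma csum_tannery {T : Type} (E : set_system T) {FE : ProperFilter E}
  (f : nat -> T -> R[i]) u M :
  (forall l, ccvg E (f l) (u l)) ->
  (\forall x \near E, forall l, cabs (f l x) <= M l) -> cvgn (series M) ->
  ccvg E (fun x => csum (f^~ x)) (csum u).
Proof.
move=> fu fM cM; split.
  apply: (tannery (f := fun l x => Re (f l x))) cM; first by move=> l; have [] := fu l.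
  by near=> x => l; apply: (le_trans (Re_le_cabs _)); move: l; near: x.
apply: (tannery (f := fun l x => Im (f l x))) cM; first by move=> l; have [] := fu l.
by near=> x => l; apply: (le_trans (Im_le_cabs _)); move: l; near: x.
Unshelve. all: by end_near. Qed.

Lemma cderiv_csum (f df : nat -> R -> R[i]) (M L : nat -> R) (t r : R) : 0 < r ->
  (forall l (x : R), `|x - t| < r -> is_cderive x (f l) (df l x)) ->
  (forall l (x : R), `|x - t| < r -> cabs (df l x) <= M l) ->
  (forall l (x : R), `|x - t| < r -> cabs (f l x) <= L l) ->
  cvgn (series M) -> cvgn (series L) ->
  is_cderive t (fun x => csum (f^~ x)) (csum (df^~ t)).
Proof.
move=> r0 dfl dfM fL cM cL.
have cf x : `|x - t| < r -> csummable (f^~ x).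
  by move=> xt; apply: cdominated cL => l; exact: fL.
split.
  apply: (deriv_series (f := fun l x => Re (f l x)) (df := fun l x => Re (df l x))) r0 _ _ _ cM.
  - by move=> l x h; have [] := dfl l x h.
  - by move=> l x xt; apply: (le_trans (Re_le_cabs _)); exact: dfM.
  - by move=> x h; have [] := cf x h.
apply: (deriv_series (f := fun l x => Im (f l x)) (df := fun l x => Im (df l x))) r0 _ _ _ cM.
- by move=> l x h; have [] := dfl l x h.
- by move=> l x xt; apply: (le_trans (Im_le_cabs _)); exact: dfM.
- by move=> x h; have [] := cf x h.
Qed.

Lemma geometric_dominator (K rho : R) : 0 <= K -> 0 <= rho < 1 ->
  cvgn (series (fun l => K * (l%:R * rho ^+ l.-1))).
Proof.
move=> K0 /andP[r0 r1]; rewrite (_ : (fun l => _) = K *: (fun l => l%:R * rho ^+ l.-1)); last by [].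
apply: is_cvg_seriesZ; apply: nondecreasing_is_cvgn.
  by apply: nondecreasing_series => n _ _; rewrite mulr_ge0 ?exprn_ge0.
exists (1 / (1 - rho) ^+ 2) => _ [N _ <-]; rewrite ler_pdivlMr ?exprn_gt0 ?subr_gt0//.
have {}r0 : 0 <= rho by [].
(* Closed form of the sum of l rho^(l-1) over l <= N; its right side is at most 1. *)
suff H : series (fun l => l%:R * rho ^+ l.-1) N.+1 * (1 - rho) ^+ 2 =
    1 - N.+1%:R * rho ^+ N + N%:R * rho ^+ N.+1.
  have h : series (fun l => l%:R * rho ^+ l.-1) N <= series (fun l => l%:R * rho ^+ l.-1) N.+1.
    by rewrite /series /= big_nat_recr//= lerDl mulr_ge0 ?exprn_ge0.
  apply: (le_trans (ler_wpM2r _ h)); first by rewrite exprn_ge0// subr_ge0 ltW.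
  rewrite H -natr1 exprS.
  have := exprn_ge0 N r0; have := ler0n R N; move: (N%:R) (rho ^+ N) => n q n0 q0.
  have : 0 <= n * q * (1 - rho) by rewrite !mulr_ge0// subr_ge0 ltW.
  by move=> h'; rewrite -subr_ge0 (_ : 1 - _ = n * q * (1 - rho) + q) ?addr_ge0//; ring.
elim: N => [|N ih]; first by rewrite /series /= big_nat1 /=; ring.
rewrite /series /= big_nat_recr//= mulrDl; move: ih; rewrite /series /= => ->.
rewrite -!natr1 !exprS; ring.
Qed.

End ComplexSeries.

(** * Nielsen polylogarithms as power series on the closed unit disc *)

Section NielsenPolylogarithms.
Context {R : realType}.
Implicit Types (z w : R[i]) (l n p N : nat).
Local Notation Re := (@complex.Re R).
Local Notation Im := (@complex.Im R).

Definition esum p l : R := nested_sum (nseq p 1%N) l.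

Definition ncoef n p l : R := esum p l / l%:R ^+ n.+1.

(* Nielsen's S_{n,p+1}; the term [l = 0] vanishes because its coefficient is a
   quotient by [0]. *)
Definition nielsen n p w : R[i] := csum (fun l => (ncoef n p l)%:C%C * w ^+ l).

Lemma esumS p l : (0 < l)%N -> esum p.+1 l.+1 = esum p.+1 l + esum p l / l%:R.
Proof.
by move=> l0; rewrite /esum /= big_nat_recr//= expr1 mul1r mulrC.
Qed.

Lemma esum1 p : esum p 1 = (p == 0)%:R.
Proof. by case: p => [|p] //; rewrite /esum /= big_geq. Qed.

Lemma esum_ge0 p l : 0 <= esum p l.
Proof.
elim: p l => [|p ih] l; first exact: ler01.
by apply: sumr_ge0 => j _; rewrite mulr_ge0 ?divr_ge0 ?exprn_ge0//; exact: ih.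
Qed.

(** The true growth is a power of ln l; a square root dominates it and survives summation, because 1
    / sqrt (l + 1) <= 2 (sqrt (l + 1) - sqrt l), an instance of (r - s)^2 >= 0. *)
Lemma esum_le p l : esum p l.+1 <= 2 ^+ p * Num.sqrt l.+1%:R.
Proof.
elim: p l => [|p ih] l.
  by rewrite expr0 mul1r /esum /= -[leLHS]sqrtr1 ler_wsqrtr// ler1n.
suff H : esum p.+1 l.+1 <= 2 ^+ p.+1 * Num.sqrt l%:R.
  by apply: (le_trans H); rewrite ler_wpM2l ?exprn_ge0// ler_wsqrtr// ler_nat.
elim: l => [|l ihl].
  by rewrite esum1 mulr_ge0 ?exprn_ge0.
rewrite esumS//; have h := ih l.
have s0 : 0 <= Num.sqrt l%:R :> R by rewrite sqrtr_ge0.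
have s2 : Num.sqrt l%:R ^+ 2 = l%:R :> R by rewrite sqr_sqrtr.
have r2 : Num.sqrt l.+1%:R ^+ 2 = l.+1%:R :> R by rewrite sqr_sqrtr.
have r0 : 0 < Num.sqrt l.+1%:R :> R by rewrite sqrtr_gt0 ltr0n.
have sr : Num.sqrt l%:R <= Num.sqrt l.+1%:R :> R by rewrite ler_wsqrtr// ler_nat.
have q0 : 0 < 2 ^+ p :> R by exact: exprn_gt0.
have e : Num.sqrt l.+1%:R ^+ 2 = Num.sqrt l%:R ^+ 2 + 1 :> R by rewrite r2 s2 natr1.
rewrite -[X in _ / X]r2; move: ihl h s0 r0 sr e; rewrite exprS.
move: (esum p.+1 _) (esum p _) (2 ^+ p) q0.
move=> a b q q0; move: (Num.sqrt l%:R) (Num.sqrt l.+1%:R) => s r ha hb s0 r0 sr e.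
have hb' : b / r ^+ 2 <= q / r.
  by rewrite ler_pdivrMr ?exprn_gt0// (_ : q / r * r ^+ 2 = q * r)//; field; rewrite gt_eqF.
apply: (le_trans (lerD ha hb')).
have -> : 2 * q * s + q / r = q * (2 * s * r + 1) / r by field; rewrite gt_eqF.
rewrite ler_pdivrMr// -subr_ge0.
have -> : 2 * q * r * r - q * (2 * s * r + 1) = q * ((r - s) ^+ 2 + (r ^+ 2 - s ^+ 2 - 1)) by ring.
rewrite (_ : r ^+ 2 - s ^+ 2 - 1 = 0); last by rewrite e; ring.
by rewrite addr0 mulr_ge0 ?sqr_ge0 ?ltW.
Qed.

Lemma ncoef_ge0 n p l : 0 <= ncoef n p l.
Proof. by rewrite divr_ge0 ?esum_ge0 ?exprn_ge0. Qed.

Lemma lncoef_ge0 n p l : 0 <= l%:R * ncoef n p l.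
Proof. exact: mulr_ge0 (ler0n _ _) (ncoef_ge0 n p l). Qed.

Lemma ncoef0 n p : ncoef n p 0 = 0.
Proof. by rewrite /ncoef expr0n invr0 mulr0. Qed.

Lemma ncoef_le n p l : ncoef n p l <= 2 ^+ p * (Num.sqrt l%:R / l%:R ^+ n.+1).
Proof.
case: l => [|l]; first by rewrite ncoef0 expr0n invr0 !mulr0.
by rewrite mulrA ler_wpM2r ?invr_ge0 ?exprn_ge0//; exact: esum_le.
Qed.

Lemma sqrt_le_nat l : Num.sqrt l%:R <= l%:R :> R.
Proof.
rewrite -(ler_pXn2r (n := 2))// ?nnegrE ?sqrtr_ge0// sqr_sqrtr// -natrX ler_nat.
by case: l => // l; rewrite expnS leq_pmulr.
Qed.

Lemma ncoef_le2 n p l : ncoef n p l <= 2 ^+ p.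
Proof.
apply: (le_trans (ncoef_le n p l)); rewrite ler_piMr ?exprn_ge0//.
case: l => [|l]; first by rewrite expr0n invr0 mulr0.
rewrite ler_pdivrMr ?exprn_gt0// mul1r (le_trans (sqrt_le_nat _))//.
by rewrite exprS ler_peMr// exprn_ege1// ler1n.
Qed.

(** The terms are l^(-3/2), and the partial sums are compared with the telescoping bound 3 - 2 /
    sqrt N. *)
Lemma sqrt_sq_dominator : cvgn (series (fun l => Num.sqrt l%:R / l%:R ^+ 2 : R)).
Proof.
apply: nondecreasing_is_cvgn.
  by apply: nondecreasing_series => n _ _; rewrite divr_ge0 ?exprn_ge0 ?sqrtr_ge0.
exists 3 => _ [N _ <-].
have t0 l : 0 <= Num.sqrt l%:R / l%:R ^+ 2 :> R by rewrite divr_ge0 ?exprn_ge0 ?sqrtr_ge0.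
suff H : series (fun l => Num.sqrt l%:R / l%:R ^+ 2) N.+2 <= 3 - 2 / Num.sqrt N.+1%:R :> R.
  apply: (@le_trans _ _ (series (fun l => Num.sqrt l%:R / l%:R ^+ 2) N.+2)).
    rewrite !seriesEnat /= big_nat_recr//= big_nat_recr//= -addrA lerDl addr_ge0//; exact: t0.
  by apply: (le_trans H); rewrite gerBl divr_ge0 ?sqrtr_ge0.
elim: N => [|N ih].
  rewrite seriesEnat /= big_nat_recr//= big_nat1 !expr0n /= invr0 mulr0 add0r sqrtr1 expr1n; lra.
rewrite seriesEnat /= big_nat_recr//=; move: ih; rewrite seriesEnat /= => ih.
apply: (le_trans (lerD ih (lexx _))).
have s0 : 0 < Num.sqrt N.+1%:R :> R by rewrite sqrtr_gt0 ltr0n.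
have s2 : Num.sqrt N.+1%:R ^+ 2 = N.+1%:R :> R by rewrite sqr_sqrtr.
have r2 : Num.sqrt N.+2%:R ^+ 2 = N.+2%:R :> R by rewrite sqr_sqrtr.
have sr : Num.sqrt N.+1%:R <= Num.sqrt N.+2%:R :> R by rewrite ler_wsqrtr// ler_nat.
have e : Num.sqrt N.+2%:R ^+ 2 = Num.sqrt N.+1%:R ^+ 2 + 1 :> R by rewrite r2 s2 natr1.
rewrite -r2; move: s0 sr e; rewrite sqrtr_sqr (ger0_norm (sqrtr_ge0 _)).
move: (Num.sqrt N.+2%:R) (Num.sqrt N.+1%:R) => r s s0 sr e {ih t0 s2 r2}.
have r0 : 0 < r by apply: lt_le_trans sr.
have -> : r / (r ^+ 2) ^+ 2 = 1 / r ^+ 3 by field; rewrite gt_eqF.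
rewrite -subr_ge0.
have -> : 3 - 2 / r - (3 - 2 / s + 1 / r ^+ 3) =
    (r * ((r - s) ^+ 2 + (r ^+ 2 - s ^+ 2 - 1)) + (r - s)) / (s * r ^+ 3).
  field; rewrite !gt_eqF//.
apply: divr_ge0; last by rewrite mulr_ge0 ?exprn_ge0 ?ltW.
apply: addr_ge0; last first.
  by rewrite subr_ge0.
rewrite (_ : r ^+ 2 - s ^+ 2 - 1 = 0); last by rewrite e; ring.
by rewrite addr0 mulr_ge0 ?sqr_ge0 ?ltW.
Qed.

Lemma ncoefS n p l : l%:R * ncoef n.+1 p l = ncoef n p l.
Proof.
case: l => [|l]; first by rewrite !ncoef0 mulr0.
have l0 : l.+1%:R != 0 :> R by rewrite pnatr_eq0.
by rewrite /ncoef (exprS _ n.+1) invfM [esum _ _ * _]mulrCA mulVKf.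
Qed.

Lemma cabs_nterm n p w l : cabs ((ncoef n p l)%:C%C * w ^+ l) = ncoef n p l * cabs w ^+ l.
Proof. by rewrite cabsM cabs_real cabsX ger0_norm// ncoef_ge0. Qed.

Definition ndom p l : R := 2 ^+ p * (Num.sqrt l%:R / l%:R ^+ 2).

Lemma ndom_cvg p : cvgn (series (ndom p)).
Proof.
rewrite (_ : ndom p = (2 ^+ p : R) *: (fun l => Num.sqrt l%:R / l%:R ^+ 2 : R))//.
by apply: is_cvg_seriesZ; exact: sqrt_sq_dominator.
Qed.

Lemma ncoefS_le n p l : ncoef n.+1 p l <= ndom p l.
Proof.
apply: (le_trans (ncoef_le _ _ _)); rewrite ler_wpM2l ?exprn_ge0//.
case: l => [|l]; first by rewrite !expr0n invr0.
rewrite ler_wpM2l ?sqrtr_ge0// lef_pV2 ?posrE ?exprn_gt0//.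
by apply: ler_weXn2l; rewrite ?ler1n.
Qed.

Lemma nielsen_summable n p w : cabs w <= 1 ->
  csummable (fun l => (ncoef n.+1 p l)%:C%C * w ^+ l).
Proof.
move=> w1; apply: (@cdominated _ _ (ndom p)); last exact: ndom_cvg.
move=> l.
rewrite cabs_nterm; apply: le_trans (ncoefS_le n p l).
by rewrite ler_piMr ?ncoef_ge0// exprn_ile1// cabs_ge0.
Qed.

(** A first index of at least 1 makes the series converge uniformly on the closed disc, so that
    limits up to the unit circle pass inside the sum. *)
Lemma nielsen_cvg {T : Type} (E : set_system T) {FE : ProperFilter E} (f : T -> R[i]) z n p :
  (\forall x \near E, cabs (f x) <= 1) -> ccvg E f z ->
  ccvg E (fun x => nielsen n.+1 p (f x)) (nielsen n.+1 p z).
Proof.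
move=> f1 fz.
apply: (csum_tannery (f := fun l x => (ncoef n.+1 p l)%:C%C * f x ^+ l) (M := ndom p)) => //; last exact: ndom_cvg.
  by move=> l; apply: ccvgM; [exact: ccvg_cst|exact: ccvgX].
near=> x => l; rewrite cabs_nterm; apply: le_trans (ncoefS_le n p l).
rewrite ler_piMr ?ncoef_ge0// exprn_ile1 ?cabs_ge0//; near: x; exact: f1.
Unshelve. all: by end_near. Qed.

(** The global bound on dw supplies the dominating series when a power series in w is differentiated
    term by term. *)
Definition tame_path (w dw : R -> R[i]) :=
  (forall x, is_cderive x w (dw x)) /\ exists K, forall x, cabs (dw x) <= K.

Lemma deriv_coef_summable n p w : cabs w < 1 ->
  csummable (fun l => (l%:R * ncoef n p l)%:C%C * w ^+ l.-1).
Proof.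
move=> w1; apply: (@cdominated _ _ (fun l => 2 ^+ p * (l%:R * cabs w ^+ l.-1))).
  move=> l; rewrite cabsM cabs_real cabsX (ger0_norm (lncoef_ge0 _ _ _)).
  rewrite mulrA (mulrC (2 ^+ p)) ler_wpM2r ?exprn_ge0 ?cabs_ge0//.
  by rewrite ler_wpM2l// ncoef_le2.
by apply: geometric_dominator; rewrite ?exprn_ge0// cabs_ge0.
Qed.

Lemma cderiv_nielsen_series n p (w dw : R -> R[i]) t : tame_path w dw -> cabs (w t) < 1 ->
  is_cderive t (fun x => nielsen n p (w x))
    (dw t * csum (fun l => (l%:R * ncoef n p l)%:C%C * w t ^+ l.-1)).
Proof.
move=> [dwP [K dwK]] w1; set rho : R := (1 + cabs (w t)) / 2.
have rho1 : rho < 1 by rewrite /rho; lra.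
have rho0 : 0 <= rho by rewrite /rho; have := cabs_ge0 (w t); lra.
have wrho : cabs (w t) < rho by rewrite /rho; lra.
have K0 : 0 <= K := le_trans (cabs_ge0 _) (dwK 0).
have : \forall x \near t, cabs (w x) < rho.
  apply: (@cvgr_lt _ _ (nbhs t) _ (fun x => cabs (w x)) (cabs (w t))) => //.
  exact: cabs_cvg (cderiv_cvg (dwP t)).
move=> /nbhs_ballP[r /= r0 hr].
have wr x : `|x - t| < r -> cabs (w x) <= rho.
  by rewrite distrC => xt; apply: ltW; apply: hr.
have dfP l x : is_cderive x (fun x => (ncoef n p l)%:C%C * w x ^+ l)
    (dw x * ((l%:R * ncoef n p l)%:C%C * w x ^+ l.-1)).
  apply: (cderiv_eq _ (cderivZ _ (cderivX l (dwP x)))).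
  rewrite (rmorphM (real_complex R) l%:R) rmorph_nat; ring.
apply: (cderiv_eq _ (@cderiv_csum _ (fun l x => (ncoef n p l)%:C%C * w x ^+ l)
  (fun l x => dw x * ((l%:R * ncoef n p l)%:C%C * w x ^+ l.-1))
  (fun l => (K * 2 ^+ p) * (l%:R * rho ^+ l.-1)) (fun l => 2 ^+ p * rho ^+ l) t r r0 _ _ _ _ _)).
- by apply: csumZ; exact: deriv_coef_summable.
- by move=> l x _; exact: dfP.
- move=> l x xt; rewrite cabsM cabsM cabs_real cabsX (ger0_norm (lncoef_ge0 _ _ _)).
  rewrite -[leRHS]mulrA; apply: ler_pM => //; rewrite ?cabs_ge0//.
    exact: mulr_ge0 (lncoef_ge0 _ _ _) (exprn_ge0 _ (cabs_ge0 _)).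
  rewrite [leRHS]mulrA (mulrC (2 ^+ p)); apply: ler_pM.
  - exact: lncoef_ge0.
  - by rewrite exprn_ge0 ?cabs_ge0.
  - by rewrite ler_wpM2l// ncoef_le2.
  - by apply: lerXn2r; rewrite ?nnegrE ?cabs_ge0//; exact: wr.
- move=> l x xt; rewrite cabs_nterm ler_pM ?ncoef_ge0 ?exprn_ge0 ?cabs_ge0 ?ncoef_le2//.
  by apply: lerXn2r; rewrite ?nnegrE ?cabs_ge0//; exact: wr.
- by apply: geometric_dominator; [rewrite mulr_ge0 ?exprn_ge0|rewrite rho0].
- by apply: (@is_cvg_geometric_series _ (2 ^+ p) rho); rewrite ger0_norm.
Qed.

Lemma nielsen_derivS n p (w dw : R -> R[i]) t : tame_path w dw -> w t != 0 -> cabs (w t) < 1 ->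
  is_cderive t (fun x => nielsen n.+1 p (w x)) (dw t / w t * nielsen n p (w t)).
Proof.
move=> wP w0 w1; apply: (cderiv_eq _ (cderiv_nielsen_series n.+1 p wP w1)).
rewrite -mulrA; congr (_ * _); apply: (mulfI w0); rewrite mulrA mulfV// mul1r.
rewrite -csumZ; last exact: deriv_coef_summable.
congr csum; apply/funext => l; rewrite ncoefS mulrCA -exprS.
by case: l => [|l]; rewrite ?ncoef0 ?mul0r.
Qed.

(** Multiplying the differentiated series by 1 - w turns its coefficients [esum p l.+1] into the
    differences [esum p l.+1 - esum p l], which by [esumS] are the coefficients of the series with p
    lowered by one. *)
Lemma nielsen_deriv0 p (w dw : R -> R[i]) t : tame_path w dw -> cabs (w t) < 1 ->
  is_cderive t (fun x => nielsen 0 p (w x))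
    (dw t / (1 - w t) * (if p is p'.+1 then nielsen 0 p' (w t) else 1)).
Proof.
move=> wP w1; apply: (cderiv_eq _ (cderiv_nielsen_series 0 p wP w1)).
have w0 : 1 - w t != 0.
  by apply: contraTneq w1 => /eqP; rewrite subr_eq0 => /eqP <-; rewrite cabs1 ltxx.
rewrite -mulrA; congr (_ * _); apply: (mulfI w0); rewrite mulrA mulfV// mul1r.
move: (w t) w1 {w0} => z z1; rewrite mulrBl mul1r -csumZ; last exact: deriv_coef_summable.
have s1 := deriv_coef_summable 0 p z1.
rewrite (csum_shift s1) mul0r mul0r add0r.
have e l : (l.+1%:R * ncoef 0 p l.+1) = esum p l.+1.
  by rewrite /ncoef expr1 mulrCA mulfV ?mulr1// pnatr_eq0.
have e' l : z * ((l%:R * ncoef 0 p l)%:C%C * z ^+ l.-1) = (if l is 0 then 0 else esum p l)%:C%C * z ^+ l.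
  by case: l => [|l]; rewrite ?mul0r ?mulr0// e mulrCA -exprS.
have -> : (fun l => (l.+1%:R * ncoef 0 p l.+1)%:C%C * z ^+ l.+1.-1) =
    (fun l => (esum p l.+1)%:C%C * z ^+ l) by apply/funext => l; rewrite e.
rewrite (_ : (fun l => z * _) = (fun l => (if l is 0 then 0 else esum p l)%:C%C * z ^+ l)); last first.
  by apply/funext => l; rewrite e'.
have dom (c : nat -> R) : (forall l, 0 <= c l <= 2 ^+ p * l.+1%:R) ->
    csummable (fun l => (c l)%:C%C * z ^+ l).
  move=> cP; apply: (@cdominated _ _ (fun l => 2 ^+ p * (l.+1%:R * cabs z ^+ l))).
    move=> l; have /andP[c0 c1] := cP l.
    by rewrite cabsM cabs_real cabsX ger0_norm// mulrA ler_wpM2r ?exprn_ge0 ?cabs_ge0.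
  by apply: (series_shift_cvg (u := fun l => 2 ^+ p * (l%:R * cabs z ^+ l.-1)));
     apply: geometric_dominator; rewrite ?exprn_ge0// cabs_ge0.
have el l : esum p l.+1 <= 2 ^+ p * l.+1%:R.
  by apply: (le_trans (esum_le p l)); rewrite ler_wpM2l ?exprn_ge0// sqrt_le_nat.
rewrite -csumB; last 2 first.
- by apply: dom => l; rewrite esum_ge0 el.
- apply: dom => -[|l]; first by rewrite lexx mulr_ge0 ?exprn_ge0.
  by rewrite esum_ge0 (le_trans (el l))// ler_wpM2l ?exprn_ge0// ler_nat.
case: p {s1 e e' dom el} => [|p].
  apply: csumP; apply: ccvg_near_eq (@ccvg_cst _ _ _ _ 1); near=> N.
  have : (0 < N)%N by near: N; exact: nbhs_infty_gt.
  move: (N) => [//|k _]; rewrite big_ord_recl /= mul0r subr0 big1 ?addr0 ?mulr1//.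
  by move=> i _ /=; rewrite subrr.
congr csum; apply/funext => -[|l]; first by rewrite mul0r subr0 esum1 ncoef0.
by rewrite -mulrBl -rmorphB/= esumS// addrAC subrr add0r /ncoef expr1.
Unshelve. all: by end_near. Qed.
End NielsenPolylogarithms.

(** * Behaviour at 0, conjugation, and the case of pure logarithms *)

Section NielsenElementary.
Context {R : realType}.
Implicit Types (z w v : R[i]) (l n p N : nat) (s : R).
Local Notation Re := (@complex.Re R).
Local Notation Im := (@complex.Im R).

(** The series has no constant term. This linear bound is what beats the powers of the logarithm
    where a path starts at 0. *)
Lemma nielsen_small n p : exists2 C : R, 0 <= C & forall w, cabs w <= 1 / 2 ->
  cabs (nielsen n p w) <= C * cabs w.
Proof.
have h0 : 0 <= (1 / 2 : R) < 1 by lra.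
have c0 := geometric_dominator (exprn_ge0 p (ler0n R 2)) h0.
set M := (fun l => 2 ^+ p * (l%:R * (1 / 2) ^+ l.-1) : R).
have M0 : 0 <= limn (series M).
  apply: limr_ge => //; apply: nearW => N; rewrite seriesEnat /=.
  by apply: sumr_ge0 => l _; rewrite !mulr_ge0 ?exprn_ge0// divr_ge0.
exists (2 * limn (series M)); first exact: mulr_ge0.
move=> w w2; have -> : 2 * limn (series M) * cabs w = 2 * limn (series (cabs w *: M)).
  have -> : limn (series (cabs w *: M)) = cabs w * limn (series M) by exact: lim_seriesZ.
  by rewrite mulrAC mulrA.
apply: cabs_csum; last exact: is_cvg_seriesZ.
move=> l; rewrite cabs_nterm -[leRHS]/(cabs w * M l) /M; case: l => [|l].
  by rewrite ncoef0 !(mul0r, mulr0).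
rewrite exprS mulrCA ler_wpM2l ?cabs_ge0//.
apply: ler_pM; rewrite ?ncoef_ge0 ?exprn_ge0 ?cabs_ge0 ?ncoef_le2//.
rewrite -[leLHS]mul1r; apply: ler_pM; rewrite ?exprn_ge0 ?cabs_ge0 ?ler1n//.
by apply: lerXn2r; rewrite ?nnegrE ?cabs_ge0//; lra.
Qed.

Lemma nielsen0 n p : nielsen n p 0 = 0 :> R[i].
Proof.
have [C _ h] := nielsen_small n p; apply: cabs_eq0; apply/eqP; rewrite eq_le cabs_ge0 andbT.
by have := h 0; rewrite cabs0 mulr0; apply; lra.
Qed.

Lemma nielsen_conj n p w : cabs w <= 1 ->
  nielsen n.+1 p w^*%C = (nielsen n.+1 p w)^*%C.
Proof.
move=> w1; have [h1 h2] := nielsen_summable n p w1.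
have e l : (ncoef n.+1 p l)%:C%C * w^*%C ^+ l = ((ncoef n.+1 p l)%:C%C * w ^+ l)^*%C.
  by rewrite (rmorphM (@conjc R)) (rmorphXn (@conjc R)) /= oppr0.
apply: complex_eqP.
  by congr (limn (series _)); apply/funext => l; rewrite e; case: (_ * _).
rewrite [RHS](_ : _ = - Im (nielsen n.+1 p w)); last by case: (nielsen _ _ _).
rewrite /= -lim_seriesN//; congr (limn (series _)); apply/funext => l.
by rewrite e -[RHS]/(- Im ((ncoef n.+1 p l)%:C%C * w ^+ l)); case: (_ * _).
Qed.

Definition ray v s : R[i] := s%:C%C * v.

Lemma ray_tame v : tame_path (ray v) (fun=> v).
Proof.
split; last by exists (cabs v).
move=> x; rewrite /ray; apply: (cderiv_eq (z := 1 * v + x%:C%C * 0)).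
  by rewrite mul1r mulr0 addr0.
apply: cderivM; last exact: cderiv_cst.
by split => /=; [exact: deriv_id|exact: derivC].
Qed.

Lemma cabs_ray v s : 0 <= s -> cabs (ray v s) = s * cabs v.
Proof. by move=> s0; rewrite /ray cabsM cabs_real ger0_norm. Qed.

Lemma ray_lt1 v s : cabs v < 1 -> 0 <= s <= 1 -> cabs (ray v s) < 1.
Proof.
move=> v1 /andP[s0 s1]; rewrite cabs_ray//; apply: le_lt_trans v1.
by rewrite ler_piMl ?cabs_ge0.
Qed.

Lemma sub1_neq0 w : cabs w < 1 -> 1 - w != 0.
Proof.
by move=> w1; apply: contraTneq w1 => /eqP; rewrite subr_eq0 => /eqP <-; rewrite cabs1 ltxx.
Qed.

(* Minus the principal logarithm of [1 - s v]. *)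
Definition raylog v s : R[i] :=
  Complex (- (1 / 2) * ln ((1 - s * Re v) ^+ 2 + (s * Im v) ^+ 2)) (atan (s * Im v / (1 - s * Re v))).

Lemma cderiv_raylog v s : 0 < 1 - s * Re v -> is_cderive s (raylog v) (v / (1 - ray v s)).
Proof.
set a := Re v; set b := Im v => sa.
set D := (1 - s * a) ^+ 2 + (s * b) ^+ 2.
have D0 : 0 < D by rewrite ltr_wpDr ?sqr_ge0// exprn_gt0.
have dsa : is_derive s 1 (fun s => 1 - s * a) (- a).
  by apply: (is_derive_eq (derivB (derivC 1 s) (derivM (deriv_id s) (derivC a s)))); ring.
have dsb : is_derive s 1 (fun s => s * b) b.
  by apply: (is_derive_eq (derivM (deriv_id s) (derivC b s))); ring.
apply: (cderiv_eq (z := Complex ((a - s * (a ^+ 2 + b ^+ 2)) / D) (b / D))).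
  have w0 : 1 - ray v s != 0.
    apply/eqP => h; have : Re (1 - ray v s) = 0 by rewrite h.
    by rewrite /ray ReD ReN ReM /= mul0r subr0 -/a => e; move: sa; rewrite e ltxx.
  apply: (mulIf w0); rewrite mulfVK//.
  rewrite /ray; apply: complex_eqP; rewrite ?ReM ?ImM ReD ImD ReN ImN ReM ImM /= -/a -/b.
    by rewrite /D; field; exact: lt0r_neq0.
  by rewrite /D; field; exact: lt0r_neq0.
split => /=.
  have dD : is_derive s 1 (fun s => (1 - s * a) ^+ 2 + (s * b) ^+ 2) (2 * (s * b ^+ 2 - a * (1 - s * a))).
    apply: (is_derive_eq (derivD (derivX 2 dsa) (derivX 2 dsb))); rewrite /= !expr1; ring.
  have dl := deriv_comp (g := fun s => (1 - s * a) ^+ 2 + (s * b) ^+ 2) (is_derive1_ln D0) dD.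
  apply: (is_derive_eq (derivZ (- (1 / 2)) dl)).
  by field; exact: lt0r_neq0.
have sa0 : (1 - s * a) != 0 by exact: lt0r_neq0.
have dq := derivM dsb (derivV (f := fun s => 1 - s * a) sa0 dsa).
apply: (is_derive_eq (deriv_comp (g := fun s => s * b * (1 - s * a)^-1) (is_derive1_atan _) dq)).
move: D0; rewrite /D => D0; field; rewrite sa0 lt0r_neq0//.
Qed.

(** Both sides vanish at 0 and have the same derivative along the segment from 0 to v;
    [nielsen0_pow] is obtained in the same way. *)
Lemma nielsen_raylog1 v : cabs v < 1 -> nielsen 0 0 v = raylog v 1.
Proof.
move=> v1.
suff : nielsen 0 0 (ray v 0) - raylog v 0 = nielsen 0 0 (ray v 1) - raylog v 1.
  rewrite {1}/ray mul0r nielsen0 {1}/raylog !mul0r subr0 expr1n expr0n addr0 ln1 mulr0 atan0.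
  by rewrite {1}/ray mul1r subrr => /eqP; rewrite eq_sym subr_eq0 => /eqP.
apply: (cderiv0_cst (F := fun s => nielsen 0 0 (ray v s) - raylog v s)) => // s s01.
have w1 := ray_lt1 v1 s01.
have sa : 0 < 1 - s * Re v.
  move: s01 => /andP[s0 s1]; rewrite subr_gt0; have := Re_le_cabs v => h.
  have : s * Re v <= `|Re v|.
    by apply: (le_trans (ler_norm _)); rewrite normrM (ger0_norm s0) ler_piMl.
  by lra.
apply: (cderiv_eq _ (cderivB (nielsen_deriv0 0 (ray_tame v) w1) (cderiv_raylog sa))).
by rewrite mulr1 subrr.
Qed.

Lemma nielsen_log v : cabs v < 1 ->
  nielsen 0 0 v = Complex (- (1 / 2) * ln ((1 - Re v) ^+ 2 + Im v ^+ 2)) (atan (Im v / (1 - Re v))).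
Proof. by move=> v1; rewrite nielsen_raylog1// /raylog !mul1r. Qed.

Lemma nielsen_raylog v s : cabs (ray v s) < 1 -> nielsen 0 0 (ray v s) = raylog v s.
Proof.
move=> v1; rewrite nielsen_log// /raylog /ray ReM ImM /=.
by rewrite mul0r subr0 mul0r addr0.
Qed.

Lemma nielsen0_pow p v : cabs v < 1 -> nielsen 0 p v = nielsen 0 0 v ^+ p.+1 / p.+1`!%:R.
Proof.
elim: p v => [|p ih] v v1; first by rewrite expr1 divr1.
suff : nielsen 0 p.+1 (ray v 0) - nielsen 0 0 (ray v 0) ^+ p.+2 / p.+2`!%:R =
       nielsen 0 p.+1 (ray v 1) - nielsen 0 0 (ray v 1) ^+ p.+2 / p.+2`!%:R.
  rewrite /ray mul0r mul1r !nielsen0 expr0n mul0r subr0 => /esym/eqP.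
  by rewrite subr_eq0 => /eqP.
apply: (cderiv0_cst (F := fun s => nielsen 0 p.+1 (ray v s) - nielsen 0 0 (ray v s) ^+ p.+2 / p.+2`!%:R)) => // s s01.
have w1 := ray_lt1 v1 s01.
have d0 := cderivM (cderivX p.+2 (nielsen_deriv0 0 (ray_tame v) w1)) (cderiv_cst s (p.+2`!%:R)^-1).
apply: (cderiv_eq _ (cderivB (nielsen_deriv0 p.+1 (ray_tame v) w1) d0)).
rewrite ih// [in p.+2`!]factS natrM.
have p2 : p.+2%:R != 0 :> R[i] by rewrite pnatr_eq0.
have f0 : p.+1`!%:R != 0 :> R[i] by rewrite pnatr_eq0 -lt0n fact_gt0.
have w0 := sub1_neq0 w1.
move: (nielsen 0 0 _) (p.+2%:R) (p.+1`!%:R) p2 f0 (1 - ray v s) w0 => A P f P0 f0 W W0.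
by rewrite /=; move: (A ^+ p.+1) => B; field; rewrite W0 f0 P0.
Qed.

End NielsenElementary.

(** * Repeated integration by parts against powers of a logarithm *)

Section Telescoping.
Context {R : realType}.
Implicit Types (z w v X : R[i]) (S : nat -> R -> R[i]) (l n p m j : nat) (t : R).
Local Notation Re := (@complex.Re R).
Local Notation Im := (@complex.Im R).

(* The alternating sum of [(-1)^k x^(m-1-k) / (m-1-k)! S_(k+1)] over [k < m]. If
   [S_(k+1)' = x' S_k], then its derivative telescopes. *)
Fixpoint tele X (L : nat -> R[i]) m : R[i] :=
  if m is m'.+1 then X ^+ m' / m'`!%:R * L 1 - tele X (fun k => L k.+1) m' else 0.

Lemma tele_ext X (L L' : nat -> R[i]) m : (forall k, L k.+1 = L' k.+1) -> tele X L m = tele X L' m.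
Proof. by elim: m L L' => //= m ih L L' e; rewrite e (ih _ (fun k => L' k.+1)). Qed.

Lemma tele0 (L : nat -> R[i]) m : tele 0 L m.+1 = (-1) ^+ m * L m.+1.
Proof.
elim: m L => [|m ih] L; first by rewrite /= expr0 divr1 subr0.
by rewrite [LHS]/= -/(tele 0 (fun k => L k.+1) m.+1) ih expr0n !mul0r sub0r exprS mulN1r mulNr.
Qed.

Lemma tele_deriv (x : R -> R[i]) dx S t m : is_cderive t x dx ->
  (forall k, is_cderive t (S k.+1) (dx * S k t)) ->
  is_cderive t (fun u => tele (x u) (S^~ u) m.+1) (dx * (x t ^+ m / m`!%:R) * S 0 t).
Proof.
move=> dxP; elim: m S => [|m ih] S dS.
  under eq_fun do rewrite /= expr0 divr1 mul1r subr0.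
  by apply: (cderiv_eq _ (dS 0)); rewrite expr0 divr1 mulr1.
have d1 := cderivM (cderivM (cderivX m.+1 dxP) (cderiv_cst t (m.+1`!%:R)^-1)) (dS 0).
apply: (cderiv_eq _ (cderivB d1 (ih (fun k => S k.+1) (fun k => dS k.+1)))).
rewrite /= factS natrM.
have p2 : m.+1%:R != 0 :> R[i] by rewrite pnatr_eq0.
have f0 : m`!%:R != 0 :> R[i] by rewrite pnatr_eq0 -lt0n fact_gt0.
rewrite exprS; move: (m.+1%:R) (m`!%:R) p2 f0 => P f P0 f0.
by field; rewrite f0 P0.
Qed.

Lemma tele_cvg {T : Type} (E : set_system T) {FE : Filter E} (x : T -> R[i]) X
  (s : nat -> T -> R[i]) (L : nat -> R[i]) m :
  ccvg E x X -> (forall k, ccvg E (s k.+1) (L k.+1)) ->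
  ccvg E (fun u => tele (x u) (s^~ u) m) (tele X L m).
Proof.
move=> xX; elim: m s L => [|m ih] s L sL; first exact: ccvg_cst.
apply: ccvgB; last by apply: (ih (fun k => s k.+1) (fun k => L k.+1)).
exact: (ccvgM (ccvgM (ccvgX m xX) (@ccvg_cst _ _ _ _ _)) (sL 0)).
Qed.

Lemma tele_cvg0 {T : Type} (E : set_system T) {FE : Filter E} (x : T -> R[i])
  (s : nat -> T -> R[i]) m :
  (forall j k, ccvg E (fun u => x u ^+ j * s k.+1 u) 0) ->
  ccvg E (fun u => tele (x u) (s^~ u) m) 0.
Proof.
elim: m s => [|m ih] s h; first exact: ccvg_cst.
apply: (ccvg_eq (subr0 0)); apply: ccvgB; last by apply: (ih (fun k => s k.+1)).
apply: (ccvg_eq (mulr0 (m`!%:R)^-1)).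
have -> : (fun u => x u ^+ m / m`!%:R * s 1 u) = (fun u => (m`!%:R)^-1 * (x u ^+ m * s 1 u)).
  by apply/funext => u; ring.
exact: (ccvgM (@ccvg_cst _ _ _ _ _) (h m 0)).
Qed.

(** With q = sqrt r the base satisfies |x| <= 2 (c/2 - ln q), so its j-th power costs only a
    constant times 1/q, while s contributes q^2. *)
Lemma log_decay {T : Type} (E : set_system T) {FE : Filter E} (x s : T -> R[i]) (r : T -> R) (c C : R) j :
  0 <= c -> (\forall u \near E, 0 < r u <= 1) -> r u @[u --> E] --> (0 : R) ->
  (\forall u \near E, cabs (x u) <= c - ln (r u)) ->
  (\forall u \near E, cabs (s u) <= C * r u) -> ccvg E (fun u => x u ^+ j * s u) 0.
Proof.
move=> c0 r01 r0 xr sr.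
have q0 : Num.sqrt (r u) @[u --> E] --> (0 : R).
  by rewrite -[X in _ --> X]sqrtr0; exact: (cvg_comp _ _ r0 (@sqrt_continuous R _)).
pose K := 2 ^+ j * (j`!%:R * expR (c / 2)) * C.
apply: (ccvg0_squeeze (g := fun u => K * Num.sqrt (r u))); last first.
  exact: (cvg_eq (mulr0 K) (cvg_mulc q0)).
near=> u.
have /andP[u0 u1] : 0 < r u <= 1 by near: u.
have xu : cabs (x u) <= c - ln (r u) by near: u.
have su : cabs (s u) <= C * r u by near: u.
have p0 : 0 < Num.sqrt (r u) by rewrite sqrtr_gt0.
have p2 : Num.sqrt (r u) ^+ 2 = r u by rewrite sqr_sqrtr// ltW.
rewrite cabsM cabsX; rewrite -p2 lnXn// in xu.
rewrite -{}p2 in su *; rewrite [in leRHS]sqrtr_sqr (ger0_norm (ltW p0)).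
have l0 : ln (Num.sqrt (r u)) <= 0.
  by apply: ln_le0; rewrite -sqrtr1 ler_wsqrtr.
move: (Num.sqrt (r u)) p0 l0 xu su => q q0' l0 xu su.
have y0 : 0 <= c / 2 - ln q by lra.
have h : cabs (x u) ^+ j <= 2 ^+ j * (j`!%:R * expR (c / 2)) / q.
  apply: (@le_trans _ _ ((2 * (c / 2 - ln q)) ^+ j)).
    apply: lerXn2r; rewrite ?nnegrE ?cabs_ge0//; first lra.
    apply: (le_trans xu); rewrite mulr2n; lra.
  rewrite exprMn -[leRHS]mulrA ler_wpM2l ?exprn_ge0//.
  apply: (le_trans (exprn_le_expR j y0)).
  by rewrite expRD expRN lnK ?posrE// mulrA.
apply: (le_trans (ler_pM (exprn_ge0 _ (cabs_ge0 _)) (cabs_ge0 _) h su)).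
rewrite /K le_eqVlt; apply/orP; left; apply/eqP; field; exact: lt0r_neq0.
Unshelve. all: by end_near. Qed.

Lemma ccvg_right (f : R -> R[i]) t : ccvg (nbhs t) f (f t) -> ccvg (t^'+) f (f t).
Proof. by move=> [h1 h2]; split; apply: cvg_at_right_filter. Qed.

Lemma ccvg_left (f : R -> R[i]) t : ccvg (nbhs t) f (f t) -> ccvg (t^'-) f (f t).
Proof. by move=> [h1 h2]; split; apply: cvg_at_left_filter. Qed.

End Telescoping.

(** * Integrals of logarithms along the arc from 0 to omega *)

Section ArcIntegrals.
Context {R : realType}.
Implicit Types (z w : R[i]) (n p m : nat) (t : R).
Local Notation Re := (@complex.Re R).
Local Notation Im := (@complex.Im R).

Definition omega : R[i] := Complex (1 / 2) (Num.sqrt 3 / 2).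

Definition cJint (g : R -> R[i]) z :=
  Jint (fun t => Re (g t)) (Re z) /\ Jint (fun t => Im (g t)) (Im z).

Lemma sqrt3_sq : Num.sqrt 3 ^+ 2 = 3 :> R.
Proof. by rewrite sqr_sqrtr. Qed.

Lemma cabs_omega : cabs omega = 1.
Proof.
rewrite /cabs /= (_ : _ + _ = (1 + Num.sqrt 3 ^+ 2) / 4); last by field.
by rewrite sqrt3_sq (_ : (1 + 3) / 4 = 1) ?sqrtr1//; field.
Qed.

Definition imag t : R[i] := Complex 0 t.

Let cderiv_imag t : is_cderive t imag 'i%C.
Proof. by split; [exact: derivC|exact: deriv_id]. Qed.

(* The path [1 - exp (- i t)]; its logarithm is [arclog t + i pi / 3]. *)
Definition arc t : R[i] := Complex (1 - cos t) (sin t).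

Let darc t : R[i] := Complex (sin t) (cos t).

(** The logarithm is shifted so as to vanish at t = pi/3, where the arc reaches omega. For c = 0 in
    [Jint_nielsen] this leaves a single polylogarithm. *)
Definition arclog t : R[i] := Complex (1 / 2 * ln (ysin t)) (pi / 6 - t / 2).

Let cderiv_arc t : is_cderive t arc (darc t).
Proof.
split => /=; last exact: is_derive_sin.
apply: (is_derive_eq (derivB (derivC 1 t) (is_derive_cos t))); ring.
Qed.

Let arc_tame : tame_path arc darc.
Proof.
split=> //; exists 2 => x; apply: (le_trans (cabs_le _)) => /=.
have h1 := cos_max x; have h2 := sin_max x.
exact: lerD h2 h1.
Qed.

Lemma cabs_arc t : cabs (arc t) = Num.sqrt (ysin t).
Proof.
rewrite /cabs /ysin /=; congr (Num.sqrt _).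
by rewrite sin2cos2; ring.
Qed.

Let arc_lt1 t : 0 < t < pi / 3 -> cabs (arc t) < 1.
Proof.
move=> /ysin_arc/andP[y0 y1].
by rewrite cabs_arc -[ltRHS]sqrtr1 ltr_sqrt.
Qed.

Let arc_neq0 t : 0 < t < pi / 3 -> arc t != 0.
Proof.
move=> /ysin_arc/andP[y0 y1]; apply/eqP => h.
have : cabs (arc t) = 0 by rewrite h cabs0.
by rewrite cabs_arc => /eqP; rewrite sqrtr_eq0 leNgt y0.
Qed.

Let cderiv_arclog t : 0 < ysin t ->
  is_cderive t arclog (Complex (sin t / ysin t) (- (1 / 2))).
Proof.
move=> y0; split => /=.
  have d := deriv_comp (is_derive1_ln y0) (is_derive_ysin t).
  apply: (is_derive_eq (derivZ (1 / 2) d)); field; exact: lt0r_neq0.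
by apply: (is_derive_eq (derivB (derivC (pi / 6) t) (derivM (deriv_id t) (derivC 2^-1 t)))); field.
Qed.

Let arclogE t : 0 < t < pi / 3 -> Complex (sin t / ysin t) (- (1 / 2)) = darc t / arc t.
Proof.
move=> t01; have w0 := arc_neq0 t01; have /andP[y0 y1] := ysin_arc t01.
apply: (mulIf w0); rewrite mulfVK//.
have h := sin_ysin t; have hc : cos t = 1 - ysin t / 2 by rewrite /ysin; field.
rewrite /arc /darc hc; apply: complex_eqP; rewrite ?ReM ?ImM /=.
  by field; exact: lt0r_neq0.
transitivity ((4 * sin t ^+ 2) / (4 * ysin t) - ysin t / 4); first by field; exact: lt0r_neq0.
by rewrite h; field; exact: lt0r_neq0.
Qed.

Let nielsen_arc p t : 0 < t < pi / 3 -> nielsen 0 p (arc t) = imag t ^+ p.+1 / p.+1`!%:R.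
Proof.
move=> t01; rewrite (nielsen0_pow p (arc_lt1 t01)) (nielsen_log (arc_lt1 t01)) [Re _]/= [Im _]/=.
have /andP[c0 c1] := cos_arc t01.
rewrite opprB addrCA subrr addr0 cos2Dsin2 ln1 mulr0 -/(tan t) tanK//.
rewrite in_itv /=; have := @pi_gt0 R; move: t01 => /andP[t0 t1]; lra.
Qed.

(* The terms of [tele] with [k = 0, ..., n] come from integrating by parts the
   powers of the shifted logarithm [arclog t + i c]. *)
Lemma Jint_nielsen c n p :
  cJint (fun t => (- (arclog t + imag c)) ^+ n.+1 / n.+1`!%:R * ('i%C * (imag t ^+ p / p`!%:R)))
        ((-1) ^+ n * tele (imag c) (fun k => nielsen k p omega) n.+1 +
         (- imag c) ^+ n.+1 / n.+1`!%:R * (imag (pi / 3) ^+ p.+1 / p.+1`!%:R)).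
Proof.
set V := (X in cJint _ X); pose clog t := arclog t + imag c.
pose S k t := nielsen k p (arc t).
(* The derivative of the first term is clog' times (- clog)^n / n! times [S 0], which cancels
   against the product rule in the second term. Only the part where [S 0] is differentiated
   remains. *)
pose F t := (-1) ^+ n * tele (clog t) (S^~ t) n.+1 + (- clog t) ^+ n.+1 / n.+1`!%:R * S 0 t.
suff [FP F0 F1] : [/\ forall t, 0 < t < pi / 3 -> is_cderive t F
      ((- clog t) ^+ n.+1 / n.+1`!%:R * ('i%C * (imag t ^+ p / p`!%:R))),
    ccvg (0^'+) F 0 & ccvg ((pi / 3)^'-) F V].
  split; [exists (fun t => Re (F t))|exists (fun t => Im (F t))].
    by split; [move=> t /FP[]|case: F0|case: F1].
  by split; [move=> t /FP[]|case: F0|case: F1].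
have p2 : n.+1%:R != 0 :> R[i] by rewrite pnatr_eq0.
have f0 : n`!%:R != 0 :> R[i] by rewrite pnatr_eq0 -lt0n fact_gt0.
split.
- move=> t t01; have /andP[y0 y1] := ysin_arc t01.
  have w0 := arc_neq0 t01; have w1 := arc_lt1 t01.
  have dl : is_cderive t clog (darc t / arc t).
    apply: (cderiv_eq _ (cderivD (cderiv_eq (arclogE t01) (cderiv_arclog y0)) (cderiv_cst t (imag c)))).
    by rewrite addr0.
  have dS k : is_cderive t (S k.+1) (darc t / arc t * S k t) by exact: nielsen_derivS.
  have dT := cderivZ ((-1) ^+ n) (tele_deriv (S := S) n dl dS).
  have dS0 := nielsen_deriv0 p arc_tame w1.
  apply: (cderiv_eq _ (cderivD dT (cderivM (cderivM (cderivX n.+1 (cderivN dl)) (cderiv_cst t (n.+1`!%:R)^-1)) dS0))).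
  have -> : darc t / (1 - arc t) = 'i%C.
    have v0 := sub1_neq0 w1; apply: (mulIf v0); rewrite mulfVK//.
    by rewrite /arc /darc; apply: complex_eqP; rewrite ?ReM ?ImM /=; ring.
  have -> : (if p is p'.+1 then nielsen 0 p' (arc t) else 1) = imag t ^+ p / p`!%:R.
    by case: (p) => [|p']; [rewrite expr0 divr1|exact: nielsen_arc].
  rewrite factS natrM /= !(exprNn (clog t)) !exprS -/(nielsen 0 p (arc t)) /S.
  move: (n.+1%:R) (n`!%:R) p2 f0 ((-1) ^+ n) (clog t ^+ n) => P f P0 f0 e B.
  move: (darc t / arc t) ('i%C * _) (nielsen 0 p (arc t)) => d C N.
  by field; rewrite f0 P0.
- have rc : Num.sqrt (ysin t) @[t --> (0 : R)^'+] --> (0 : R).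
    have y0 : ysin 0 = 0 :> R by rewrite /ysin cos0; ring.
    have yc : ysin t @[t --> (0 : R)] --> ysin 0 by exact: derivable_cvg (is_derive_ysin 0).
    apply: cvg_at_right_filter; rewrite -[X in _ --> X]sqrtr0 -{2}y0.
    exact: (cvg_comp _ _ yc (@sqrt_continuous R _)).
  have D (j k : nat) : ccvg (0^'+) (fun t => clog t ^+ j * S k t) 0.
    have [C C0 HC] := @nielsen_small R k p.
    apply: (log_decay (r := fun t => Num.sqrt (ysin t)) (c := `|c| + pi / 6) (C := C)) => //.
    + by rewrite addr_ge0// divr_ge0// pi_ge0.
    + near=> t; have t01 : 0 < t < pi / 3.
        by apply/andP; split; near: t; [exact: nbhs_right_gt|apply: nbhs_right_lt; exact: pi3_gt0].
      have /andP[y0 y1] := ysin_arc t01.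
      by rewrite sqrtr_gt0 y0 -[leRHS]sqrtr1 ler_wsqrtr// ltW.
    + near=> t; have t01 : 0 < t < pi / 3.
        by apply/andP; split; near: t; [exact: nbhs_right_gt|apply: nbhs_right_lt; exact: pi3_gt0].
      have /andP[y0 y1] := ysin_arc t01.
      apply: (le_trans (cabs_le _)) => /=.
      have q0 : 0 < Num.sqrt (ysin t) by rewrite sqrtr_gt0.
      have e : ln (ysin t) = 2 * ln (Num.sqrt (ysin t)).
        by rewrite -{1}(sqr_sqrtr (ltW y0)) lnXn// mulr2n; ring.
      have l0 : ln (Num.sqrt (ysin t)) <= 0.
        by apply: ln_le0; rewrite -sqrtr1 ler_wsqrtr// ltW.
      rewrite addr0 e ler0_norm; last lra.
      have h1 : `|pi / 6 - t / 2 + c| <= pi / 6 + `|c|.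
        apply: (le_trans (ler_normD _ _)); rewrite lerD2r.
        by move: t01 => /andP[t0 t1]; rewrite ger0_norm; lra.
      by move: h1; lra.
    + have := rc => /cvgrPdist_lt/(_ (1 / 2)) hr.
      near=> t; rewrite -cabs_arc; apply: HC; rewrite cabs_arc.
      have : `|0 - Num.sqrt (ysin t)| < 1 / 2 by near: t; apply: hr; lra.
      by rewrite sub0r normrN ger0_norm ?sqrtr_ge0// => /ltW.
  apply: (ccvg_eq (z := (-1) ^+ n * 0 + (-1) ^+ n.+1 / n.+1`!%:R * 0)); first by rewrite !mulr0 addr0.
  apply: ccvgD.
    apply: ccvgM; first exact: ccvg_cst.
    by apply: tele_cvg0 => j k.
  have -> : (fun t => (- clog t) ^+ n.+1 / n.+1`!%:R * S 0 t) =
     (fun t => (-1) ^+ n.+1 / n.+1`!%:R * (clog t ^+ n.+1 * S 0 t)).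
    by apply/funext => t; rewrite (exprNn (clog t)); ring.
  exact: (ccvgM (@ccvg_cst R _ _ _ _) (D n.+1 0)).
have y1 : ysin (pi / 3) = 1 :> R by rewrite /ysin cos_pi3; field.
have arc1 : arc (pi / 3) = omega.
  by rewrite /arc /omega cos_pi3 sin_pi3; congr Complex; field.
have log1 : arclog (pi / 3) = 0.
  by rewrite /arclog y1 ln1 mulr0; congr Complex; field.
have cl : ccvg ((pi / 3)^'-) clog (imag c).
  apply: (ccvg_eq (add0r _)); apply: ccvgD; last exact: ccvg_cst.
  by rewrite -log1; apply/ccvg_left/(cderiv_cvg (cderiv_arclog _)); rewrite y1.
have cw : ccvg ((pi / 3)^'-) arc omega.
  by rewrite -arc1; apply/ccvg_left/(cderiv_cvg (cderiv_arc _)).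
have cS k : ccvg ((pi / 3)^'-) (S k.+1) (nielsen k.+1 p omega).
  apply: nielsen_cvg cw; near=> t; apply/ltW/arc_lt1; apply/andP; split; near: t.
    by apply: nbhs_left_gt; exact: pi3_gt0.
  exact: nbhs_left_lt.
have cS0 : ccvg ((pi / 3)^'-) (S 0) (imag (pi / 3) ^+ p.+1 / p.+1`!%:R).
  have h : ccvg ((pi / 3)^'-) (fun t => imag t ^+ p.+1 / p.+1`!%:R) (imag (pi / 3) ^+ p.+1 / p.+1`!%:R).
    apply: ccvgM; last exact: ccvg_cst.
    by apply: ccvgX; apply/ccvg_left/(cderiv_cvg (cderiv_imag _)).
  apply: ccvg_near_eq h; near=> t; apply/esym/nielsen_arc; apply/andP; split; near: t.
    by apply: nbhs_left_gt; exact: pi3_gt0.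
  exact: nbhs_left_lt.
apply: ccvgD.
  exact: (ccvgM (@ccvg_cst _ _ _ _ _) (tele_cvg (L := fun k => nielsen k p omega) n.+1 cl cS)).
exact: (ccvgM (ccvgM (ccvgX n.+1 (ccvgN cl)) (@ccvg_cst _ _ _ _ _)) cS0).
Unshelve. all: by end_near. Qed.

End ArcIntegrals.

(** * The relation between w and 1 - w along the ray to omega *)

Section InversionRelation.
Context {R : realType}.
Implicit Types (z w : R[i]) (n p m a b k : nat) (t : R).
Local Notation Re := (@complex.Re R).
Local Notation Im := (@complex.Im R).
Local Notation om := (@omega R).

Lemma tan_pi3 : tan (pi / 3) = Num.sqrt 3 :> R.
Proof. by rewrite /tan sin_pi3 cos_pi3; field. Qed.

Lemma atan_sqrt3 : atan (Num.sqrt 3) = pi / 3 :> R.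
Proof.
rewrite -tan_pi3 tanK// in_itv /=; have := @pi_gt0 R; lra.
Qed.

Let logw t : R[i] := Complex (ln t) (pi / 3).

Let v t : R[i] := 1 - ray om t.

Let logv t : R[i] := - raylog om t.

Let cderiv_logw t : 0 < t -> is_cderive t logw (om / ray om t).
Proof.
move=> t0; have -> : om / ray om t = Complex (1 / t) 0.
  have o0 : om != 0.
    by apply/eqP => h; have := @cabs_omega R; rewrite h cabs0 => /eqP; rewrite eq_sym oner_eq0.
  have t1 : t%:C%C != 0 by rewrite fmorph_eq0 gt_eqF.
  rewrite /ray invfM mulrCA mulfV// mulr1; apply: (mulIf t1); rewrite mulVf//.
  by apply: complex_eqP; rewrite ?ReM ?ImM /=; field; exact: lt0r_neq0.
by split => /=; [rewrite div1r; exact: is_derive1_ln|exact: derivC].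
Qed.

Let v_tame : tame_path v (fun=> - om).
Proof.
split; last by exists (cabs (- om)).
have [h _] := @ray_tame R om.
by move=> t; apply: (cderiv_eq _ (cderivB (cderiv_cst t 1) (h t))); rewrite sub0r.
Qed.

Let cabs_w t : 0 <= t -> cabs (ray om t) = t.
Proof. by move=> t0; rewrite cabs_ray// cabs_omega mulr1. Qed.

Let cabs_v t : cabs (v t) = Num.sqrt (1 - t * (1 - t)).
Proof.
rewrite /cabs /v /ray ReD ImD ReN ImN ReM ImM /=; congr (Num.sqrt _).
transitivity (1 - t + t ^+ 2 * (1 + Num.sqrt 3 ^+ 2) / 4); first by field.
by rewrite sqrt3_sq; field.
Qed.

Let cabs_v_lt1 t : 0 < t < 1 -> cabs (v t) < 1.
Proof.
move=> /andP[t0 t1]; have h : 0 < t * (1 - t) by rewrite mulr_gt0// subr_gt0.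
by rewrite cabs_v -[ltRHS]sqrtr1 ltr_sqrt//; lra.
Qed.

Let logv_nielsen t : 0 <= t < 1 -> logv t = - nielsen 0 0 (ray om t).
Proof. by move=> /andP[t0 t1]; rewrite nielsen_raylog// cabs_w. Qed.

Let cderiv_logv t : t <= 1 -> is_cderive t logv (- om / v t).
Proof.
move=> t1; rewrite mulNr; apply: cderivN; apply: cderiv_raylog => /=; lra.
Qed.

Let logw_nielsen t : 0 < t < 1 -> nielsen 0 0 (v t) = - logw t.
Proof.
move=> t01; have v1 := cabs_v_lt1 t01; move: t01 => /andP[t0 t1].
rewrite nielsen_log// /v /ray ReD ImD ReN ImN ReM ImM [Re 1]/= [Im 1]/= [Re _%:C%C]/= [Im _%:C%C]/=.
rewrite /omega [Re _]/= [Im _]/=.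
have -> : (1 - (1 - (t * (1 / 2) - 0 * (Num.sqrt 3 / 2)))) ^+ 2 +
   (0 - (t * (Num.sqrt 3 / 2) + 0 * (1 / 2))) ^+ 2 = t ^+ 2.
  transitivity (t ^+ 2 * (1 + Num.sqrt 3 ^+ 2) / 4); first by field.
  by rewrite sqrt3_sq; field.
have -> : (0 - (t * (Num.sqrt 3 / 2) + 0 * (1 / 2))) / (1 - (1 - (t * (1 / 2) - 0 * (Num.sqrt 3 / 2)))) =
    - Num.sqrt 3.
  by field; lra.
by rewrite atanN atan_sqrt3 lnXn// mulr2n /logw; apply: complex_eqP => /=; field.
Qed.

(** On the ray, S_0(w) and S_0(1 - w) are divided powers of -log (1 - w) and -log w, so the
    derivatives of the two [tele] sums add up to that of the product of divided powers of log w and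
    log (1 - w), and G is constant. At t = 0 only the value at 1 survives, since log (1 - w)
    vanishes there; at t = 1 one has 1 - omega = conj omega, with logarithms i pi/3 and -i pi/3. *)
Lemma nielsen_inversion a b :
  (-1) ^+ b.+1 * tele (imag (pi / 3)) (fun k => nielsen k b om) a.+1
  + (-1) ^+ a.+1 * tele (- imag (pi / 3)) (fun k => nielsen k a om^*%C) b.+1
  - imag (pi / 3) ^+ a.+1 / a.+1`!%:R * ((- imag (pi / 3)) ^+ b.+1 / b.+1`!%:R)
  = (-1) ^+ a.+1 * ((-1) ^+ b * nielsen b.+1 a (1 : R[i])).
Proof.
pose S k t := nielsen k b (ray om t).
pose T k t := nielsen k a (v t).
pose G t := (-1) ^+ b.+1 * tele (logw t) (S^~ t) a.+1 + (-1) ^+ a.+1 * tele (logv t) (T^~ t) b.+1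
   - logw t ^+ a.+1 / a.+1`!%:R * (logv t ^+ b.+1 / b.+1`!%:R).
have ww t : 0 < t < 1 -> ray om t != 0 /\ cabs (ray om t) < 1.
  move=> /andP[t0 t1]; have h := cabs_w (ltW t0); split; last by rewrite h.
  by apply/eqP => e; move: h; rewrite e cabs0 => h; move: t0; rewrite -h ltxx.
have dG t : 0 < t < 1 -> is_cderive t G 0.
  move=> t01; have /andP[t0 t1] := t01; have [w0 w1] := ww t t01.
  have v1 := cabs_v_lt1 t01; have v0 : v t != 0 by exact: sub1_neq0.
  have dx := cderiv_logw t0; have dy := cderiv_logv (ltW t1).
  have dS k : is_cderive t (S k.+1) (om / ray om t * S k t).
    exact: (nielsen_derivS k b (ray_tame om) w0 w1).
  have dT k : is_cderive t (T k.+1) (- om / v t * T k t).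
    exact: (nielsen_derivS k a v_tame v0 v1).
  have d1 := cderivZ ((-1) ^+ b.+1) (tele_deriv (S := S) a dx dS).
  have d2 := cderivZ ((-1) ^+ a.+1) (tele_deriv (S := T) b dy dT).
  have d3 := cderivM (cderivM (cderivX a.+1 dx) (cderiv_cst t (a.+1`!%:R)^-1))
                     (cderivM (cderivX b.+1 dy) (cderiv_cst t (b.+1`!%:R)^-1)).
  apply: (cderiv_eq _ (cderivB (cderivD d1 d2) d3)).
  have -> : S 0 t = (- logv t) ^+ b.+1 / b.+1`!%:R.
    by rewrite /S (nielsen0_pow b w1) logv_nielsen ?opprK// t1 ltW.
  have -> : T 0 t = (- logw t) ^+ a.+1 / a.+1`!%:R.
    by rewrite /T (nielsen0_pow a v1) logw_nielsen.
  rewrite !factS !natrM /= (exprNn (logv t)) (exprNn (logw t)).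
  have p1 : a.+1%:R != 0 :> R[i] by rewrite pnatr_eq0.
  have p2 : b.+1%:R != 0 :> R[i] by rewrite pnatr_eq0.
  have f1 : a`!%:R != 0 :> R[i] by rewrite pnatr_eq0 -lt0n fact_gt0.
  have f2 : b`!%:R != 0 :> R[i] by rewrite pnatr_eq0 -lt0n fact_gt0.
  have s1 : (-1) ^+ a.+1 * (-1) ^+ a.+1 = 1 :> R[i].
    by rewrite -exprD addnn -mul2n exprM sqrrN expr1n expr1n.
  have s2 : (-1) ^+ b.+1 * (-1) ^+ b.+1 = 1 :> R[i].
    by rewrite -exprD addnn -mul2n exprM sqrrN expr1n expr1n.
  move: (om / ray om t) (- om / v t) (logw t) (logv t) ((-1) ^+ a.+1) ((-1) ^+ b.+1) s1 s2
    (a.+1%:R) (b.+1%:R) (a`!%:R) (b`!%:R) p1 p2 f1 f2 => p q x y ea eb s1 s2 A B C D A0 B0 C0 D0.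
  transitivity ((eb * eb - 1) * (p * (x ^+ a / C) * (y ^+ b.+1 / (B * D)))
     + (ea * ea - 1) * (q * (y ^+ b / D) * (x ^+ a.+1 / (A * C)))).
    move: (x ^+ a) (y ^+ b) (x ^+ a.+1) (y ^+ b.+1) => xa yb xa1 yb1.
    by field; rewrite A0 B0 C0 D0.
  by rewrite s1 s2 !subrr !mul0r addr0.
have [C C0 HC] := @nielsen_small R 0 0.
have idc : (t : R) @[t --> (0 : R)^'+] --> (0 : R).
  by apply: cvg_at_right_filter; exact: cvg_id.
have y0 : ccvg (0^'+) logv 0.
  apply: (ccvg0_squeeze (g := fun t => C * t)); last exact: (cvg_eq (mulr0 C) (cvg_mulc idc)).
  near=> t; have t0 : 0 < t by near: t; exact: nbhs_right_gt.
  have t2 : t < 1 / 2 by near: t; apply: nbhs_right_lt; lra.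
  rewrite logv_nielsen; last by rewrite ltW//=; lra.
  rewrite cabsN -[in leRHS](cabs_w (ltW t0)); apply: HC; rewrite cabs_w; lra.
have xdec (s : R -> R[i]) K j : (\forall t \near 0^'+, cabs (s t) <= K * t) ->
    ccvg (0^'+) (fun t => logw t ^+ j * s t) 0.
  move=> hs; apply: (log_decay (r := fun t => t) (c := pi / 3) (C := K)) => //.
  + exact: ltW pi3_gt0.
  + near=> t; apply/andP; split; near: t; [exact: nbhs_right_gt|exact: nbhs_right_le].
  + near=> t; have t0 : 0 < t by near: t; exact: nbhs_right_gt.
    have t1 : t <= 1 by near: t; exact: nbhs_right_le.
    apply: (le_trans (cabs_le _)) => /=; rewrite (ger0_norm (ltW pi3_gt0)).
    by rewrite ler0_norm ?ln_le0// addrC.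
have lim0 : ccvg (0^'+) G ((-1) ^+ a.+1 * ((-1) ^+ b * nielsen b.+1 a (1 : R[i]))).
  have e : (-1) ^+ b.+1 * 0 + (-1) ^+ a.+1 * tele 0 (fun k => nielsen k a (1 : R[i])) b.+1 - 0 * (b.+1`!%:R)^-1 =
      (-1) ^+ a.+1 * ((-1) ^+ b * nielsen b.+1 a (1 : R[i])).
    by rewrite tele0 mulr0 mul0r subr0 add0r.
  apply: (ccvg_eq e); apply: ccvgB; first apply: ccvgD.
  - apply: (ccvgM (@ccvg_cst _ _ _ _ _)); apply: tele_cvg0 => j k.
    have [K K0 HK] := @nielsen_small R k.+1 b.
    apply: (xdec _ K); near=> t; have t0 : 0 < t by near: t; exact: nbhs_right_gt.
    have t2 : t <= 1 / 2 by near: t; apply: nbhs_right_le; lra.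
    by rewrite -[in leRHS](cabs_w (ltW t0)); apply: HK; rewrite cabs_w// ltW.
  - apply: (ccvgM (@ccvg_cst _ _ _ _ _)); apply: tele_cvg => // k.
    have [vt _] := v_tame.
    have e1 : v 0 = 1 by rewrite /v /ray mul0r subr0.
    apply: nielsen_cvg; last by rewrite -e1; apply/ccvg_right/(cderiv_cvg (vt 0)).
    near=> t; apply/ltW/cabs_v_lt1; apply/andP; split; near: t; [exact: nbhs_right_gt|exact: nbhs_right_lt].
  - have -> : (fun t => logw t ^+ a.+1 / a.+1`!%:R * (logv t ^+ b.+1 / b.+1`!%:R)) =
      (fun t => ((logw t ^+ a.+1 * logv t) * (a.+1`!%:R)^-1 * logv t ^+ b) * (b.+1`!%:R)^-1).
      by apply/funext => t; rewrite (exprS (logv t)); ring.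
    apply: ccvgM; last exact: ccvg_cst.
    have e2 : 0 * (a.+1`!%:R)^-1 * 0 ^+ b = 0 :> R[i] by rewrite !mul0r.
    apply: (ccvg_eq e2); apply: ccvgM; last exact: ccvgX.
    apply: ccvgM; last exact: ccvg_cst.
    apply: (xdec _ C); near=> t; have t0 : 0 < t by near: t; exact: nbhs_right_gt.
    have t2 : t < 1 / 2 by near: t; apply: nbhs_right_lt; lra.
    rewrite logv_nielsen; last by rewrite ltW//=; lra.
    by rewrite cabsN -[in leRHS](cabs_w (ltW t0)); apply: HC; rewrite cabs_w; lra.
have x1 : logw 1 = imag (pi / 3) by rewrite /logw ln1.
have y1 : logv 1 = - imag (pi / 3).
  rewrite /logv /raylog /omega /= !mul1r.
  have -> : (1 - 2^-1) ^+ 2 + (Num.sqrt 3 / 2) ^+ 2 = 1 :> R.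
    transitivity ((1 + Num.sqrt 3 ^+ 2) / 4 : R); first by field.
    by rewrite sqrt3_sq; field.
  have -> : Num.sqrt 3 / 2 / (1 - 2^-1) = Num.sqrt 3 :> R by field.
  by rewrite ln1 mulr0 atan_sqrt3.
have v1 : v 1 = om^*%C.
  by rewrite /v /ray mul1r; apply: complex_eqP; rewrite ?ReD ?ImD ?ReN ?ImN /=; field.
have cx : ccvg (1^'-) logw (imag (pi / 3)).
  by rewrite -x1; apply/ccvg_left/(cderiv_cvg (cderiv_logw ltr01)).
have cy : ccvg (1^'-) logv (- imag (pi / 3)).
  by rewrite -y1; apply/ccvg_left/(cderiv_cvg (cderiv_logv (lexx 1))).
have near01 : \forall t \near (1 : R)^'-, 0 < t < 1.
  near=> t; apply/andP; split; near: t; [exact: nbhs_left_gt|exact: nbhs_left_lt].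
have cS k : ccvg (1^'-) (S k.+1) (nielsen k.+1 b om).
  have [wt _] := @ray_tame R om.
  apply: nielsen_cvg; last by rewrite -{2}(mul1r om); apply/ccvg_left/(cderiv_cvg (wt 1)).
  by near=> t; have [_ /ltW] : ray om t != 0 /\ cabs (ray om t) < 1 by apply: ww; near: t.
have cT k : ccvg (1^'-) (T k.+1) (nielsen k.+1 a om^*%C).
  have [vt _] := v_tame.
  apply: nielsen_cvg; last by rewrite -v1; apply/ccvg_left/(cderiv_cvg (vt 1)).
  by near=> t; apply/ltW/cabs_v_lt1; near: t.
apply/esym; apply: (cderiv0_limits ltr01 dG lim0).
apply: ccvgB; first apply: ccvgD.
- exact: (ccvgM (@ccvg_cst _ _ _ _ _) (tele_cvg (L := fun k => nielsen k b om) a.+1 cx cS)).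
- exact: (ccvgM (@ccvg_cst _ _ _ _ _) (tele_cvg (L := fun k => nielsen k a om^*%C) b.+1 cy cT)).
exact: (ccvgM (ccvgM (ccvgX a.+1 cx) (@ccvg_cst _ _ _ _ _))
  (ccvgM (ccvgX b.+1 cy) (@ccvg_cst _ _ _ _ _))).
Unshelve. all: by end_near. Qed.

End InversionRelation.

(** * Special values at omega and at 1 *)

Section NielsenValues.
Context {R : realType}.
Implicit Types (z w : R[i]) (n p m a b k l N : nat) (t : R).
Local Notation Re := (@complex.Re R).
Local Notation Im := (@complex.Im R).
Local Notation om := (@omega R).

Lemma ccvg_complex (u : nat -> R[i]^o) z : ccvg \oo u z -> u n @[n --> \oo] --> (z : R[i]^o).
Proof.
move=> h; apply/(@cvgrPdist_lt _ (R[i]^o)) => e; rewrite ltcE => /andP[/= /eqP e1 e0].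
have h0 : cabs (z - u n) @[n --> \oo] --> (0 : R).
  apply: (cvg_eq (a := cabs (z - z))); first by rewrite subrr cabs0.
  by apply: cabs_cvg; apply: ccvgB => //; exact: ccvg_cst.
move/cvgrPdist_lt/(_ _ e0) : h0 => h0; near=> n.
have : `|0 - cabs (z - u n)| < Re e by near: n.
rewrite sub0r normrN ger0_norm ?cabs_ge0// => hn.
by rewrite normc_def ltcE /= e1 eqxx.
Unshelve. all: by end_near. Qed.

Lemma cis_omega l : cis (l%:R * pi / 3) = om ^+ l.
Proof.
elim: l => [|l ih].
  by rewrite mul0r mul0r /cis cos0 sin0 expr0.
rewrite exprSr -ih; have -> : l.+1%:R * pi / 3 = l%:R * pi / 3 + pi / 3 :> R.
  by rewrite -natr1; ring.
by rewrite /cis cosD sinD cos_pi3 sin_pi3 /omega; apply: complex_eqP; rewrite ?ReM ?ImM /=; ring.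
Qed.

Lemma mu_nielsen n p : mu n.+2 (nseq p 1%N) = nielsen n.+1 p om.
Proof.
have h := csum_cvg (nielsen_summable n p (_ : cabs om <= 1)).
have {h} : ccvg \oo (fun N => \sum_(l < N) (ncoef n.+1 p l)%:C%C * om ^+ l) (nielsen n.+1 p om).
  by apply: h; rewrite cabs_omega.
move=> h; apply: (cvg_lim (@norm_hausdorff _ (R[i]^o))); apply: ccvg_complex.
rewrite (_ : (fun N => _) = fun N => \sum_(l < N.+1) (ncoef n.+1 p l)%:C%C * om ^+ l); last first.
  apply/funext => N; rewrite big_ord_recl ncoef0 mul0r add0r.
  rewrite big_add1 /= big_mkord; apply: eq_bigr => l _.
  rewrite /bump /= add1n cis_omega /ncoef -/(esum p l.+1).
  by rewrite rmorphM fmorphV rmorphXn rmorph_nat; ring.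
by split; [rewrite (cvg_shiftS (fun N => Re (\sum_(l < N) (ncoef n.+1 p l)%:C%C * om ^+ l)))|
  rewrite (cvg_shiftS (fun N => Im (\sum_(l < N) (ncoef n.+1 p l)%:C%C * om ^+ l)))]; case: h.
Qed.

Lemma nielsen1_cvg n p : \sum_(l < N) ncoef n.+1 p l @[N --> \oo] --> Re (nielsen n.+1 p (1 : R[i])).
Proof.
have h : csummable (fun l => (ncoef n.+1 p l)%:C%C * (1 : R[i]) ^+ l).
  by apply: nielsen_summable; rewrite cabs1.
have [h1 _] := csum_cvg h; apply: cvg_trans h1; apply: near_eq_cvg; apply: nearW => N.
elim: N => [|N ih]; first by rewrite !big_ord0.
by rewrite !big_ord_recr ReD ih expr1n mulr1.
Qed.

Lemma Im_nielsen1 n p : Im (nielsen n p (1 : R[i])) = 0.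
Proof.
apply: (cvg_lim (@Rhausdorff R)); rewrite (_ : series _ = fun=> 0); first exact: cvg_cst.
by apply/funext => N; rewrite seriesEnat /= big1// => l _; rewrite expr1n mulr1.
Qed.

Lemma ncoef_p0 n l : ncoef n 0 l.+1 = 1 / l.+1%:R ^+ n.+1 :> R.
Proof. by []. Qed.

Lemma ncoef_p0_sum n N : \sum_(l < N.+1) ncoef n 0 l = zsum n.+1 N :> R.
Proof.
rewrite big_ord_recl ncoef0 add0r /zsum big_add1 big_mkord.
by apply: eq_bigr.
Qed.

Lemma nielsen1_zeta n : nielsen n.+1 0 1 = (zeta n.+2)%:C%C :> R[i].
Proof.
apply: complex_eqP; last exact: Im_nielsen1.
have h : zsum n.+2 N @[N --> \oo] --> Re (nielsen n.+1 0 (1 : R[i])).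
  have h0 : \sum_(l < N) ncoef n.+1 0 l @[N --> \oo] --> Re (nielsen n.+1 0 (1 : R[i])).
    exact: nielsen1_cvg.
  have h1 : \sum_(l < N.+1) ncoef n.+1 0 l @[N --> \oo] --> Re (nielsen n.+1 0 (1 : R[i])).
    by rewrite (cvg_shiftS (fun N => \sum_(l < N) ncoef n.+1 0 l)).
  by apply: cvg_trans h1; apply: near_eq_cvg; apply: nearW => N; rewrite ncoef_p0_sum.
have h' : zsum n.+2 N @[N --> \oo] --> (zeta n.+2 : R) by exact: zsum_cvg.
exact: etrans (esym (cvg_lim (@Rhausdorff R) h)) (cvg_lim (@Rhausdorff R) h').
Qed.

Let ReZ (x : R) z : Re (x%:C%C * z) = x * Re z.
Proof. by rewrite ReM /= mul0r subr0. Qed.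

Let om6 : om ^+ 6 = 1.
Proof.
rewrite -cis_omega /cis (_ : 6%:R * pi / 3 = pi *+ 2); last by rewrite mulr2n; field.
by rewrite cos2pi sin2pi.
Qed.

Let Re_om l : Re (om ^+ (6 * l + 1)%N) = 1 / 2 /\ Re (om ^+ (6 * l + 2)%N) = - (1 / 2) /\
   Re (om ^+ (6 * l + 3)%N) = - 1 /\ Re (om ^+ (6 * l + 4)%N) = - (1 / 2) /\
   Re (om ^+ (6 * l + 5)%N) = 1 / 2 /\ Re (om ^+ (6 * l + 6)%N) = 1.
Proof.
have q := @sqrt3_sq R.
have e j : om ^+ (6 * l + j)%N = om ^+ j by rewrite exprD exprM om6 expr1n mul1r.
have o3 : om ^+ 3 = -1.
  rewrite -cis_omega /cis (_ : 3%:R * pi / 3 = pi); last by field.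
  by rewrite cospi sinpi; apply: complex_eqP; rewrite /= ?oppr0.
rewrite !e om6 o3 expr1 (exprD _ 3 1) (exprD _ 3 2) o3 expr1 !mulN1r !ReN /=.
have -> : 1 / 2 * (1 / 2) - Num.sqrt 3 / 2 * (Num.sqrt 3 / 2) = - (1 / 2) :> R.
  transitivity ((1 - Num.sqrt 3 ^+ 2) / 4 : R); first by field.
  by rewrite q; field.
by rewrite opprK.
Qed.

Let cvg_dominating_index (u : nat -> R) (x : R) (f : nat -> nat) : (forall n, (n <= f n)%N) ->
  u n @[n --> \oo] --> x -> u (f n) @[n --> \oo] --> x.
Proof.
move=> nf; apply: cvg_comp; apply/cvgnyPge => A; near=> n.
by apply: (leq_trans _ (nf n)); near: n; exact: nbhs_infty_ge.
Unshelve. all: by end_near. Qed.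

(** The real part of omega^l is (1 - 2 [2 | l] - 3 [3 | l] + 6 [6 | l]) / 2, with brackets for
    indicators. Each indicator contributes a rescaled partial zeta sum, and a full period of 6 is
    added at a time. *)
Lemma Re_nielsen_omega n :
  Re (nielsen n.+1 0 om) = (1 - 2^-1 ^+ n.+1) * (1 - 3^-1 ^+ n.+1) / 2 * zeta n.+2.
Proof.
have h : csummable (fun l => (ncoef n.+1 0 l)%:C%C * om ^+ l).
  by apply: nielsen_summable; rewrite cabs_omega.
have [h1 _] := csum_cvg h.
set k := n.+2.
have key M : Re (\sum_(l < (6 * M).+1) (ncoef n.+1 0 l)%:C%C * om ^+ l) =
   (zsum k (6 * M)%N - 2 * 2^-1 ^+ k * zsum k (3 * M)%N - 3 * 3^-1 ^+ k * zsum k (2 * M)%N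
     + 6 * 6^-1 ^+ k * zsum k M) / 2.
  elim: M => [|M ih].
    by rewrite !muln0 big_ord_recl big_ord0 ncoef0 mul0r !zsum0 /=; ring.
  have fM (c j : nat) : 1 / (c * j)%:R ^+ k = c%:R^-1 ^+ k * (1 / j%:R ^+ k) :> R.
    by rewrite natrM exprMn invfM mul1r exprVn mul1r.
  have [r1 [r2 [r3 [r4 [r5 r6]]]]] := Re_om M.
  have -> : (6 * M.+1 = (6 * M).+3.+3)%N by rewrite mulnS.
  have -> : (3 * M.+1 = (3 * M).+3)%N by rewrite mulnS.
  have -> : (2 * M.+1 = (2 * M).+2)%N by rewrite mulnS.
  rewrite 6!big_ord_recr !zsumS /= !ReD ih !ReZ !ncoef_p0.
  move: r1 r2 r3 r4 r5 r6; rewrite !addnS addn0 => -> -> -> -> -> ->.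
  rewrite -/k.
  have e6 : ((6 * M).+3.+3 = 6 * M.+1)%N by rewrite mulnS.
  have e63 : ((3 * M).+3 = 3 * M.+1)%N by rewrite mulnS.
  have e62 : ((2 * M).+2 = 2 * M.+1)%N by rewrite mulnS.
  have e4 : ((6 * M).+4 = 2 * (3 * M).+2)%N by rewrite !mulnS mulnA.
  have e3 : ((6 * M).+3 = 3 * (2 * M).+1)%N by rewrite mulnS mulnA.
  have e2 : ((6 * M).+2 = 2 * (3 * M).+1)%N by rewrite mulnS mulnA.
  rewrite e6 e63 e62 e4 e3 e2 !fM.
  have v6 : (6%:R : R)^-1 ^+ k = 2^-1 ^+ k * 3^-1 ^+ k by rewrite -exprMn; congr (_ ^+ _); field.
  rewrite v6.
  move: (2^-1 ^+ k) (3^-1 ^+ k) (1 / _ ^+ k) (1 / _ ^+ k) (1 / _ ^+ k) (1 / _ ^+ k)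
    (1 / _ ^+ k) (1 / _ ^+ k) => x y A B C D E F.
  by field.
have z0 (c : nat) : (0 < c)%N -> zsum k (c * M)%N @[M --> \oo] --> (zeta k : R).
  by move=> c0; apply: (cvg_dominating_index (f := muln c)); [move=> M; rewrite leq_pmull|exact: zsum_cvg].
have z1 : zsum k M @[M --> \oo] --> (zeta k : R) by exact: zsum_cvg.
have h3 : Re (\sum_(l < (6 * M).+1) (ncoef n.+1 0 l)%:C%C * om ^+ l) @[M --> \oo] --> Re (nielsen n.+1 0 om).
  apply: (cvg_dominating_index (u := fun N => Re (\sum_(l < N) (ncoef n.+1 0 l)%:C%C * om ^+ l))
    (f := fun M => (6 * M).+1)) h1 => M.
  by rewrite ltnW// ltnS leq_pmull.
have h4 : Re (\sum_(l < (6 * M).+1) (ncoef n.+1 0 l)%:C%C * om ^+ l) @[M --> \oo] -->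
    (zeta k - 2 * 2^-1 ^+ k * zeta k - 3 * 3^-1 ^+ k * zeta k + 6 * 6^-1 ^+ k * zeta k) / 2.
  under eq_fun do rewrite key.
  apply: cvgM; last exact: cvg_cst.
  apply: cvgD; last exact: cvg_mulc.
  apply: cvgB; last by apply: cvg_mulc; exact: z0.
  by apply: cvgB; [exact: z0|apply: cvg_mulc; exact: z0].
rewrite -(cvg_lim (@Rhausdorff R) h3) (cvg_lim (@Rhausdorff R) h4) /k.
have v6 : (6%:R : R)^-1 ^+ n.+2 = 2^-1 ^+ n.+2 * 3^-1 ^+ n.+2 by rewrite -exprMn; congr (_ ^+ _); field.
by rewrite v6 !(exprS _ n.+1); move: (2^-1 ^+ n.+1) (3^-1 ^+ n.+1) => x y; field.
Qed.

(** The part of the sum of 1 / (i^5 j) over i, j <= N in which i + j > N. *)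
Let E5 N : R := \sum_(i < N) 1 / i.+1%:R ^+ 5 * (zsum 1 N - zsum 1 (N - i.+1)%N).

Let T5 N : R := \sum_(i < N) zsum 1 i / i.+1%:R ^+ 5.

(** A finite form of 2 zeta(5,1) = 5 zeta(6) - 2 zeta(2) zeta(4) - zeta(3)^2 with error term [E5];
    being exact, it can be proved by induction on N. *)
Let euler_finite N : 2 * zsum 2 N * zsum 4 N + zsum 3 N ^+ 2 =
  5 * zsum 6 N - 2 * T5 N - 2 * E5 N.
Proof.
elim: N => [|N ih]; first by rewrite /T5 /E5 !zsum0 !big_ord0; ring.
have step : E5 N.+1 = E5 N + (\sum_(i < N) (1 / i.+1%:R ^+ 5 * (1 / N.+1%:R - 1 / (N - i)%:R)))
    + 1 / N.+1%:R ^+ 5 * zsum 1 N.+1.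
  rewrite /E5 big_ord_recr /= subnn zsum0 subr0; congr (_ + _).
  rewrite -big_split; apply: eq_bigr => i _ /=.
  rewrite subSS !zsumS -(subnSK (ltn_ord i)) zsumS !expr1; ring.
have sums j : zsum j N = \sum_(i < N) 1 / i.+1%:R ^+ j :> R.
  by rewrite /zsum big_add1 big_mkord.
have rev : zsum 1 N = \sum_(i < N) 1 / (N - i)%:R :> R.
  rewrite sums (reindex_inj rev_ord_inj); apply: eq_bigr => i _ /=.
  by rewrite expr1 subnSK.
(* Each summand vanishes by partial fractions in a = N + 1, b = i + 1 and a - b. *)
have cross : 2 * (1 / N.+1%:R ^+ 2) * zsum 4 N + 2 * (1 / N.+1%:R ^+ 4) * zsum 2 N
    + 2 * (1 / N.+1%:R ^+ 3) * zsum 3 N + 2 * (1 / N.+1%:R ^+ 5) * zsum 1 N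
    + 2 * (1 / N.+1%:R ^+ 5) * (\sum_(i < N) 1 / (N - i)%:R)
    + 2 * (\sum_(i < N) (1 / i.+1%:R ^+ 5 * (1 / N.+1%:R - 1 / (N - i)%:R))) = 0 :> R.
  rewrite !sums !mulr_sumr -!big_split big1// => i _ /=.
  have e : (N - i)%:R = N.+1%:R - i.+1%:R :> R by rewrite -natrB ?subSS// ltnS ltnW.
  have i0 : i.+1%:R != 0 :> R by rewrite pnatr_eq0.
  have n0 : N.+1%:R != 0 :> R by rewrite pnatr_eq0.
  have ni : N.+1%:R - i.+1%:R != 0 :> R by rewrite -e pnatr_eq0 subn_eq0 -ltnNge.
  rewrite e; move: (N.+1%:R) (i.+1%:R) n0 i0 ni => a b a0 b0 ab.
  by field; rewrite a0 b0 ab.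
rewrite step [T5 N.+1]/T5 big_ord_recr /= -/(T5 N) !zsumS expr1.
move: ih cross; rewrite -rev; move: (zsum 1 N) (zsum 2 N) (zsum 3 N) (zsum 4 N) (zsum 6 N) (T5 N) (E5 N).
move: (\sum_(i < N) _); have n0 : N.+1%:R != 0 :> R by rewrite pnatr_eq0.
move: (N.+1%:R) n0 => n n0 s z1 z2 z3 z4 z6 t e ih cross.
apply/eqP; rewrite -subr_eq0; apply/eqP.
transitivity ((2 * z2 * z4 + z3 ^+ 2 - (5 * z6 - 2 * t - 2 * e)) +
 (2 * (1 / n ^+ 2) * z4 + 2 * (1 / n ^+ 4) * z2 + 2 * (1 / n ^+ 3) * z3 + 2 * (1 / n ^+ 5) * z1
    + 2 * (1 / n ^+ 5) * z1 + 2 * s)).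
  by field.
by rewrite ih cross subrr addr0.
Qed.

(** The inner harmonic block has i terms of size at most 1 / (N - i + 1), and i (N - i + 1) >= N, so
    each summand is at most 1 / (i^3 N). *)
Let E5_cvg0 : E5 N @[N --> \oo] --> (0 : R).
Proof.
apply: (@cvg_harmonic_bound _ E5 2) => N.
have H m i : zsum 1 (m + i)%N - zsum 1 m <= i%:R / m.+1%:R :> R.
  elim: i => [|i ih]; first by rewrite addn0 subrr mul0r.
  rewrite addnS zsumS addrAC -[i.+1%:R]natr1 mulrDl; apply: lerD => //.
  by rewrite expr1 ler_wpM2l// lef_pV2 ?posrE// ler_nat ltnS leq_addr.
have H0 m i : 0 <= zsum 1 (m + i)%N - zsum 1 m :> R.
  by rewrite subr_ge0 zsum_ndecr// leq_addr.
rewrite ger0_norm; last first.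
  apply: sumr_ge0 => i _; rewrite mulr_ge0 ?divr_ge0 ?exprn_ge0//.
  by rewrite -{1}(subnK (ltn_ord i)) H0.
apply: (@le_trans _ _ (zsum 3 N.+1 / N.+1%:R)); last by rewrite ler_wpM2r ?invr_ge0// zsum_le2.
rewrite /zsum big_add1 big_mkord mulr_suml; apply: ler_sum => i _.
have {}H := H (N.+1 - i.+1)%N i.+1; rewrite subnK ?ltn_ord// in H.
apply: (le_trans (ler_wpM2l _ H)); first by rewrite divr_ge0 ?exprn_ge0.
have i0 : 0 < i.+1%:R :> R by rewrite ltr0n.
have n0 : 0 < N.+1%:R :> R by rewrite ltr0n.
have m0 : 0 < (N.+1 - i.+1).+1%:R :> R by rewrite ltr0n.
have imn : N.+1%:R <= i.+1%:R * (N.+1 - i.+1).+1%:R :> R.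
  rewrite -natrM ler_nat subnSK// -[leqLHS](subnK (ltnW (ltn_ord i))) mulSn leq_add2l.
  by rewrite leq_pmulr// subn_gt0.
move: (i.+1%:R) (N.+1%:R) ((N.+1 - i.+1).+1%:R) i0 n0 m0 imn => a n m a0 n0 m0 h.
rewrite -subr_ge0 (_ : _ - _ = (a * m - n) / (a ^+ 4 * m * n)); last first.
  by field; rewrite !gt_eqF.
by rewrite divr_ge0 ?subr_ge0// !mulr_ge0 ?exprn_ge0 ?ltW.
Qed.

Lemma nielsen1_weight6 : nielsen 4 1 (1 : R[i]) =
  (5 / 2 * zeta 6 - zeta 2 * zeta 4 - zeta 3 ^+ 2 / 2)%:C%C.
Proof.
apply: complex_eqP; last exact: Im_nielsen1.
have h : T5 N @[N --> \oo] --> Re (nielsen 4 1 (1 : R[i])).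
  have h0 : \sum_(l < N) ncoef 4 1 l @[N --> \oo] --> Re (nielsen 4 1 (1 : R[i])).
    exact: nielsen1_cvg.
  have h1 : \sum_(l < N.+1) ncoef 4 1 l @[N --> \oo] --> Re (nielsen 4 1 (1 : R[i])).
    by rewrite (cvg_shiftS (fun N => \sum_(l < N) ncoef 4 1 l)).
  apply: cvg_trans h1; apply: near_eq_cvg; apply: nearW => N.
  rewrite big_ord_recl ncoef0 add0r; apply: eq_bigr => i _.
  rewrite /ncoef lift0 /esum [nested_sum _ _]/=; congr (_ / _).
  by rewrite /zsum; apply: eq_bigr => j _; rewrite mulr1.
have h' : T5 N @[N --> \oo] --> 5 / 2 * zeta 6 - zeta 2 * zeta 4 - zeta 3 ^+ 2 / 2 - 0.
  have -> : T5 = fun N => 5 / 2 * zsum 6 N - zsum 2 N * zsum 4 N - zsum 3 N * zsum 3 N / 2 - E5 N.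
    by apply/funext => N; have := euler_finite N; rewrite expr2; lra.
  apply: cvgB => //; rewrite expr2; apply: cvgB; first apply: cvgB.
  - by apply: cvg_mulc; exact: zsum_cvg.
  - by apply: cvgM; exact: zsum_cvg.
  - by apply: cvgM; [apply: cvgM; exact: zsum_cvg|exact: cvg_cst].
rewrite subr0 in h'.
exact: etrans (esym (cvg_lim (@Rhausdorff R) h)) (cvg_lim (@Rhausdorff R) h').
Qed.

End NielsenValues.

(** * Moments of ln (2 sin (t/2)) and t, and polylogarithms in terms of them *)

Section LogSineMoments.
Context {R : realType}.
Implicit Types (z w : R[i]) (n p m a b i j k : nat) (t : R).
Local Notation Re := (@complex.Re R).
Local Notation Im := (@complex.Im R).
Local Notation om := (@omega R).

Lemma cJint_ext (g h : R -> R[i]) z : (forall t, 0 < t < pi / 3 -> g t = h t) ->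
  cJint g z -> cJint h z.
Proof. by move=> gh [h1 h2]; split; [apply: Jint_ext h1|apply: Jint_ext h2] => t /gh ->. Qed.

Lemma cJintD (g h : R -> R[i]) z w : cJint g z -> cJint h w -> cJint (fun t => g t + h t) (z + w).
Proof.
move=> [g1 g2] [h1 h2]; split.
  by rewrite ReD; apply: Jint_ext (JintD g1 h1) => t _; rewrite ReD.
by rewrite ImD; apply: Jint_ext (JintD g2 h2) => t _; rewrite ImD.
Qed.

Lemma cJintZ c (g : R -> R[i]) z : cJint g z -> cJint (fun t => c * g t) (c * z).
Proof.
move=> [g1 g2]; split.
  by rewrite ReM; apply: Jint_ext (JintB (JintZ (Re c) g1) (JintZ (Im c) g2)) => t _; rewrite ReM.
by rewrite ImM; apply: Jint_ext (JintD (JintZ (Re c) g2) (JintZ (Im c) g1)) => t _; rewrite ImM.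
Qed.

Lemma cJint_sum n (g : nat -> R -> R[i]) (z : nat -> R[i]) :
  (forall i, (i < n)%N -> cJint (g i) (z i)) ->
  cJint (fun t => \sum_(i < n) g i t) (\sum_(i < n) z i).
Proof.
elim: n => [|n ih] H.
  rewrite big_ord0; have h := Jint_cst (0 : R); rewrite mul0r in h.
  by split; apply: Jint_ext h => t _; rewrite big_ord0.
rewrite big_ord_recr/=.
apply: (@cJint_ext (fun t => \sum_(i < n) g i t + g n t)).
  by move=> t _; rewrite big_ord_recr.
by apply: cJintD; [apply: ih => i ilt; apply: H; exact: ltnW|exact: H].
Qed.

Lemma cJint_uniq (g : R -> R[i]) z w : cJint g z -> cJint g w -> z = w.
Proof. by move=> [g1 g2] [h1 h2]; apply: complex_eqP; [exact: Jint_uniq g1 h1|exact: Jint_uniq g2 h2]. Qed.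

Lemma cJint_real (g : R -> R) v : Jint g v -> cJint (fun t => (g t)%:C%C) v%:C%C.
Proof.
move=> h; split => //=; have h0 := Jint_cst (0 : R); rewrite mul0r in h0.
exact: h0.
Qed.

Definition lnsin t : R := 1 / 2 * ln (ysin t).

(* The coefficients of the expansion of (-(l + i (q - t/2)))^m / m! * i (i t)^p / p! in
   powers of [l] and [t]. *)
Definition wcoef (q : R) m p i j : R :=
  (-1) ^+ (m - i) / (m - i)`!%:R * ((2^-1) ^+ (i - j) / (i - j)`!%:R * ((- q) ^+ j / j`!%:R)) / p`!%:R.

(** Taking for M either the functions l^j t^k at a point t or their integrals makes the same sum
    describe an integrand and its value. *)
Definition wterm (q : R) (M : nat -> nat -> R) m p i j : R :=
  wcoef q m p i j * M (m - i)%N (i - j + p)%N.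

Definition wsum (q : R) (M : nat -> nat -> R) m p : R[i] :=
  \sum_(i < m.+1) \sum_(j < i.+1) 'i%C ^+ (i + p.+1) * (wterm q M m p i j)%:C%C.

Let divpow_add (F : numFieldType) (x y : F) m :
  (x + y) ^+ m / m`!%:R = \sum_(i < m.+1) x ^+ (m - i) / (m - i)`!%:R * (y ^+ i / i`!%:R).
Proof.
have f0 k : k`!%:R != 0 :> F by rewrite pnatr_eq0 -lt0n fact_gt0.
rewrite exprDn mulr_suml; apply: eq_bigr => i _.
have im : (i <= m)%N by rewrite -ltnS.
have e : 'C(m, i)%:R * (i`!%:R * (m - i)`!%:R) = m`!%:R :> F by rewrite -!natrM bin_fact.
rewrite -mulr_natr -e; have b0 : 'C(m, i)%:R != 0 :> F by rewrite pnatr_eq0 -lt0n bin_gt0.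
by move: (f0 i) (f0 (m - i)%N) b0; move: (i`!%:R) ((m - i)`!%:R) ('C(m, i)%:R) => A B C A0 B0 C0; field; rewrite A0 B0.
Qed.

Let imagX t k : imag t ^+ k = 'i%C ^+ k * (t ^+ k)%:C%C.
Proof.
rewrite (_ : imag t = 'i%C * t%:C%C); last by apply: complex_eqP; rewrite ?ReM ?ImM /=; ring.
by rewrite exprMn rmorphXn.
Qed.

Lemma wsum_expand c m p t :
  (- (arclog t + imag c)) ^+ m / m`!%:R * ('i%C * (imag t ^+ p / p`!%:R)) =
  wsum (c + pi / 6) (fun j k => lnsin t ^+ j * t ^+ k) m p.
Proof.
set q := c + pi / 6.
have -> : - (arclog t + imag c) = (- lnsin t)%:C%C + imag (t / 2 - q).
  by rewrite /arclog /lnsin /q /imag; apply: complex_eqP; rewrite ?ReN ?ImN ?ReD ?ImD /=; ring.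
rewrite divpow_add mulr_suml; apply: eq_bigr => i _.
rewrite (imagX t p) (imagX (t / 2 - q) i).
have -> : 'i%C ^+ i * ((t / 2 - q) ^+ i)%:C%C / i`!%:R = 'i%C ^+ i * ((t / 2 - q) ^+ i / i`!%:R)%:C%C.
  by rewrite rmorphM fmorphV rmorph_nat; ring.
rewrite divpow_add rmorph_sum mulr_sumr mulr_sumr mulr_suml; apply: eq_bigr => j _.
rewrite -rmorphXn /wterm /wcoef -!(rmorph_nat (real_complex R)) -!fmorphV.
rewrite [LHS](_ : _ = 'i%C ^+ (i + p.+1) * (((- lnsin t) ^+ (m - i))%:C%C * ((m - i)`!%:R^-1)%:C%C *
  ((t / 2) ^+ (i - j) / (i - j)`!%:R * ((- q) ^+ j / j`!%:R))%:C%C * (t ^+ p)%:C%C * (p`!%:R^-1)%:C%C)); last first.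
  by rewrite exprD exprS; ring.
rewrite -!rmorphM; congr (_ * real_complex R _).
rewrite (exprNn (lnsin t)) (exprMn (i - j)%N t) (exprD t).
move: ((m - i)`!%:R^-1) ((i - j)`!%:R^-1) (j`!%:R^-1) (p`!%:R^-1) => A B C D.
move: ((-1) ^+ _) (lnsin t ^+ _) (t ^+ _) (2^-1 ^+ _) ((- q) ^+ j) (t ^+ p) => a b x y z w.
by rewrite -!mulrA; ring.
Qed.

Let Jint_pow k : Jint (fun t => t ^+ k) ((pi / 3) ^+ k.+1 / k.+1%:R).
Proof.
exists (fun t => t ^+ k.+1 / k.+1%:R).
have dP t : is_derive t 1 (fun t => t ^+ k.+1 / k.+1%:R) (t ^+ k).
  apply: (is_derive_eq (derivM (derivX k.+1 (deriv_id t)) (derivC (k.+1%:R)^-1 t))).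
  by rewrite /= mulr0 addr0 mulr1 mulrAC mulfV ?mul1r// pnatr_eq0.
split=> //.
- apply: cvg_at_right_filter; have h := derivable_cvg (dP 0).
  by apply: (cvg_eq _ h); rewrite expr0n mul0r.
- by apply: cvg_at_left_filter; exact: derivable_cvg (dP (pi / 3)).
Qed.

(* In [Jint_nielsen] the coefficient of the highest power of [lnsin] does not vanish. *)
Lemma moment_exists j k : exists v, Jint (fun t => lnsin t ^+ j * t ^+ k) v.
Proof.
have [n jn] : exists n, (j < n)%N by exists j.+1.
elim: n j k jn => // n ih j k; rewrite ltnS leq_eqVlt => /orP[/eqP {j}->|]; last exact: ih.
case: n ih => [|n] ih.
  exists ((pi / 3) ^+ k.+1 / k.+1%:R).
  by apply: Jint_ext (Jint_pow k) => t _; rewrite expr0 mul1r.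
have ex i j0 : exists v : R, (i < n.+1)%N -> Jint (fun t => lnsin t ^+ i * t ^+ j0) v.
  have [h|h] := boolP (i < n.+1)%N; last by exists 0.
  by have [v hv] := ih i j0 h; exists v.
pose M i j0 : R := sval (cid (ex i j0)).
have MP i j0 : (i < n.+1)%N -> Jint (fun t => lnsin t ^+ i * t ^+ j0) (M i j0) := svalP (cid (ex i j0)).
have [z J] : exists z, cJint (fun t => wsum (0 + pi / 6) (fun j k => lnsin t ^+ j * t ^+ k) n.+1 k) z.
  by eexists; apply: cJint_ext (Jint_nielsen 0 n k) => t _; rewrite wsum_expand.
set K : R[i] := 'i%C ^+ (0 + k.+1) * (wcoef (0 + pi / 6) n.+1 k 0 0)%:C%C.
have K0 : K != 0.
  rewrite mulf_neq0//; first by rewrite expf_neq0// neq0Ci.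
  rewrite fmorph_eq0 /wcoef !subn0 !expr0 fact0 !divr1 !mulr1.
  by rewrite !mulf_neq0 ?invr_neq0 ?expf_neq0 ?oppr_eq0 ?oner_eq0// pnatr_eq0 -lt0n fact_gt0.
pose rest (N : nat -> nat -> R) := \sum_(i < n.+1) \sum_(j < i.+2)
  'i%C ^+ (i.+1 + k.+1) * (wterm (0 + pi / 6) N n.+1 k i.+1 j)%:C%C.
have split_w N : wsum (0 + pi / 6) N n.+1 k = K * (N n.+1 k)%:C%C + rest N.
  rewrite /wsum big_ord_recl; congr (_ + _).
  rewrite big_ord_recl big_ord0 addr0 /= /wterm !subn0 add0n.
  by rewrite /K (rmorphM (real_complex R)) mulrA.
have Jrest : cJint (fun t => rest (fun j k => lnsin t ^+ j * t ^+ k)) (rest M).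
  apply: (cJint_sum (g := fun i t => \sum_(j < i.+2) 'i%C ^+ (i.+1 + k.+1) *
     (wterm (0 + pi / 6) (fun j k => lnsin t ^+ j * t ^+ k) n.+1 k i.+1 j)%:C%C)
    (z := fun i => \sum_(j < i.+2) 'i%C ^+ (i.+1 + k.+1) * (wterm (0 + pi / 6) M n.+1 k i.+1 j)%:C%C)) => i ilt.
  apply: (cJint_sum (g := fun j t => 'i%C ^+ (i.+1 + k.+1) *
     (wterm (0 + pi / 6) (fun j k => lnsin t ^+ j * t ^+ k) n.+1 k i.+1 j)%:C%C)
    (z := fun j => 'i%C ^+ (i.+1 + k.+1) * (wterm (0 + pi / 6) M n.+1 k i.+1 j)%:C%C)) => j _.
  apply: cJintZ; apply: cJint_real; apply: JintZ; apply: MP.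
  by rewrite subSS ltnS leq_subr.
exists (Re (K^-1 * (z + -1 * rest M))).
have [h _] := cJintZ K^-1 (cJintD J (cJintZ (-1) Jrest)).
apply: Jint_ext h => t _.
by rewrite split_w mulN1r addrK mulKf.
Qed.

Definition moment j k : R := sval (cid (moment_exists j k)).

Lemma Jint_moment j k : Jint (fun t => lnsin t ^+ j * t ^+ k) (moment j k).
Proof. exact: svalP (cid (moment_exists j k)). Qed.

Lemma moment0 k : moment 0 k = (pi / 3) ^+ k.+1 / k.+1%:R.
Proof.
apply: Jint_uniq (Jint_moment 0 k) _.
by apply: Jint_ext (Jint_pow k) => t _; rewrite expr0 mul1r.
Qed.

Lemma cJint_wsum q m p :
  cJint (fun t => wsum q (fun j k => lnsin t ^+ j * t ^+ k) m p) (wsum q moment m p).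
Proof.
apply: (cJint_sum (g := fun i t => \sum_(j < i.+1) 'i%C ^+ (i + p.+1) *
     (wterm q (fun j k => lnsin t ^+ j * t ^+ k) m p i j)%:C%C)
    (z := fun i => \sum_(j < i.+1) 'i%C ^+ (i + p.+1) * (wterm q moment m p i j)%:C%C)) => i _.
apply: (cJint_sum (g := fun j t => 'i%C ^+ (i + p.+1) *
     (wterm q (fun j k => lnsin t ^+ j * t ^+ k) m p i j)%:C%C)
    (z := fun j => 'i%C ^+ (i + p.+1) * (wterm q moment m p i j)%:C%C)) => j _.
by apply: cJintZ; apply: cJint_real; apply: JintZ; exact: Jint_moment.
Qed.

Let wsum_tele c n p : wsum (c + pi / 6) moment n.+1 p =
  (-1) ^+ n * tele (imag c) (fun k => nielsen k p om) n.+1 +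
  (- imag c) ^+ n.+1 / n.+1`!%:R * (imag (pi / 3) ^+ p.+1 / p.+1`!%:R).
Proof.
apply: cJint_uniq (cJint_wsum _ _ _) _.
by apply: cJint_ext (Jint_nielsen c n p) => t _; exact: wsum_expand.
Qed.

Lemma nielsen_moment n p : nielsen n.+1 p om = wsum (pi / 6) moment n.+1 p.
Proof.
have := wsum_tele 0 n p; rewrite add0r => ->.
have -> : imag 0 = 0 :> R[i] by [].
rewrite tele0 oppr0 expr0n !mul0r addr0 mulrA -exprD addnn -mul2n exprM.
by rewrite sqrrN expr1n expr1n mul1r.
Qed.

(** The choice c = pi/3 turns [arclog] plus i c into the logarithm of w itself, whence q = pi/2.
    Conjugation carries omega to conj omega and i pi/3 to its negative, so the two [tele] sums are
    exactly those of [nielsen_inversion] and are replaced by a value at 1. *)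
Lemma moment_inversion a b :
  wsum (pi / 2) moment a.+1 b + (wsum (pi / 2) moment b.+1 a)^*%C =
  nielsen b.+1 a (1 : R[i]) +
  (- imag (pi / 3)) ^+ a.+1 / a.+1`!%:R * (imag (pi / 3) ^+ b.+1 / b.+1`!%:R).
Proof.
have q : pi / 2 = pi / 3 + pi / 6 :> R by field.
rewrite q !wsum_tele; set X := imag (pi / 3).
have inv := @nielsen_inversion R a b; rewrite -/X in inv.
have cX : X^*%C = - X by apply: complex_eqP; rewrite ?ReN ?ImN /= ?oppr0.
have cdiv (z : R[i]) n k : (z ^+ n / k%:R)^*%C = z^*%C ^+ n / k%:R.
  by rewrite (rmorphM (@conjc R)) (rmorphXn (@conjc R)) (fmorphV (@conjc R)) (rmorph_nat (@conjc R)).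
have cM (z w : R[i]) : (z * w)^*%C = z^*%C * w^*%C by exact: (rmorphM (@conjc R)).
have cB (z w : R[i]) : (z - w)^*%C = z^*%C - w^*%C by exact: (rmorphB (@conjc R)).
have ctele x (L : nat -> R[i]) m : (tele x L m)^*%C = tele x^*%C (fun k => (L k)^*%C) m.
  elim: m L => [|m ih] L; first by rewrite /= oppr0.
  change ((x ^+ m / m`!%:R * L 1 - tele x (fun k => L k.+1) m)^*%C =
    x^*%C ^+ m / m`!%:R * (L 1)^*%C - tele x^*%C (fun k => (L k.+1)^*%C) m).
  by rewrite cB cM cdiv ih.
have cN k (z : R[i]) : ((-1) ^+ k * z)^*%C = (-1) ^+ k * z^*%C.
  by rewrite (rmorphM (@conjc R)) (rmorphXn (@conjc R)) (rmorphN1 (@conjc R)).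
have cD (z w : R[i]) : (z + w)^*%C = z^*%C + w^*%C by exact: (rmorphD (@conjc R)).
have cXN : (- X)^*%C = X by rewrite -cX; case: X {inv cX} => u v; rewrite /= opprK.
rewrite cD cN cM !cdiv ctele cX cXN.
rewrite (@tele_ext _ (- X) (fun k => (nielsen k a om)^*%C) (fun k => nielsen k a om^*%C)); last first.
  by move=> k; rewrite nielsen_conj// cabs_omega.
move: inv; move: (tele X _ _) (tele (- X) _ _) (nielsen _ _ _) => T1 T2 S.
rewrite !(exprNn X) !exprS !mulN1r.
have s1 : (-1) ^+ a * (-1) ^+ a = 1 :> R[i].
  by rewrite -exprD addnn -mul2n exprM sqrrN expr1n expr1n.
have s2 : (-1) ^+ b * (-1) ^+ b = 1 :> R[i].
  by rewrite -exprD addnn -mul2n exprM sqrrN expr1n expr1n.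
move: ((-1) ^+ a) ((-1) ^+ b) s1 s2 (a.+1`!%:R^-1) (b.+1`!%:R^-1) (X ^+ a) (X ^+ b) => e f s1 s2 A B x y inv.
apply/eqP; rewrite -subr_eq0; apply/eqP.
transitivity (- (e * f) * ((- f * T1 + - e * T2 - X * x * A * (- f * (X * y) * B)) - - e * (f * S))
  + (1 - f * f) * (e * T1 - e * (X * x * A * (X * y * B))) + (1 - e * e) * f * T2 + (e * e * (f * f) - 1) * S).
  ring.
by rewrite inv s1 s2; ring.
Qed.

End LogSineMoments.

(** * Real and imaginary parts of the relations in computable form *)

Section MomentRelations.
Context {R : realType}.
Implicit Types (M : nat -> nat -> R) (P S q : R) (f : nat -> R) (n p m a b i j k : nat).
Local Notation Re := (@complex.Re R).
Local Notation Im := (@complex.Im R).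

(* Variants of the sums, factorials and powers of the imaginary unit of [wsum]
   that reduce to plain arithmetic expressions on numerals. *)
Fixpoint nsum n f : R := if n is n'.+1 then nsum n' f + f n' else 0.

Fixpoint rfact n : R := if n is n'.+1 then n%:R * rfact n' else 1.

Fixpoint ire k : R := match k with 0 => 1 | 1 => 0 | k'.+2 => - ire k' end.

Fixpoint iim k : R := match k with 0 => 0 | 1 => 1 | k'.+2 => - iim k' end.

Definition rterm q M m p i j : R :=
  (-1) ^+ (m - i) / rfact (m - i) * ((2^-1) ^+ (i - j) / rfact (i - j) * ((- q) ^+ j / rfact j)) / rfact p
   * M (m - i)%N (i - j + p)%N.

Definition wre q M m p : R :=
  nsum m.+1 (fun i => ire (i + p.+1) * nsum i.+1 (rterm q M m p i)).

Definition wim q M m p : R :=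
  nsum m.+1 (fun i => iim (i + p.+1) * nsum i.+1 (rterm q M m p i)).

(* The real and imaginary parts of [moment_inversion], and the distribution relation,
   as expressions that vanish when [P = pi] and [M = moment]. *)
Definition inv_re P S M a b : R :=
  wre (P / 2) M a.+1 b + wre (P / 2) M b.+1 a - S
  - (-1) ^+ a.+1 * ire (a.+1 + b.+1) * (P / 3) ^+ (a.+1 + b.+1) / rfact a.+1 / rfact b.+1.

Definition inv_im P M a b : R :=
  wim (P / 2) M a.+1 b - wim (P / 2) M b.+1 a
  - (-1) ^+ a.+1 * iim (a.+1 + b.+1) * (P / 3) ^+ (a.+1 + b.+1) / rfact a.+1 / rfact b.+1.

Definition dist P Z M n : R :=
  wre (P / 6) M n.+1 0 - (1 - 2^-1 ^+ n.+1) * (1 - 3^-1 ^+ n.+1) / 2 * Z.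

Lemma nsumE n f : nsum n f = \sum_(i < n) f i.
Proof. by elim: n => [|n ih]; rewrite ?big_ord0// big_ord_recr /= ih. Qed.

Lemma rfactE n : rfact n = n`!%:R.
Proof. by elim: n => [//|n ih]; rewrite factS natrM -ih. Qed.

Lemma expCi k : 'i%C ^+ k = Complex (ire k) (iim k).
Proof.
suff [h _] : 'i%C ^+ k = Complex (ire k) (iim k) /\ 'i%C ^+ k.+1 = Complex (ire k.+1) (iim k.+1) by [].
elim: k => [|k [h1 h2]]; first by rewrite expr0 expr1.
split=> //; rewrite !exprS h1; apply: complex_eqP; rewrite !(ReM, ImM) /=; ring.
Qed.

Lemma wsumE q M m p : wsum q M m p = Complex (wre q M m p) (wim q M m p).
Proof.
have reS (n : nat) (F : 'I_n -> R[i]) : Re (\sum_(i < n) F i) = \sum_(i < n) Re (F i).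
  exact: (big_morph Re (@ReD R)).
have imS (n : nat) (F : 'I_n -> R[i]) : Im (\sum_(i < n) F i) = \sum_(i < n) Im (F i).
  exact: (big_morph Im (@ImD R)).
apply: complex_eqP.
  rewrite reS [RHS]nsumE; apply: eq_bigr => i _; rewrite reS nsumE mulr_sumr; apply: eq_bigr => j _.
  by rewrite expCi /wterm /rterm /wcoef !rfactE ReM /= mulr0 subr0.
rewrite imS [RHS]nsumE; apply: eq_bigr => i _; rewrite imS nsumE mulr_sumr; apply: eq_bigr => j _.
by rewrite expCi /wterm /rterm /wcoef !rfactE ImM /= mulr0 add0r.
Qed.

Lemma inversion_moment a b :
  wsum (pi / 2) moment a.+1 b + (wsum (pi / 2) moment b.+1 a)^*%C - nielsen b.+1 a (1 : R[i])
  - ((-1) ^+ a.+1 * (pi / 3) ^+ (a.+1 + b.+1) / rfact a.+1 / rfact b.+1)%:C%C *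
    Complex (ire (a.+1 + b.+1)) (iim (a.+1 + b.+1)) = 0.
Proof.
rewrite moment_inversion (addrC (nielsen _ _ _)) addrK; apply/eqP; rewrite subr_eq0; apply/eqP.
rewrite (exprNn (imag _)) !rfactE -expCi (exprD (pi / 3)) (exprD 'i%C).
have imX k : imag (pi / 3) ^+ k = 'i%C ^+ k * ((pi / 3) ^+ k)%:C%C.
  rewrite (_ : imag _ = 'i%C * (pi / 3)%:C%C); last by apply: complex_eqP; rewrite ?ReM ?ImM /=; ring.
  by rewrite exprMn rmorphXn.
rewrite !imX -!(rmorph_nat (real_complex R)) -!(fmorphV (real_complex R)).
rewrite -(rmorphN1 (real_complex R)) -(rmorphXn (real_complex R)).
move: ((-1) ^+ _) ((pi / 3) ^+ _) ((pi / 3) ^+ _) (_`!%:R^-1) (_`!%:R^-1) ('i%C ^+ _) ('i%C ^+ _).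
move=> e x y A B u v; rewrite !(rmorphM (real_complex R)); ring.
Qed.

Lemma inv_re_moment a b : inv_re pi (Re (nielsen b.+1 a (1 : R[i]))) moment a b = 0.
Proof.
have := congr1 Re (inversion_moment a b); rewrite !wsumE /inv_re.
move: (nielsen b.+1 a _) => z.
move: (ire (a.+1 + b.+1)) (iim (a.+1 + b.+1)) ((-1) ^+ a.+1) ((pi / 3) ^+ _) (rfact a.+1) (rfact b.+1).
move: (wre (pi / 2) moment a.+1 b) (wim (pi / 2) moment a.+1 b)
  (wre (pi / 2) moment b.+1 a) (wim (pi / 2) moment b.+1 a) => u v u' v' c d e x r r'.
by rewrite !(ReD, ReN) ReM /= => h; rewrite -[RHS]h; ring.
Qed.

Lemma inv_im_moment a b : inv_im pi moment a b = 0.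
Proof.
have := congr1 Im (inversion_moment a b); rewrite !wsumE /inv_im.
have := @Im_nielsen1 R b.+1 a; move: (nielsen b.+1 a _) => z z0.
move: (ire (a.+1 + b.+1)) (iim (a.+1 + b.+1)) ((-1) ^+ a.+1) ((pi / 3) ^+ _) (rfact a.+1) (rfact b.+1).
move: (wre (pi / 2) moment a.+1 b) (wim (pi / 2) moment a.+1 b)
  (wre (pi / 2) moment b.+1 a) (wim (pi / 2) moment b.+1 a) => u v u' v' c d e x r r'.
by rewrite !(ImD, ImN) ImM z0 /= => h; rewrite -[RHS]h; ring.
Qed.

Lemma dist_moment n : dist pi (zeta n.+2) moment n = 0.
Proof.
have := @Re_nielsen_omega R n; rewrite nielsen_moment wsumE [Re (Complex _ _)]/= => h.
by rewrite /dist h subrr.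
Qed.

Lemma Im_mu_moment n p : Im (mu n.+2 (nseq p 1%N)) = wim (pi / 6) moment n.+1 p.
Proof. by rewrite mu_nielsen nielsen_moment wsumE. Qed.

Lemma Re_nielsen1_zeta n : Re (nielsen n.+1 0 (1 : R[i])) = zeta n.+2.
Proof. by rewrite nielsen1_zeta. Qed.

End MomentRelations.

(** * Polynomial certificates for the evaluations *)

Section MomentCertificates.
Context {R : realType}.
Implicit Types (j k n : nat).
Variables (P z3 z5 z7 : R) (N : nat -> nat -> R).

(** Here P plays the role of pi. Only the moments without logarithm are explicit; the others are
    free unknowns, so the statements below are polynomial identities in P, the zeta values and N. *)
Definition moment_fun j k : R := if j is 0 then (P / 3) ^+ k.+1 / k.+1%:R else N j k.

Local Notation M := moment_fun.

(** For L = [moment] and the true zeta values this is n! times the integral that gives A_{1,n} up to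
    sqrt 3. The powers of 2 arise from ln y = 2 ln (2 sin (t/2)). *)
Definition lnpow_moment z2 y3 z4 y5 z6 y7 (L : nat -> nat -> R) n : R :=
  rfact n * nsum n.+1 (fun i => cval z2 y3 z4 y5 z6 y7 (n - i) * (2 ^+ i / rfact i) * L i 0).

Ltac unfold_moments :=
  cbv beta iota zeta delta [lnpow_moment cval nth inv_re inv_im dist wre wim nsum rterm rfact ire iim
    moment_fun subn addn Nat.sub Nat.add].

(** Each relation is expanded once into the unknown moments, so that a certificate only has to
    combine these linear forms. *)
Lemma inv_im01 : inv_im P M 0 1 =
  - (N 2 0 / 2) + 7 / 216 * P ^+ 3.
Proof. by unfold_moments; field. Qed.

Lemma inv_im02 : inv_im P M 0 2 =
  - (N 1 0 * P ^+ 2 / 8) + N 1 1 * P / 4 + 3 / 8 * N 1 2 + N 3 0 / 6.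
Proof. by unfold_moments; field. Qed.

Lemma inv_im03 : inv_im P M 0 3 =
  N 2 0 * P ^+ 2 / 16 - N 2 1 * P / 8 + N 2 2 / 16 - N 4 0 / 24 - 73 / (2 ^+ 7 * 3 ^+ 5 * 5) * P
  ^+ 5.
Proof. by unfold_moments; field. Qed.

Lemma inv_im04 : inv_im P M 0 4 =
  N 1 0 * P ^+ 4 / 384 - N 1 1 * P ^+ 3 / 96 + N 1 2 * P ^+ 2 / 64 - N 1 3 * P / 96 - 5 / 128 *
  N 1 4 - N 3 0 * P ^+ 2 / 48 + N 3 1 * P / 24 - N 3 2 / 48 + N 5 0 / 120.
Proof. by unfold_moments; field. Qed.

Lemma inv_im05 : inv_im P M 0 5 =
  - (N 2 0 * P ^+ 4 / 768) + N 2 1 * P ^+ 3 / 192 - N 2 2 * P ^+ 2 / 128 + N 2 3 * P / 192 - N 2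
  4 / 768 + N 4 0 * P ^+ 2 / 192 - N 4 1 * P / 96 + N 4 2 / 192 - N 6 0 / 720 + 697 / (2 ^+ 10 *
  3 ^+ 8 * 5 * 7) * P ^+ 7.
Proof. by unfold_moments; field. Qed.

Lemma inv_im06 : inv_im P M 0 6 =
  - (N 1 0 * P ^+ 6 / (2 ^+ 10 * 3 ^+ 2 * 5)) + N 1 1 * P ^+ 5 / (2 ^+ 9 * 3 * 5) - N 1 2 * P ^+
  4 / (2 ^+ 10 * 3) + N 1 3 * P ^+ 3 / (2 ^+ 8 * 3 ^+ 2) - N 1 4 * P ^+ 2 / (2 ^+ 10 * 3) + N 1
  5 * P / (2 ^+ 9 * 3 * 5) + 7 / (2 ^+ 10 * 5) * N 1 6 + N 3 0 * P ^+ 4 / (2 ^+ 8 * 3 ^+ 2) - N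
  3 1 * P ^+ 3 / 576 + N 3 2 * P ^+ 2 / 384 - N 3 3 * P / 576 + N 3 4 / (2 ^+ 8 * 3 ^+ 2) - N 5
  0 * P ^+ 2 / 960 + N 5 1 * P / 480 - N 5 2 / 960 + N 7 0 / (2 ^+ 4 * 3 ^+ 2 * 5 * 7).
Proof. by unfold_moments; field. Qed.

Lemma inv_im13 : inv_im P M 1 3 =
  - (N 1 1 * P ^+ 3 / 48) + N 1 2 * P ^+ 2 / 16 + N 1 3 * P / 48 - N 1 4 / 16 + N 3 1 * P / 12 -
  N 3 2 / 12.
Proof. by unfold_moments; field. Qed.

Lemma inv_im14 : inv_im P M 1 4 =
  N 2 1 * P ^+ 3 / 96 - N 2 2 * P ^+ 2 / 32 + N 2 3 * P / 32 + N 2 4 / 96 - N 4 1 * P / 48 + N 4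
  2 / 48 - 577 / (2 ^+ 9 * 3 ^+ 8 * 5 * 7) * P ^+ 7.
Proof. by unfold_moments; field. Qed.

Lemma inv_im15 : inv_im P M 1 5 =
  N 1 1 * P ^+ 5 / (2 ^+ 8 * 3 * 5) - N 1 2 * P ^+ 4 / 768 + N 1 3 * P ^+ 3 / 384 - N 1 4 * P ^+
  2 / 384 - 11 / (2 ^+ 8 * 3 * 5) * N 1 5 * P + N 1 6 / 256 - N 3 1 * P ^+ 3 / 288 + N 3 2 * P
  ^+ 2 / 96 - N 3 3 * P / 96 + N 3 4 / 288 + N 5 1 * P / 240 - N 5 2 / 240.
Proof. by unfold_moments; field. Qed.

Lemma inv_im24 : inv_im P M 2 4 =
  - (N 1 2 * P ^+ 4 / 768) + N 1 3 * P ^+ 3 / 192 - N 1 4 * P ^+ 2 / 384 - N 1 5 * P / 192 + N 1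
  6 / 256 + N 3 2 * P ^+ 2 / 96 - N 3 3 * P / 48 + N 3 4 / 288 - N 5 2 / 240.
Proof. by unfold_moments; field. Qed.

Lemma inv_re02 S : inv_re P S M 0 2 =
  N 2 0 * P / 4 - N 2 1 / 4 - 23 / (2 ^+ 6 * 3 ^+ 4) * P ^+ 4 - S.
Proof. by unfold_moments; field. Qed.

Lemma inv_re03 S : inv_re P S M 0 3 =
  N 1 0 * P ^+ 3 / 48 - N 1 1 * P ^+ 2 / 16 + N 1 2 * P / 16 - 3 / 16 * N 1 3 - N 3 0 * P / 12 +
  N 3 1 / 12 - S.
Proof. by unfold_moments; field. Qed.

Lemma inv_re04 S : inv_re P S M 0 4 =
  - (N 2 0 * P ^+ 3 / 96) + N 2 1 * P ^+ 2 / 32 - N 2 2 * P / 32 + N 2 3 / 96 + N 4 0 * P / 48 -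
  N 4 1 / 48 + 227 / (2 ^+ 9 * 3 ^+ 7 * 5) * P ^+ 6 - S.
Proof. by unfold_moments; field. Qed.

Lemma inv_re05 S : inv_re P S M 0 5 =
  - (N 1 0 * P ^+ 5 / (2 ^+ 8 * 3 * 5)) + N 1 1 * P ^+ 4 / 768 - N 1 2 * P ^+ 3 / 384 + N 1 3 *
  P ^+ 2 / 384 - N 1 4 * P / 768 + 11 / (2 ^+ 8 * 5) * N 1 5 + N 3 0 * P ^+ 3 / 288 - N 3 1 * P
  ^+ 2 / 96 + N 3 2 * P / 96 - N 3 3 / 288 - N 5 0 * P / 240 + N 5 1 / 240 - S.
Proof. by unfold_moments; field. Qed.

Lemma inv_re13 S : inv_re P S M 1 3 =
  N 2 1 * P ^+ 2 / 16 - N 2 2 * P / 8 + 7 / 48 * N 2 3 - N 4 1 / 24 - 35 / (2 ^+ 8 * 3 ^+ 7) * P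
  ^+ 6 - S.
Proof. by unfold_moments; field. Qed.

Lemma dist0 Z : dist P Z M 0 =
  P ^+ 2 / 36 - 1 / 6 * Z.
Proof. by unfold_moments; field. Qed.

Lemma dist1 Z : dist P Z M 1 =
  - (N 1 0 * P / 6) + N 1 1 / 2 - 1 / 3 * Z.
Proof. by unfold_moments; field. Qed.

Lemma dist2 Z : dist P Z M 2 =
  N 2 0 * P / 12 - N 2 1 / 4 - P ^+ 4 / (2 ^+ 6 * 3 ^+ 5) - 91 / 216 * Z.
Proof. by unfold_moments; field. Qed.

Lemma dist4 Z : dist P Z M 4 =
  - (N 2 0 * P ^+ 3 / (2 ^+ 5 * 3 ^+ 4)) + N 2 1 * P ^+ 2 / 288 - N 2 2 * P / 96 + N 2 3 / 96 +
  N 4 0 * P / 144 - N 4 1 / 48 + P ^+ 6 / (2 ^+ 9 * 3 ^+ 8 * 5) - 3751 / 7776 * Z.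
Proof. by unfold_moments; field. Qed.

Lemma dist5 Z : dist P Z M 5 =
  - (N 1 0 * P ^+ 5 / (2 ^+ 8 * 3 ^+ 6 * 5)) + N 1 1 * P ^+ 4 / (2 ^+ 8 * 3 ^+ 5) - N 1 2 * P ^+
  3 / (2 ^+ 7 * 3 ^+ 4) + N 1 3 * P ^+ 2 / (2 ^+ 7 * 3 ^+ 3) - N 1 4 * P / (2 ^+ 8 * 3 ^+ 2) + N
  1 5 / (2 ^+ 8 * 3 * 5) + N 3 0 * P ^+ 3 / (2 ^+ 5 * 3 ^+ 5) - N 3 1 * P ^+ 2 / 864 + N 3 2 * P
  / 288 - N 3 3 / 288 - N 5 0 * P / 720 + N 5 1 / 240 - 637 / 1296 * Z.
Proof. by unfold_moments; field. Qed.

Lemma wim10 : wim (P / 6) M 1 0 =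
  - (N 1 0).
Proof. by unfold_moments; field. Qed.

Lemma wim30 : wim (P / 6) M 3 0 =
  N 1 0 * P ^+ 2 / 72 - N 1 1 * P / 12 + N 1 2 / 8 - N 3 0 / 6.
Proof. by unfold_moments; field. Qed.

Lemma wim50 : wim (P / 6) M 5 0 =
  - (N 1 0 * P ^+ 4 / (2 ^+ 7 * 3 ^+ 5)) + N 1 1 * P ^+ 3 / (2 ^+ 5 * 3 ^+ 4) - N 1 2 * P ^+ 2 /
  576 + N 1 3 * P / 288 - N 1 4 / 384 + N 3 0 * P ^+ 2 / 432 - N 3 1 * P / 72 + N 3 2 / 48 - N 5
  0 / 120.
Proof. by unfold_moments; field. Qed.

Lemma wim70 : wim (P / 6) M 7 0 =
  N 1 0 * P ^+ 6 / (2 ^+ 10 * 3 ^+ 8 * 5) - N 1 1 * P ^+ 5 / (2 ^+ 9 * 3 ^+ 6 * 5) + N 1 2 * P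
  ^+ 4 / (2 ^+ 10 * 3 ^+ 5) - N 1 3 * P ^+ 3 / (2 ^+ 8 * 3 ^+ 5) + N 1 4 * P ^+ 2 / (2 ^+ 10 * 3
  ^+ 3) - N 1 5 * P / (2 ^+ 9 * 3 ^+ 2 * 5) + N 1 6 / (2 ^+ 10 * 3 ^+ 2 * 5) - N 3 0 * P ^+ 4 /
  (2 ^+ 8 * 3 ^+ 6) + N 3 1 * P ^+ 3 / (2 ^+ 6 * 3 ^+ 5) - N 3 2 * P ^+ 2 / (2 ^+ 7 * 3 ^+ 3) +
  N 3 3 * P / (2 ^+ 6 * 3 ^+ 3) - N 3 4 / (2 ^+ 8 * 3 ^+ 2) + N 5 0 * P ^+ 2 / (2 ^+ 6 * 3 ^+ 3
  * 5) - N 5 1 * P / (2 ^+ 5 * 3 ^+ 2 * 5) + N 5 2 / 960 - N 7 0 / (2 ^+ 4 * 3 ^+ 2 * 5 * 7).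
Proof. by unfold_moments; field. Qed.

Lemma wim31 : wim (P / 6) M 3 1 =
  N 2 1 * P / 12 - N 2 2 / 4 - P ^+ 5 / (2 ^+ 6 * 3 ^+ 6 * 5).
Proof. by unfold_moments; field. Qed.

Lemma wim51 : wim (P / 6) M 5 1 =
  - (N 2 1 * P ^+ 3 / (2 ^+ 5 * 3 ^+ 4)) + N 2 2 * P ^+ 2 / 288 - N 2 3 * P / 96 + N 2 4 / 96 +
  N 4 1 * P / 144 - N 4 2 / 48 + P ^+ 7 / (2 ^+ 9 * 3 ^+ 9 * 5 * 7).
Proof. by unfold_moments; field. Qed.

Lemma wim52 : wim (P / 6) M 5 2 =
  N 1 2 * P ^+ 4 / (2 ^+ 8 * 3 ^+ 5) - N 1 3 * P ^+ 3 / (2 ^+ 6 * 3 ^+ 4) + N 1 4 * P ^+ 2 / (2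
  ^+ 7 * 3 ^+ 2) - N 1 5 * P / 576 + N 1 6 / 768 - N 3 2 * P ^+ 2 / 864 + N 3 3 * P / 144 - N 3
  4 / 96 + N 5 2 / 240.
Proof. by unfold_moments; field. Qed.

Let relE := (inv_im01, inv_im02, inv_im03, inv_im04, inv_im05, inv_im06, inv_im13,
  inv_im14, inv_im15, inv_im24, inv_re02, inv_re03, inv_re04, inv_re05, inv_re13, dist0,
  dist1, dist2, dist4, dist5, wim10, wim30, wim50, wim70, wim31, wim51, wim52).

(* The multipliers of the relations below were found by linear algebra over the
   rational numbers. *)
Lemma zeta2_moment z2 : z2 = P ^+ 2 / 6 - 6 * dist P z2 M 0.
Proof. by rewrite ?relE; field. Qed.

(** The zeta value enters [dist] and [inv_re] with different weights, so eliminating the unknown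
    moments between them leaves an equation that determines it. The value at 6 is found in the same
    way. *)
Lemma zeta4_moment z4 : z4 = P ^+ 4 / 90 + 216 / 125 * dist P z4 M 2
  - 72 / 125 * P * inv_im P M 0 1 - 216 / 125 * inv_re P z4 M 0 2.
Proof. by rewrite ?relE; field. Qed.

Lemma zeta6_moment z6 : z6 = P ^+ 6 / 945
  + (432 * P ^+ 2 * dist P (P ^+ 4 / 90) M 2 + 2 ^+ 5 * 3 ^+ 5 * dist P z6 M 4
     - 96 * P ^+ 3 * inv_im P M 0 1 - 2 ^+ 5 * 3 ^+ 4 * P * inv_im P M 0 3
     - 2 ^+ 5 * 3 ^+ 5 * inv_re P z6 M 0 4) / (5 ^+ 2 * 7 * 23).
Proof. by rewrite ?relE; field. Qed.

(** In this lemma and its successors every term in [dist], [inv_im] or [inv_re] vanishes once P =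
    pi, N = [moment] and the zeta values are the true ones. What then remains is the claimed
    evaluation, with [wim] in place of the imaginary parts of the MCVs. *)
Lemma lnpow_moment0 :
  lnpow_moment (P ^+ 2 / 6) z3 (P ^+ 4 / 90) z5 (P ^+ 6 / 945) z7 M 0 =
  P / 3.
Proof. by rewrite ?relE; unfold_moments; field. Qed.

Lemma lnpow_moment1 :
  lnpow_moment (P ^+ 2 / 6) z3 (P ^+ 4 / 90) z5 (P ^+ 6 / 945) z7 M 1 =
  - (2 * wim (P / 6) M 1 0).
Proof. by rewrite ?relE; unfold_moments; field. Qed.

Lemma lnpow_moment2 :
  lnpow_moment (P ^+ 2 / 6) z3 (P ^+ 4 / 90) z5 (P ^+ 6 / 945) z7 M 2 =
  4 * P ^+ 3 / 27 - 8 * inv_im P M 0 1.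
Proof. by rewrite ?relE; unfold_moments; field. Qed.

Lemma lnpow_moment3 :
  lnpow_moment (P ^+ 2 / 6) z3 (P ^+ 4 / 90) z5 (P ^+ 6 / 945) z7 M 3 =
  - (36 * wim (P / 6) M 3 0) + 2 * P ^+ 2 * wim (P / 6) M 1 0 - 12 * P * dist P z3 M 1 + 12 *
  inv_im P M 0 2.
Proof. by rewrite ?relE; unfold_moments; field. Qed.

Lemma lnpow_moment4 :
  lnpow_moment (P ^+ 2 / 6) z3 (P ^+ 4 / 90) z5 (P ^+ 6 / 945) z7 M 4 =
  - (96 * (wim (P / 6) M 3 1 + z3 * wim (P / 6) M 1 0)) + 134 * P ^+ 5 / 243 + 160 * P * dist P
  (P ^+ 4 / 90) M 2 - 16 / 3 * P ^+ 2 * inv_im P M 0 1 - 384 * inv_im P M 0 3.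
Proof. by rewrite ?relE; unfold_moments; field. Qed.

Lemma lnpow_moment5 :
  lnpow_moment (P ^+ 2 / 6) z3 (P ^+ 4 / 90) z5 (P ^+ 6 / 945) z7 M 5 =
  - (6 * (360 * wim (P / 6) M 5 0 - 20 * P ^+ 2 * wim (P / 6) M 3 0 - P ^+ 4 * wim (P / 6) M 1
  0)) - 160 / 3 * P ^+ 3 * dist P z3 M 1 - 960 * z3 * inv_im P M 0 1 + 80 * P ^+ 2 * inv_im P M
  0 2 - 240 * P * inv_re P z5 M 0 3 + 2 ^+ 4 * 3 * 5 * 7 * inv_im P M 0 4 - 960 * inv_im P M 1 3.
Proof. by rewrite ?relE; unfold_moments; field. Qed.

Lemma lnpow_moment6 :
  lnpow_moment (P ^+ 2 / 6) z3 (P ^+ 4 / 90) z5 (P ^+ 6 / 945) z7 M 6 =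
  - (2 ^+ 6 * 3 ^+ 3 * 5 * (wim (P / 6) M 5 1 + z3 * wim (P / 6) M 3 0 + z5 * wim (P / 6) M 1
  0)) + 480 * P ^+ 2 * (wim (P / 6) M 3 1 + z3 * wim (P / 6) M 1 0) + 2 ^+ 2 * 5 * 13 ^+ 2 * P
  ^+ 7 / 729 - 2 ^+ 6 * 3 ^+ 2 * 5 * P * z3 * dist P z3 M 1 - 320 * P ^+ 3 * dist P (P ^+ 4 /
  90) M 2 + 2 ^+ 8 * 3 * 5 ^+ 2 * P * dist P (P ^+ 6 / 945) M 4 + 2 ^+ 5 * 37 / 27 * P ^+ 4 *
  inv_im P M 0 1 + 2 ^+ 6 * 3 ^+ 2 * 5 * z3 * inv_im P M 0 2 - 640 * P ^+ 2 * inv_im P M 0 3 - 2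
  ^+ 10 * 3 ^+ 2 * 5 * inv_im P M 0 5 - 960 * P * inv_re P (5 / 2 * (P ^+ 6 / 945) - P ^+ 2 / 6
  * (P ^+ 4 / 90) - z3 ^+ 2 / 2) M 1 3 + 2 ^+ 6 * 3 ^+ 2 * 5 * inv_im P M 1 4.
Proof. by rewrite ?relE; unfold_moments; field. Qed.

Lemma lnpow_moment7 :
  lnpow_moment (P ^+ 2 / 6) z3 (P ^+ 4 / 90) z5 (P ^+ 6 / 945) z7 M 7 =
  - (2 / 3 * (2 ^+ 4 * 3 ^+ 4 * 5 * 7 * wim (P / 6) M 7 0 - 2 ^+ 3 * 3 * 5 * 7 * 23 * P ^+ 2 *
  wim (P / 6) M 5 0 - 2 * 3 ^+ 4 * 7 * P ^+ 4 * wim (P / 6) M 3 0 + (2 ^+ 5 * 3 ^+ 3 * 5 * 7 *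
  z3 ^+ 2 - 79 * P ^+ 6) * wim (P / 6) M 1 0)) - 2 ^+ 7 * 3 ^+ 2 * 5 * 7 * (wim (P / 6) M 5 2 +
  z3 * wim (P / 6) M 3 1) - 140 / 81 * P * (3 * 5 * 659 * z7 + 2 ^+ 3 * 3 ^+ 3 * 7 * P ^+ 2 * z5
  + 68 * P ^+ 4 * z3) - 2 ^+ 3 * 5 * 7 * 101 / 27 * P ^+ 5 * dist P z3 M 1 + 2 ^+ 7 * 3 * 5 ^+ 2
  * 7 * P * z3 * dist P (P ^+ 4 / 90) M 2 + 2 ^+ 6 * 3 * 5 ^+ 2 * 7 * P * dist P z7 M 5 - 2 ^+ 7
  * 3 ^+ 3 * 5 * 7 * z5 * inv_im P M 0 1 - 2 ^+ 6 * 5 * 7 * P ^+ 2 * z3 * inv_im P M 0 1 + 2 ^+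
  4 * 7 * 353 / 27 * P ^+ 4 * inv_im P M 0 2 - 2 ^+ 9 * 3 ^+ 2 * 5 * 7 * z3 * inv_im P M 0 3 - 2
  ^+ 5 * 5 * 7 * 13 / 3 * P ^+ 3 * inv_re P z5 M 0 3 + 2 ^+ 5 * 3 * 5 * 7 * 11 * P ^+ 2 * inv_im
  P M 0 4 - 2 ^+ 5 * 3 * 5 * 7 * 19 * P * inv_re P z7 M 0 5 + 2 ^+ 5 * 3 ^+ 2 * 5 * 7 * 61 *
  inv_im P M 0 6 - 2 ^+ 9 * 5 * 7 * P ^+ 2 * inv_im P M 1 3 - 2 ^+ 7 * 3 ^+ 2 * 5 * 7 ^+ 2 *
  inv_im P M 1 5 + 2 ^+ 8 * 3 ^+ 2 * 5 * 7 * inv_im P M 2 4.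
Proof. by rewrite ?relE; unfold_moments; field. Qed.

End MomentCertificates.

(** * The relations at the true moments, and the resulting values *)

Section Evaluation.
Context {R : realType}.
Implicit Types (n p a b i j k : nat).
Local Notation Re := (@complex.Re R).
Local Notation Im := (@complex.Im R).
Local Notation Mpi := (moment_fun pi (@moment R)).

Let MpiE : @moment R = Mpi.
Proof. by apply/funext => -[|j]; apply/funext => k //; exact: moment0. Qed.

Lemma inv_im_eq0 a b : inv_im pi Mpi a b = 0.
Proof. by rewrite -MpiE inv_im_moment. Qed.

Lemma dist_eq0 n : dist pi (zeta n.+2) Mpi n = 0.
Proof. by rewrite -MpiE dist_moment. Qed.

Lemma inv_re_eq0 n : inv_re pi (zeta n.+2) Mpi 0 n = 0.
Proof. by rewrite -MpiE -Re_nielsen1_zeta inv_re_moment. Qed.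

Lemma zeta2 : zeta 2 = pi ^+ 2 / 6 :> R.
Proof. by rewrite (zeta2_moment pi moment (zeta 2)) dist_eq0 mulr0 subr0. Qed.

Lemma zeta4 : zeta 4 = pi ^+ 4 / 90 :> R.
Proof.
rewrite (zeta4_moment pi moment (zeta 4)) dist_eq0 inv_im_eq0 inv_re_eq0.
by rewrite !mulr0 !subr0 addr0.
Qed.

Lemma zeta6 : zeta 6 = pi ^+ 6 / 945 :> R.
Proof.
rewrite (zeta6_moment pi moment (zeta 6)) -zeta4 !dist_eq0 !inv_im_eq0 inv_re_eq0.
by rewrite !mulr0 !subr0 addr0 mul0r addr0.
Qed.

(** Among the real inversion relations in use, this one alone has a double sum at 1, [nielsen 4 1],
    in place of a simple zeta value; Euler's evaluation enters here. *)
Lemma inv_re13_eq0 :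
  inv_re pi (5 / 2 * (pi ^+ 6 / 945) - pi ^+ 2 / 6 * (pi ^+ 4 / 90) - zeta 3 ^+ 2 / 2) Mpi 1 3 = 0.
Proof.
rewrite -zeta2 -zeta4 -zeta6 -MpiE -[X in inv_re _ X _ _ _](_ : Re (nielsen 4 1 (1 : R[i])) = _).
  exact: inv_re_moment.
by rewrite nielsen1_weight6.
Qed.

Lemma A_lnpow_moment n : (n < 8)%N -> A_exists R 1 n /\
  A 1 n = lnpow_moment (pi ^+ 2 / 6) (zeta 3) (pi ^+ 4 / 90) (zeta 5) (pi ^+ 6 / 945) (zeta 7) Mpi n
    / Num.sqrt 3.
Proof.
move=> n8; rewrite /lnpow_moment rfactE; apply: A_of_Jint; rewrite nsumE.
apply: (Jint_sum (f := fun i t => ccoef (n - i) * lnpow i t)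
  (a := fun i => cval (pi ^+ 2 / 6) (zeta 3) (pi ^+ 4 / 90) (zeta 5) (pi ^+ 6 / 945) (zeta 7) (n - i)
     * (2 ^+ i / rfact i) * Mpi i 0)) => i iltn.
rewrite -mulrA ccoef_val; last by rewrite (leq_ltn_trans (leq_subr _ _)).
rewrite zeta2 zeta4 zeta6; apply: JintZ; rewrite rfactE -MpiE.
apply: Jint_ext (JintZ (2 ^+ i / i`!%:R) (Jint_moment i 0)) => t _.
rewrite /lnpow /lnsin expr0 mulr1 mulrAC -exprMn mulrA.
have -> : 2 * (1 / 2) * ln (ysin t) = ln (ysin t) by field.
by [].
Qed.

Lemma Im_mu n p : Im (mu n.+2 (nseq p 1%N)) = wim (pi / 6) Mpi n.+1 p.
Proof. by rewrite -MpiE Im_mu_moment. Qed.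

Lemma ImZ (x : R) z : Im (x%:C%C * z) = x * Im z.
Proof. by rewrite ImM /= mul0r addr0. Qed.

End Evaluation.

Local Close Scope classical_set_scope.
Local Open Scope complex_scope.

Theorem mainTheorem5 (R : realType) :
  (forall n : nat, (n <= 7)%N -> A_exists R 1 n) /\
  A 1 0 = pi / (3 * Num.sqrt 3) :> R /\
  A 1 1 = - (2 * complex.Im (mu 2 [::]) / Num.sqrt 3) :> R /\
  A 1 2 = 2 ^+ 2 * pi ^+ 3 / (3 ^+ 3 * Num.sqrt 3) :> R /\
  A 1 3 = - (2 * complex.Im (2 * 3 ^+ 2 * mu 4 [::] - (pi ^+ 2)%:C * mu 2 [::])
             / Num.sqrt 3) :> R /\
  A 1 4 = - (2 ^+ 5 * 3 * complex.Im (mu 4 [:: 1%N] + (zeta 3)%:C * mu 2 [::])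
             / Num.sqrt 3)
          + 2 * 67 * pi ^+ 5 / (3 ^+ 5 * Num.sqrt 3) :> R /\
  A 1 5 = - (2 * 3 * complex.Im (2 ^+ 3 * 3 ^+ 2 * 5 * mu 6 [::]
                                 - 2 ^+ 2 * 5 * (pi ^+ 2)%:C * mu 4 [::]
                                 - (pi ^+ 4)%:C * mu 2 [::])
             / Num.sqrt 3) :> R /\
  A 1 6 = - (2 ^+ 6 * 3 ^+ 3 * 5
             * complex.Im (mu 6 [:: 1%N] + (zeta 3)%:C * mu 4 [::]
                           + (zeta 5)%:C * mu 2 [::])
             / Num.sqrt 3)
          + 2 ^+ 5 * 3 * 5 * pi ^+ 2
             * complex.Im (mu 4 [:: 1%N] + (zeta 3)%:C * mu 2 [::])
             / Num.sqrt 3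
          + 2 ^+ 2 * 5 * 13 ^+ 2 * pi ^+ 7 / (3 ^+ 6 * Num.sqrt 3) :> R /\
  A 1 7 = - (2 * complex.Im
               (2 ^+ 4 * 3 ^+ 4 * 5 * 7 * mu 8 [::]
                - 2 ^+ 3 * 3 * 5 * 7 * 23 * (pi ^+ 2)%:C * mu 6 [::]
                - 2 * 3 ^+ 4 * 7 * (pi ^+ 4)%:C * mu 4 [::]
                + (2 ^+ 5 * 3 ^+ 3 * 5 * 7 * (zeta 3 ^+ 2)%:C
                   - 79 * (pi ^+ 6)%:C) * mu 2 [::])
             / (3 * Num.sqrt 3))
          - 2 ^+ 7 * 3 ^+ 2 * 5 * 7
             * complex.Im (mu 6 [:: 1%N; 1%N] + (zeta 3)%:C * mu 4 [:: 1%N])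
             / Num.sqrt 3
          - 2 ^+ 2 * 5 * 7 * pi
             * (3 * 5 * 659 * zeta 7
                + 2 ^+ 3 * 3 ^+ 3 * 7 * pi ^+ 2 * zeta 5
                + 2 ^+ 2 * 17 * pi ^+ 4 * zeta 3)
             / (3 ^+ 4 * Num.sqrt 3) :> R.
Proof.
have AE n (n8 : (n < 8)%N) := (@A_lnpow_moment R n n8).2.
have s0 : Num.sqrt 3 != 0 :> R by rewrite sqrtr_eq0 -ltNge.
have natC n : n%:R = (n%:R : R)%:C :> R[i] by rewrite rmorph_nat.
have XC (x : R) n : x%:C ^+ n = (x ^+ n)%:C by rewrite rmorphXn.
have MC (x y : R) : x%:C * y%:C = (x * y)%:C by rewrite rmorphM.
have BC (x y : R) : x%:C - y%:C = (x - y)%:C by rewrite rmorphB.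
have mu2 := @Im_mu R 0 0; have mu4 := @Im_mu R 2 0; have mu6 := @Im_mu R 4 0.
have mu8 := @Im_mu R 6 0; have mu41 := @Im_mu R 2 1; have mu61 := @Im_mu R 4 1.
have mu611 := @Im_mu R 4 2; rewrite /= in mu2 mu4 mu6 mu8 mu41 mu61 mu611.
split; first by move=> n n7; have [] := @A_lnpow_moment R n n7.
rewrite !AE// lnpow_moment0 lnpow_moment1 lnpow_moment2 lnpow_moment3 lnpow_moment4.
(* Turning pi^4 / 90 and pi^6 / 945 back into zeta values gives the arguments of [dist] the shape of
   [dist_eq0]. Once all relation terms are gone, only constants and the [wim] terms are left, and
   [Im_mu] recognises the latter as imaginary parts of MCVs. *)
rewrite lnpow_moment5 lnpow_moment6 lnpow_moment7 inv_re13_eq0 -zeta4 -zeta6.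
rewrite !dist_eq0 !inv_im_eq0 !inv_re_eq0.
rewrite !(natC, XC) !MC !BC !(ImD, ImN) !ImZ mu2 mu4 mu6 mu8 mu41 mu61 mu611.
move: (wim _ _ 1 0) (wim _ _ 3 0) (wim _ _ 5 0) (wim _ _ 7 0) (wim _ _ 3 1) (wim _ _ 5 1) (wim _ _ 5 2).
move: (zeta 3) (zeta 5) (zeta 7) (pi : R) (Num.sqrt 3) s0 => z3 z5 z7 P s s0 w2 w4 w6 w8 w41 w61 w611.
repeat split; by field.
Qed.
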